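(* We have $$\left(\hat{\tilde{\boldsymbol{\theta}}}^n-\tilde{\boldsymbol{\theta}}\right)^T\left[\tilde J^n(\hat{\boldsymbol{\theta}}^n)\right]\left(\hat{\tilde{\boldsymbol{\theta}}}^n-\tilde{\boldsymbol{\theta}}\right)\Rightarrow_u\mathbf{z}^T\mathbf{z}\qquad(n\to\infty),$$ where $\mathbf z$ is a standard normal random vector on $\mathbb{R}^{2(p-1)}$. That is, for every $\boldsymbol{\theta}\in\mathbb{R}^{m+2(p-1)}$ and every sequence of parameters $\boldsymbol{\theta}^n\to\boldsymbol{\theta}$, the quadratic form on the left, computed with $\tilde{\boldsymbol{\theta}}$ replaced by the bias components $\tilde{\boldsymbol{\theta}}^n$ of $\boldsymbol{\theta}^n$ and with the data distributed according to $\mathbb{P}_{\boldsymbol{\theta}^n}$, converges in distribution to $\mathbf z^T\mathbf z$.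
   Context: Model. Fix integers $p\ge2$ (laboratories; laboratory 1 is the reference) and $m\ge2$ (levels), and known positive constants $\sigma^2_{x_j}$ and $\sigma^2_{ij}$ ($i=1,\dots,p$, $j=1,\dots,m$). The parameter is $\boldsymbol{\theta}=(\mu_{x_1},\dots,\mu_{x_m},\alpha_2,\dots,\alpha_p,\beta_2,\dots,\beta_p)^T\in\mathbb{R}^{m+2(p-1)}$, with bias components $\tilde{\boldsymbol{\theta}}=(\alpha_2,\dots,\alpha_p,\beta_2,\dots,\beta_p)^T$; put $\alpha_1=0$, $\beta_1=1$. The unobserved variables $x_j\sim N(\mu_{x_j},\sigma^2_{x_j})$ and the errors $e_{ijk}\sim N(0,\sigma^2_{ij})$ are all mutually independent, and the observations are $Y_{ijk}=\alpha_i+\beta_i x_j+e_{ijk}$, $k=1,\dots,n_i$, $i=1,\dots,p$, $j=1,\dots,m$. Put $n=\sum_{i=1}^p n_i$, and let $\mathbf{Y}^n$ be the vector of all observations. The limit $n\to\infty$ means that $n_i\to\infty$ and $n_i/n\to w_i$ for every $i$, with $w_i>0$ constants. $\mathbb{P}_{\boldsymbol{\theta}}$ denotes the law of the observed data under parameter $\boldsymbol{\theta}$. $L^n(\boldsymbol{\theta})=\log f_{\mathbf{Y}^n}(\mathbf{Y}^n,\boldsymbol{\theta})$ is the log-likelihood of the observed data (the marginal normal density of $\mathbf{Y}^n$, with $x_1,\dots,x_m$ integrated out), $J^n(\boldsymbol{\theta})=-\frac{\partial^2L^n(\boldsymbol{\theta})}{\partial\boldsymbol{\theta}\,\partial\boldsymbol{\theta}^T}$,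 and $\tilde J^n(\boldsymbol{\theta})$ is the $2(p-1)\times2(p-1)$ submatrix of $J^n(\boldsymbol{\theta})$ obtained by deleting the rows and columns associated with $\mu_{x_1},\dots,\mu_{x_m}$. $\hat{\boldsymbol{\theta}}^n$ is the maximum likelihood estimator (a maximizer of $L^n$ over $\mathbb{R}^{m+2(p-1)}$) and $\hat{\tilde{\boldsymbol{\theta}}}^n$ is its bias part (its last $2(p-1)$ components). *)

(* Defs.v *)
From HB Require Import structures.
From mathcomp Require Import all_boot all_order all_algebra.
From mathcomp Require Import all_classical all_reals all_analysis.

Set Implicit Arguments.
Unset Strict Implicit.
Unset Printing Implicit Defensive.

Import Order.TTheory GRing.Theory Num.Theory.
Import numFieldNormedType.Exports.

Local Open Scope classical_set_scope.
Local Open Scope ring_scope.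

(** Probability *)

(* Only measurable sets are compared: the values of a measure elsewhere are
   unspecified. The last argument is the variance, while [normal_prob] takes
   the standard deviation. *)
Definition has_normal_law (R : realType) (d : measure_display)
    (T : measurableType d) (P : probability T R) (X : {RV P >-> R})
    (mu s2 : R) : Prop :=
  forall A : set R, measurable A ->
    distribution P X A = normal_prob mu (Num.sqrt s2) A.

Definition mutually_independent (R : realType) (d : measure_display)
    (T : measurableType d) (P : probability T R) (I : finType)
    (X : I -> {RV P >-> R}) : Prop :=
  forall (J : {set I}) (A : I -> set R), (forall i, measurable (A i)) ->
    P [set t | forall i, i \in J -> A i (X i t)]
    = (\prod_(i in J) P (X i @^-1` A i))%E.

Definition standard_normal_vector (R : realType) (d : measure_display)
    (T : measurableType d) (P : probability T R) (q : nat)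
    (z : 'I_q -> {RV P >-> R}) : Prop :=
  (forall a, has_normal_law (z a) 0 1) /\ mutually_independent z.

(* The variables [X v] may live on different probability spaces. Their
   measurability is only required from some rank on. *)
Definition cvg_in_distribution (R : realType)
    (d : nat -> measure_display) (T : forall v, measurableType (d v))
    (P : forall v, probability (T v) R) (X : forall v, T v -> R)
    (d' : measure_display) (T' : measurableType d') (P' : probability T' R)
    (X' : T' -> R) : Prop :=
  [/\ \forall v \near \oo, measurable_fun [set: T v] (X v),
      measurable_fun [set: T'] X' &
      forall f : R -> R, continuous f -> (exists M, forall x, `|f x| <= M) ->
        (\int[P v]_t (f (X v t))%:E)%E @[v --> \oo]
          --> (\int[P']_t (f (X' t))%:E)%E].

(** The calibration model; the reference laboratory has index 0 in ['I_p]. *)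

Definition param (R : realType) (p m : nat) := 'rV[R]_(m + (p.-1 + p.-1)).

(* Laboratory [l.+1] reads component [l] of [v], the reference reads [c]. *)
Definition with_reference (R : realType) (p : nat) (c : R) (v : 'rV[R]_p.-1)
    (i : 'I_p) : R :=
  if nat_of_ord i is l.+1 then
    (if @insub nat (fun l => (l < p.-1)%N) 'I_p.-1 l is Some l' then v 0 l'
     else c)
  else c.

Definition level_mean (R : realType) (p m : nat) (theta : param R p m)
    (j : 'I_m) : R := lsubmx theta 0 j.

Definition bias (R : realType) (p m : nat) (theta : param R p m) :
  'rV[R]_(p.-1 + p.-1) := rsubmx theta.

Definition alpha (R : realType) (p m : nat) (theta : param R p m) :
  'I_p -> R := with_reference 0 (lsubmx (bias theta)).

Definition beta (R : realType) (p m : nat) (theta : param R p m) :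
  'I_p -> R := with_reference 1 (rsubmx (bias theta)).

Definition sample (R : realType) (p m : nat) (n : 'I_p -> nat) :=
  forall i : 'I_p, 'I_m -> 'I_(n i) -> R.

Definition observations (R : realType) (p m : nat) (n : 'I_p -> nat)
    (theta : param R p m) (x : 'I_m -> R) (e : sample R m n) :
    sample R m n :=
  fun i j k => alpha theta i + beta theta i * x j + e i j k.

Definition source (p m : nat) (n : 'I_p -> nat) : finType :=
  ('I_m + {i : 'I_p & 'I_m * 'I_(n i)})%type.

Definition all_sources (U : Type) (p m : nat) (n : 'I_p -> nat)
    (x : 'I_m -> U) (e : forall i : 'I_p, 'I_m -> 'I_(n i) -> U)
    (s : source m n) : U :=
  match s with
  | inl j => x j
  | inr (existT i jk) => e i jk.1 jk.2
  end.

Definition model_sources (R : realType) (p m : nat) (n : 'I_p -> nat)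
    (s2x : 'I_m -> R) (s2 : 'I_p -> 'I_m -> R) (theta : param R p m)
    (d : measure_display) (T : measurableType d) (P : probability T R)
    (x : 'I_m -> {RV P >-> R})
    (e : forall i : 'I_p, 'I_m -> 'I_(n i) -> {RV P >-> R}) : Prop :=
  [/\ forall j, has_normal_law (x j) (level_mean theta j) (s2x j),
      forall i j k, has_normal_law (e i j k) 0 (s2 i j) &
      mutually_independent (all_sources x e)].

(** Likelihood *)

(* Iterated Lebesgue integral over R^m; by Tonelli, for nonnegative measurable
   [g], the integral against m-dimensional Lebesgue measure. *)
Fixpoint iterated_integral (R : realType) (m : nat) :
    ('rV[R]_m -> \bar R) -> \bar R :=
  match m with
  | 0 => fun g => g 0
  | m'.+1 => fun g =>
      (\int[@lebesgue_measure R]_t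
         iterated_integral
           (fun u : 'rV[R]_m' => g (row_mx (const_mx t : 'rV[R]_1) u)))%E
  end.

(* Joint density of the latent levels [u] and of the data [y]. *)
Definition complete_density (R : realType) (p m : nat) (n : 'I_p -> nat)
    (s2x : 'I_m -> R) (s2 : 'I_p -> 'I_m -> R) (y : sample R m n)
    (theta : param R p m) (u : 'rV[R]_m) : R :=
  (\prod_j normal_pdf (level_mean theta j) (Num.sqrt (s2x j)) (u 0 j))
  * \prod_i \prod_j \prod_k
      normal_pdf (alpha theta i + beta theta i * u 0 j) (Num.sqrt (s2 i j))
        (y i j k).

Definition loglik (R : realType) (p m : nat) (n : 'I_p -> nat)
    (s2x : 'I_m -> R) (s2 : 'I_p -> 'I_m -> R) (y : sample R m n)
    (theta : param R p m) : R :=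
  ln (fine (iterated_integral
              (fun u => (complete_density s2x s2 y theta u)%:E))).

Definition maximizes_loglik (R : realType) (p m : nat) (n : 'I_p -> nat)
    (s2x : 'I_m -> R) (s2 : 'I_p -> 'I_m -> R) (y : sample R m n)
    (theta : param R p m) : Prop :=
  forall theta' : param R p m, loglik s2x s2 y theta' <= loglik s2x s2 y theta.

Definition hessian (R : realType) (q : nat) (f : 'rV[R]_q -> R)
    (theta : 'rV[R]_q) : 'M[R]_q :=
  \matrix_(a, b)
    'D_(delta_mx 0 a : 'rV[R]_q)
      (fun t : 'rV[R]_q => 'D_(delta_mx 0 b : 'rV[R]_q) f t) theta.

Definition obs_information (R : realType) (p m : nat) (n : 'I_p -> nat)
    (s2x : 'I_m -> R) (s2 : 'I_p -> 'I_m -> R) (y : sample R m n)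
    (theta : param R p m) : 'M[R]_(m + (p.-1 + p.-1)) :=
  - hessian (loglik s2x s2 y) theta.

Definition bias_information (R : realType) (p m : nat) (n : 'I_p -> nat)
    (s2x : 'I_m -> R) (s2 : 'I_p -> 'I_m -> R) (y : sample R m n)
    (theta : param R p m) : 'M[R]_(p.-1 + p.-1) :=
  drsubmx (obs_information s2x s2 y theta).

Definition quadratic_form (R : realType) (q : nat) (A : 'M[R]_q)
    (v : 'rV[R]_q) : R := (v *m A *m v^T) 0 0.

Definition is_mle (R : realType) (p m : nat) (n : 'I_p -> nat)
    (s2x : 'I_m -> R) (s2 : 'I_p -> 'I_m -> R)
    (thetahat : sample R m n -> param R p m) : Prop :=
  forall y : sample R m n, maximizes_loglik s2x s2 y (thetahat y).

(* Borel measurability in R^q, coordinatewise. *)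
Definition random_vector (R : realType) (d : measure_display)
    (T : measurableType d) (q : nat) (V : T -> 'rV[R]_q) : Prop :=
  forall a, measurable_fun [set: T] (fun t => V t 0 a).

(* Main.v *)
Require Import Defs.
From HB Require Import structures.
From mathcomp Require Import all_boot all_order all_algebra.
From mathcomp Require Import all_classical all_reals all_analysis.
From mathcomp Require Import measurable_realfun.
From mathcomp Require Import ring lra.

Set Implicit Arguments.
Unset Strict Implicit.
Unset Printing Implicit Defensive.

Import Order.TTheory GRing.Theory Num.Theory.
Import numFieldNormedType.Exports.

Local Open Scope classical_set_scope.
Local Open Scope ring_scope.

(** Integrating out the latent levels reduces the log-likelihood to the sample
    means Ybar_ij = alpha_i + beta_i x_j + zeta_ij / sqrt n, and -2 log-likelihood
    is, up to a constant, a sum over levels of log-precisions and of least-squares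
    criteria whose minimizers are the estimated levels.

    Restrict to the event, of probability close to 1 uniformly in the sequence,
    that x_j and zeta_ij are bounded and x_1, x_2 are separated. There every
    bounded quantity converges along an ultrafilter. Comparing the maximizer with
    the value of the likelihood at the true bias and at mu_j = x_j gives root-n
    consistency, and the first order condition then shows that the Wald form and
    the score form U^T J^-1 U have a common limit, where J and U are the Gram
    matrix and the score of the weighted regression of zeta on the bias directions
    with one nuisance coefficient per level. Hence, by contradiction, the two forms
    are uniformly close.

    Given the levels x, U is a linear image A E of the standardized errors with
    A A^T = J. Rotating E by Givens rotations whose angles depend only on x makes
    A lower triangular, and U^T J^-1 U is then exactly a sum of squares of 2(p-1)
    independent standard normal variables, although J itself remains random in
    the limit. *)

(** * Gaussian measures and rotations *)

(** Each level is drawn only once, so the levels are not averaged out as the samples grow: their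
    means are not consistently estimable and the information keeps depending on x. Instead, the
    asymptotics are deterministic and the probability is exact: on the good event the two forms are
    compared for every realization and every maximizer, and the score form equals there a sum whose
    chi-square law is exact at each rank, so no central limit theorem intervenes.

    Two features of the design provide compactness. The reference slope is 1 under every parameter,
    which bounds the estimated log-precisions from below and pins the estimated levels, whatever the
    other estimated slopes are. Two separated levels then tell intercept errors from slope
    errors. *)

Lemma integral_lebesgue_affine (R : realType) (s : {posnum R}) (c : R)
    (f : R -> \bar R) :
  measurable_fun [set: R] f -> (forall x, 0 <= f x)%E ->
  (\int[lebesgue_measure]_x f x
   = \int[lebesgue_measure]_x ((s%:num)%:E * f (s%:num * x + c)%R))%E.
Proof.
move=> mf f0.
pose phi (x : measurableTypeR R) : measurableTypeR R := s%:num * x + c.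
have mphi : measurable_fun [set: measurableTypeR R] phi.
  by apply: measurable_funD => //; exact: measurable_funM.
unshelve epose (smu := mscale (s%:num)%:nng
  (pushforward (@lebesgue_measure R) phi)
  : {measure set (measurableTypeR R) -> \bar R}).
  exact: mphi.
have smuE A : measurable A -> lebesgue_measure A = smu A.
  apply: lebesgue_measure_unique => X.
  case=> -[a b] /= _ <-.
  rewrite /smu /= /mscale/= /pushforward.
  have -> : phi @^-1` `]a, b]
      = `](a - c) / s%:num, (b - c) / s%:num]%classic.
    apply/seteqP; split => x /=; rewrite !in_itv/= /phi ltr_pdivrMr//
      ler_pdivlMr// ltrBlDr lerBrDr (mulrC x) //.
  rewrite !lebesgue_measure_itv/= !lte_fin.
  rewrite ltr_pM2r ?invr_gt0// ltrD2r.
  case: ifPn => ab; last by rewrite mule0.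
  rewrite -!EFinB -EFinM; congr EFin.
  by field.
transitivity (\int[smu]_x f x)%E.
  by apply: eq_measure_integral => A mA _; exact: smuE.
rewrite ge0_integral_mscale// ge0_integral_pushforward//.
rewrite preimage_setT ge0_integralZl//.
exact: measurableT_comp.
Qed.

Lemma integral_lebesgue_shift (R : realType) (c : R) (f : R -> \bar R) :
  measurable_fun [set: R] f -> (forall x, 0 <= f x)%E ->
  (\int[lebesgue_measure]_x f x = \int[lebesgue_measure]_x f (x + c)%R)%E.
Proof.
move=> mf f0; rewrite (integral_lebesgue_affine 1%:pos c) //.
by apply: eq_integral => x _ /=; rewrite mul1e mul1r.
Qed.

(** The Radon-Nikodym derivative is determined only almost everywhere; it agrees with [normal_pdf]
    because both have the same integral over every measurable set. *)
Lemma integral_normal_prob (R : realType) (m s : R) (f : R -> \bar R) :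
  (normal_prob m s).-integrable [set: R] f ->
  (\int[normal_prob m s]_x f x
   = \int[lebesgue_measure]_x (f x * (normal_pdf m s x)%:E))%E.
Proof.
move=> fi.
pose nu : {finite_measure set (measurableTypeR R) -> \bar R} := normal_prob m s.
have numu : nu `<< (@lebesgue_measure R) by exact: normal_prob_dominates.
have mpdf : measurable_fun [set: R] (fun x => (normal_pdf m s x)%:E).
  by apply/measurable_EFinP; exact: measurable_normal_pdf.
rewrite -(Radon_Nikodym_change_of_variables numu)//.
apply: ae_eq_integral => //.
- apply: emeasurable_funM; first exact: measurable_int fi.
  exact: measurable_int (Radon_Nikodym_integrable _).
- apply: emeasurable_funM; first exact: measurable_int fi.
  exact: mpdf.
- apply: ae_eqe_mul2l.
  apply: integral_ae_eq => //.
  + exact: Radon_Nikodym_integrable.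
  + by move=> E _ mE; rewrite -Radon_Nikodym_integral.
Qed.

Lemma normal_pdf01 (R : realType) (x : R) :
  normal_pdf 0 1 x = normal_peak 1 * expR (- x ^+ 2 / 2).
Proof. by rewrite normal_pdfE ?oner_neq0// /normal_fun subr0 expr1n. Qed.

Section Shear.
Variable (R : realType).
Local Notation mu := (@lebesgue_measure R).
Implicit Types F : R * R -> \bar R.

Let measurable_pair F (g h : R * R -> R) :
  measurable_fun [set: R * R] F -> measurable_fun [set: R * R] g ->
  measurable_fun [set: R * R] h ->
  measurable_fun [set: R * R] (fun z => F (g z, h z)).
Proof.
move=> mF mg mh.
by apply: (measurableT_comp mF); exact: measurable_fun_pair.
Qed.

Lemma integral_shear2 F (t : R) :
  measurable_fun [set: R * R] F -> (forall z, 0 <= F z)%E ->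
  (\int[mu]_x \int[mu]_y F (x, y + t * x)%R
   = \int[mu]_x \int[mu]_y F (x, y))%E.
Proof.
move=> mF F0; apply: eq_integral => x _.
rewrite [RHS](integral_lebesgue_shift (t * x))//.
exact: (measurableT_comp mF).
Qed.

(** The shear moves the outer variable, so Tonelli first makes it the inner one, where the shear is
    a translation. *)
Lemma integral_shear1 F (t : R) :
  measurable_fun [set: R * R] F -> (forall z, 0 <= F z)%E ->
  (\int[mu]_x \int[mu]_y F (x + t * y, y)%R
   = \int[mu]_x \int[mu]_y F (x, y))%E.
Proof.
move=> mF F0.
rewrite (@fubini_tonelli _ _ _ _ _ mu mu (fun z => F (z.1 + t * z.2, z.2)%R))//; last first.
  apply: measurable_pair => //; apply: measurable_funD => //.
  exact: measurable_funM.
rewrite (@fubini_tonelli _ _ _ _ _ mu mu F)//.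
apply: eq_integral => y _ /=.
rewrite [RHS](integral_lebesgue_shift (t * y))//.
exact: (measurableT_comp mF).
Qed.

(* A rotation that is not a half-turn is a product of three shears. *)
Lemma integral_rotation F (c s : R) :
  c ^+ 2 + s ^+ 2 = 1 -> s != 0 ->
  measurable_fun [set: R * R] F -> (forall z, 0 <= F z)%E ->
  (\int[mu]_x \int[mu]_y F (c * x + s * y, c * y - s * x)%R
   = \int[mu]_x \int[mu]_y F (x, y))%E.
Proof.
move=> cs1 s0 mF F0.
(* [t] is the tangent of half the rotation angle; the three shears have parameters [t], [- s] and
   [t]. *)
pose t := (1 - c) / s.
pose F1 z := F (z.1 + t * z.2, z.2)%R.
pose F2 z := F1 (z.1, z.2 + (- s) * z.1)%R.
have mF1 : measurable_fun [set: R * R] F1.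
  apply: measurable_pair => //; apply: measurable_funD => //.
  exact: measurable_funM.
have mF2 : measurable_fun [set: R * R] F2.
  apply: measurable_pair => //; apply: measurable_funD => //.
  exact: measurable_funM.
have F1_ge0 z : (0 <= F1 z)%E by exact: F0.
have F2_ge0 z : (0 <= F2 z)%E by exact: F0.
have e1 : (\int[mu]_x \int[mu]_y F1 (x, y) = \int[mu]_x \int[mu]_y F (x, y))%E
  := integral_shear1 t mF F0.
have e2 : (\int[mu]_x \int[mu]_y F2 (x, y) = \int[mu]_x \int[mu]_y F1 (x, y))%E
  := integral_shear2 (- s) mF1 F1_ge0.
rewrite -e1 -e2 -(integral_shear1 t mF2 F2_ge0).
have ts : t * s = 1 - c by rewrite /t divfK.
have ct : (1 + c) * t = s.
  apply: (mulIf s0); rewrite -mulrA ts -[RHS]expr2.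
  have -> : s ^+ 2 = 1 - c ^+ 2 by rewrite -cs1 addrAC subrr add0r.
  by ring.
apply: eq_integral => x _; apply: eq_integral => y _.
rewrite /F2 /F1 /=; congr (F (_, _)); clearbody t.
  transitivity (x + t * y + t * y - (t * s) * x - (t * s) * (t * y)).
    by rewrite ts -{1}ct; ring.
  by ring.
transitivity (y - s * x - (t * s) * y); last by ring.
by rewrite ts; ring.
Qed.

(** The product density depends only on x^2 + y^2, which the rotation preserves, so it remains to
    rotate Lebesgue measure. *)
Lemma normal_prob_rotation (c s : R) (A B : set R) :
  c ^+ 2 + s ^+ 2 = 1 -> s != 0 -> measurable A -> measurable B ->
  ((normal_prob 0 1 \x normal_prob 0 1)
    [set z : R * R | A (c * z.1 + s * z.2)%R /\ B (c * z.2 - s * z.1)%R]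
   = normal_prob 0 1 A * normal_prob 0 1 B)%E.
Proof.
move=> cs1 s0 mA mB.
set Z := [set z | _].
have mZ : measurable Z.
  rewrite (_ : Z = ((fun z : R * R => c * z.1 + s * z.2) @^-1` A) `&`
    ((fun z : R * R => c * z.2 - s * z.1) @^-1` B)) //.
  apply: measurableI; rewrite -[X in measurable X]setTI.
    suff: measurable_fun [set: R * R] (fun z => c * z.1 + s * z.2) by exact.
    by apply: measurable_funD; exact: measurable_funM.
  suff: measurable_fun [set: R * R] (fun z => c * z.2 - s * z.1) by exact.
  by apply: measurable_funB; exact: measurable_funM.
have dens (W : set (R * R)) : measurable W ->
    ((normal_prob 0 1 \x normal_prob 0 1) W
     = \int[mu]_x \int[mu]_y
         ((\1_W (x, y))%:E * (normal_pdf 0 1 x * normal_pdf 0 1 y)%:E))%E.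
  move=> mW; rewrite /product_measure1.
  rewrite integral_normal_prob; last first.
    apply/integrableP; split; first exact: measurable_fun_xsection.
    apply: (@le_lt_trans _ _ (\int[normal_prob 0 1]_(x in [set: R]) 1)%E).
      apply: ge0_le_integral => //.
        by apply: measurableT_comp => //; exact: measurable_fun_xsection.
      move=> x _ /=; rewrite gee0_abs//.
      by apply: probability_le1; exact: measurable_xsection.
    by rewrite integral_cst// mul1e ltey_eq fin_num_measure.
  apply: eq_integral => x _ /=.
  rewrite {1}/normal_prob integral_mkcond.
  rewrite muleC -ge0_integralZl//; last 3 first.
  - apply/measurable_restrict => //; first exact: measurable_xsection.
    apply: measurable_funTS.
    by apply/measurable_EFinP; exact: measurable_normal_pdf.
  - by move=> y _; apply: erestrict_ge0 => z _; rewrite lee_fin normal_pdf_ge0.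
  - by rewrite lee_fin normal_pdf_ge0.
  apply: eq_integral => y _; rewrite patchE indicE mem_xsection.
  by case: ifPn => _; rewrite ?mule0 ?mul0e// mul1e EFinM.
rewrite dens//.
rewrite -product_measure1E// dens; last exact: measurableX.
pose F (z : R * R) := ((\1_(A `*` B) z)%:E * (normal_pdf 0 1 z.1 * normal_pdf 0 1 z.2)%:E)%E.
have mF : measurable_fun [set: R * R] F.
  apply: emeasurable_funM.
    by apply/measurable_EFinP/measurable_indic; exact: measurableX.
  apply/measurable_EFinP; apply: measurable_funM;
    by apply: measurableT_comp => //; exact: measurable_normal_pdf.
have F0 z : (0 <= F z)%E.
  by rewrite mule_ge0// lee_fin// mulr_ge0// normal_pdf_ge0.
apply: etrans (integral_rotation cs1 s0 mF F0).
apply: eq_integral => x _; apply: eq_integral => y _.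
rewrite /F /=; congr (_ * _)%E.
congr EFin; rewrite !normal_pdf01.
rewrite mulrACA [RHS]mulrACA -!expRD; congr (_ * expR _).
transitivity (- ((c ^+ 2 + s ^+ 2) * (x ^+ 2 + y ^+ 2)) / 2).
  by rewrite cs1; field.
by field.
Qed.
End Shear.

Lemma normal_prob_standardize (R : realType) (m s : R) (A : set R) :
  0 < s -> measurable A ->
  normal_prob m s [set x | A ((x - m) / s)] = normal_prob 0 1 A.
Proof.
move=> s0 mA.
have mA' : measurable [set x | A ((x - m) / s)].
  rewrite -[X in measurable X]setTI.
  suff: measurable_fun [set: R] (fun x => (x - m) / s) by exact.
  by apply: measurable_funM => //; exact: measurable_funB.
rewrite /normal_prob integral_mkcond [RHS]integral_mkcond.
rewrite (integral_lebesgue_affine (PosNum s0) m)//; last 2 first.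
- apply/measurable_restrict => //; apply: measurable_funTS.
  by apply/measurable_EFinP; exact: measurable_normal_pdf.
- by move=> y; apply: erestrict_ge0 => z _; rewrite lee_fin normal_pdf_ge0.
apply: eq_integral => x _ /=; rewrite !patchE.
have -> : (s * x + m \in [set x | A ((x - m) / s)]) = (x \in A).
  by apply/idP/idP; rewrite !inE/= addrK mulrAC mulfV ?mul1r// gt_eqF.
case: ifPn => _; last by rewrite mule0.
rewrite -EFinM; congr EFin.
rewrite !normal_pdfE ?oner_neq0 ?gt_eqF// /normal_fun subr0 addrK.
have -> : normal_peak s = s^-1 * normal_peak 1.
  rewrite /normal_peak expr1n mul1r -mulrnAr sqrtrM ?sqr_ge0// sqrtr_sqr.
  by rewrite gtr0_norm// invfM.
rewrite mulrA mulrA mulfV ?gt_eqF// mul1r; congr (_ * expR _).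
by rewrite expr1n exprMn; field; rewrite gt_eqF.
Qed.

Lemma measurable_funV d (T : measurableType d) (R : realType) (f : T -> R) :
  measurable_fun [set: T] f -> measurable_fun [set: T] (fun t => (f t)^-1).
Proof.
move=> mf.
(* Squaring provides the nonnegative base of the real power; at a zero of [f] the factor [f t]
   restores the convention 0^-1 = 0. *)
have -> : (fun t => (f t)^-1) = (fun t => f t * (f t ^+ 2) `^ (-1)).
  apply/funext => t; rewrite powR_inv1 ?sqr_ge0//.
  have [->|f0] := eqVneq (f t) 0; first by rewrite invr0 mul0r.
  by field.
apply: measurable_funM => //.
apply: (measurableT_comp (measurable_powR _)).
exact: measurable_funX.
Qed.

Lemma measurable_fun_sqrt d (T : measurableType d) (R : realType) (f : T -> R) :
  (forall t, 0 <= f t) ->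
  measurable_fun [set: T] f -> measurable_fun [set: T] (fun t => Num.sqrt (f t)).
Proof.
move=> f0 mf.
have -> : (fun t => Num.sqrt (f t)) = (fun t => f t `^ 2^-1).
  by apply/funext => t; rewrite powR12_sqrt.
exact: (measurableT_comp (measurable_powR _)).
Qed.

(** This law and the next serve together: independence of [f] from the event [D] says that the trace
    of its law on [D] is a multiple of the law. Both being finite measures, a comparison on a
    pi-system suffices. *)
Lemma exists_trace_law d d' (T : measurableType d) (Y : measurableType d')
    (R : realType) (P : probability T R) (D : set T) (f : T -> Y) :
  measurable D -> measurable_fun [set: T] f ->
  exists Q : {measure set Y -> \bar R},
    forall Z, Q Z = P (f @^-1` Z `&` D).
Proof.
move=> mD mf.
unshelve eexists (pushforward (mrestr P mD) f); first exact: mf.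
by move=> Z; rewrite /= /pushforward /mrestr.
Qed.

Lemma exists_scaled_law d d' (T : measurableType d) (Y : measurableType d')
    (R : realType) (P : probability T R) (f : T -> Y) (k : R) :
  0 <= k -> measurable_fun [set: T] f ->
  exists Q : {measure set Y -> \bar R},
    forall Z, Q Z = (k%:E * P (f @^-1` Z))%E.
Proof.
move=> k0 mf.
unshelve eexists (mscale (NngNum k0) (pushforward P f)); first exact: mf.
by move=> Z; rewrite /= /pushforward /mscale.
Qed.

Lemma measure_eq_rectangles d1 d2 (T1 : measurableType d1)
    (T2 : measurableType d2) (R : realType)
    (m1 m2 : {measure set (T1 * T2) -> \bar R}) :
  (m1 [set: T1 * T2] < +oo)%E ->
  (forall A B, measurable A -> measurable B -> m1 (A `*` B) = m2 (A `*` B)) ->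
  forall X, measurable X -> m1 X = m2 X.
Proof.
move=> fin m12 X mX.
pose C : set (set (T1 * T2)) :=
  [set C | exists A, measurable A /\ exists B, measurable B /\ C = A `*` B].
apply: (measure_unique C (fun=> setT)) => //.
- rewrite measurable_prod_measurableType //; congr (<<s _ >>).
  rewrite predeqE => Z; split => [[A mA [B mB <-]]|[A [mA [B [mB ->]]]]].
    by exists A; split => //; exists B.
  by exists A => //; exists B.
- move=> /= _ _ [X1 [mX1 [X2 [mX2 ->]]]] [Y1 [mY1 [Y2 [mY2 ->]]]].
  rewrite -setXI; exists (X1 `&` Y1); split; first exact: measurableI.
  by exists (X2 `&` Y2); split => //; exact: measurableI.
- by move=> _; exists setT; split => //; exists setT; rewrite setXTT.
- by rewrite bigcup_const//; exists 0.
- by move=> _ [A [mA [B [mB ->]]]]; exact: m12.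
Qed.

Lemma measure_eq_boxes d (T1 : measurableType d) (R : realType) (n : nat)
    (m1 m2 : {measure set (n.-tuple T1) -> \bar R}) :
  (m1 [set: n.-tuple T1] < +oo)%E ->
  (forall A : 'I_n -> set T1, (forall i, measurable (A i)) ->
    m1 [set u | forall i, A i (tnth u i)] = m2 [set u | forall i, A i (tnth u i)]) ->
  forall X, measurable X -> m1 X = m2 X.
Proof.
move=> fin m12 X mX.
pose C : set (set (n.-tuple T1)) :=
  [set C | exists2 A : 'I_n -> set T1, (forall i, measurable (A i)) &
     C = [set u | forall i, A i (tnth u i)]].
have mC Z : C Z -> measurable Z.
  move=> [A mA ->].
  rewrite (_ : mkset _ = \big[setI/setT]_(i < n) (@tnth n T1 ^~ i @^-1` A i)).
    apply: bigsetI_measurable => i _; rewrite -[X in measurable X]setTI.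
    exact: measurable_tnth.
  rewrite -bigcap_seq; apply/seteqP; split => u /=.
    by move=> Au i _; exact: Au.
  by move=> Au i; apply: (Au i); rewrite /= mem_index_enum.
apply: (measure_unique C (fun=> setT)) => //.
- apply/seteqP; split => Z.
    move: Z; apply: smallest_sub; first exact: smallest_sigma_algebra.
    rewrite -bigcup_seq => Y [i _ [A mA <-]]; apply: sub_sigma_algebra.
    exists (fun j => if j == i then A else setT).
      by move=> j; case: ifP.
    rewrite setTI; apply/seteqP; split => u /=.
      by move=> Au j; case: eqP => [->|].
    by move=> /(_ i); rewrite eqxx.
  move=> sZ; apply: sZ; split; first exact: sigma_algebra_measurable.
  exact: mC.
- move=> _ _ [A mA ->] [B mB ->]; exists (fun i => A i `&` B i).
    by move=> i; exact: measurableI.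
  apply/seteqP; split => u /=.
    by move=> [Au Bu] i; split.
  by move=> ABu; split => i; have [] := ABu i.
- move=> _; exists (fun=> setT) => //.
  by apply/seteqP; split.
- by rewrite bigcup_const//; exists 0.
- by move=> _ [A mA ->]; exact: m12.
Qed.

(** * Exact chi-square representation *)

Section IndepNormal.
Variables (R : realType) (d : measure_display) (T : measurableType d).
Variable P : probability T R.
Variables (d0 : measure_display) (T0 : measurableType d0) (W : T -> T0).

(* The [X i] are i.i.d. standard normal and jointly independent of [W]. *)
Definition indep_normal (I : finType) (X : I -> T -> R) : Prop :=
  [/\ measurable_fun [set: T] W,
      forall i, measurable_fun [set: T] (X i) &
      forall (B : set T0) (A : I -> set R), measurable B ->
        (forall i, measurable (A i)) ->
        P (W @^-1` B `&` [set t | forall i, A i (X i t)])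
        = (P (W @^-1` B) * \prod_i normal_prob 0 1 (A i))%E].

Definition givens (I : eqType) (a b : I) (c s : R) (x : I -> R) (i : I) : R :=
  if i == a then c * x a + s * x b
  else if i == b then c * x b - s * x a else x i.

Lemma measurable_givens d1 (T1 : measurableType d1) (I : eqType) (a b : I)
    (c s : T1 -> R) (X : I -> T1 -> R) :
  measurable_fun [set: T1] c -> measurable_fun [set: T1] s ->
  (forall i, measurable_fun [set: T1] (X i)) -> forall i,
  measurable_fun [set: T1] (fun t => givens a b (c t) (s t) (X^~ t) i).
Proof.
move=> mc ms mX i; rewrite /givens; case: (i == a).
  by apply: measurable_funD; exact: measurable_funM.
case: (i == b) => //.
by apply: measurable_funB; exact: measurable_funM.
Qed.

Lemma measurable_event (I : finType) (X : I -> T -> R) (A : I -> set R)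
    (J : pred I) :
  (forall i, measurable_fun [set: T] (X i)) -> (forall i, measurable (A i)) ->
  measurable [set t | forall i, J i -> A i (X i t)].
Proof.
move=> mX mA.
rewrite (_ : mkset _ = \big[setI/setT]_(i in J) (X i @^-1` A i)).
  apply: bigsetI_measurable => i _; rewrite -[X in measurable X]setTI.
  exact: mX.
rewrite -bigcap_seq_cond; apply/seteqP; split => t /=.
  by move=> At i /= /andP[_ Ji]; exact: At.
by move=> At i Ji; apply: (At i); rewrite /= mem_index_enum.
Qed.

(** With [W] fixed and the other coordinates confined to their sets, the pair (X_a, X_b) is a planar
    standard Gaussian, so a rotation chosen from [W] leaves its law unchanged; Fubini over the law
    of [W] concludes. The condition [s w = 0 -> c w = 1] excludes the half-turn, which
    [normal_prob_rotation] does not cover. *)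
Lemma indep_normal_givens (I : finType) (X : I -> T -> R) (a b : I)
    (c s : T0 -> R) : a != b ->
  measurable_fun [set: T0] c -> measurable_fun [set: T0] s ->
  (forall w, c w ^+ 2 + s w ^+ 2 = 1) -> (forall w, s w = 0 -> c w = 1) ->
  indep_normal X ->
  indep_normal (fun i t => givens a b (c (W t)) (s (W t)) (X^~ t) i).
Proof.
move=> ab mc ms cs1 c1 [mW mX indX].
have mcW : measurable_fun [set: T] (c \o W) by exact: measurableT_comp.
have msW : measurable_fun [set: T] (s \o W) by exact: measurableT_comp.
split=> //; first exact: (measurable_givens _ _ mcW msW).
move=> B A mB mA.
pose J i := (i != a) && (i != b).
pose D := [set t | forall i, J i -> A i (X i t)].
have mD : measurable D by exact: measurable_event.
pose K := (\prod_(i | J i) fine (normal_prob 0 1 (A i)))%R.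
have fin (C : set R) : measurable C -> normal_prob 0 1 C \is a fin_num.
  by move=> mC; rewrite fin_num_measure.
have K0 : 0 <= K by apply: prodr_ge0 => i _; exact: fine_ge0.
have KE : K%:E = (\prod_(i | J i) normal_prob 0 1 (A i))%E.
  rewrite /K; elim/big_ind2: _ => //.
    by move=> x1 x2 y1 y2 <- <-; rewrite EFinM.
  by move=> i _; rewrite fineK// fin.
have prodE (C : I -> set R) : (forall i, J i -> C i = A i) ->
    (\prod_i normal_prob 0 1 (C i)
     = normal_prob 0 1 (C a) * normal_prob 0 1 (C b) * K%:E)%E.
  move=> CA; rewrite (bigD1 a)//= (bigD1 b) 1?eq_sym//= KE muleA; congr (_ * _)%E.
  by apply: eq_big => // i Ji; rewrite CA.
have mXab : measurable_fun [set: T] (fun t => (X a t, X b t)).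
  exact: measurable_fun_pair.
have mWX : measurable_fun [set: T] (fun t => (W t, (X a t, X b t))).
  exact: measurable_fun_pair.
have [Q QE] := exists_trace_law P mD mWX.
pose g1 : probability (measurableTypeR R) R := normal_prob 0 1.
pose g2 : probability (measurableTypeR R * measurableTypeR R)%type R :=
  (g1 \x g1)%E.
have [LW LWE] := exists_scaled_law P K0 mW.
(* [h] is the identity; it carries the Gaussian product from [measurableTypeR R] to the measurable
   structure of [R]. *)
pose h (z : measurableTypeR R * measurableTypeR R) : R * R := (z.1, z.2).
have mh : measurable_fun [set: measurableTypeR R * measurableTypeR R] h.
  have mid : measurable_fun [set: measurableTypeR R] (id : measurableTypeR R -> R).
    by move=> _ Y mY; rewrite setTI.
  apply: measurable_fun_pair.
    exact: (measurableT_comp mid (@measurable_fst _ _ (measurableTypeR R) (measurableTypeR R))).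
  exact: (measurableT_comp mid (@measurable_snd _ _ (measurableTypeR R) (measurableTypeR R))).
have h_id C : h @^-1` C = C by apply/seteqP; split=> -[].
pose h' : {mfun (measurableTypeR R * measurableTypeR R)%type >-> (R * R)%type} :=
  HB.pack h (isMeasurableFun.Build _ _ _ _ _ mh).
pose g2R : probability (R * R)%type R := distribution g2 h'.
have g2RE C : g2R C = g2 C by rewrite -[C in RHS]h_id.
have g2E A1 A2 : measurable A1 -> measurable A2 ->
    g2 (A1 `*` A2) = (normal_prob 0 1 A1 * normal_prob 0 1 A2)%E.
  exact: product_measure1E.
(* For fixed constraints on [W] and on the other coordinates, the trace of the law of the pair is a
   multiple of the planar Gaussian; rectangles suffice to see it. *)
have rect B1 C : measurable B1 -> measurable C ->
    P (W @^-1` B1 `&` (fun t => (X a t, X b t)) @^-1` C `&` D)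
    = (K%:E * P (W @^-1` B1) * g2 C)%E.
  move=> mB1 mC.
  have mWB1 : measurable (W @^-1` B1) by rewrite -[X in measurable X]setTI; exact: mW.
  have [Q1 Q1E] := exists_trace_law P (measurableI _ _ mWB1 mD) mXab.
  have k0 : 0 <= K * fine (P (W @^-1` B1)) by rewrite mulr_ge0// fine_ge0.
  have [Q2 Q2E] := exists_scaled_law g2 k0 mh.
  have Q12 : Q1 C = Q2 C.
    apply: measure_eq_rectangles mC.
  - rewrite Q1E; apply: le_lt_trans (ltry 1); apply: probability_le1.
    apply: measurableI; first by rewrite -[X in measurable X]setTI; exact: mXab.
    exact: measurableI.
  - move=> A1 A2 mA1 mA2; rewrite Q1E Q2E h_id g2E//.
    rewrite EFinM fineK ?fin_num_measure//.
    pose C' i := if i == a then A1 else if i == b then A2 else A i.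
    have mC' i : measurable (C' i) by rewrite /C'; case: ifP => // _; case: ifP.
    have ba : (b == a) = false by rewrite eq_sym; exact/negbTE.
    transitivity (P (W @^-1` B1 `&` [set t | forall i, C' i (X i t)])).
      congr (P _); apply/seteqP; split => t /=.
        move=> [[A1t A2t] [Bt Dt]]; split => // i; rewrite /C'.
        case: eqP => [->//|/eqP ia]; case: eqP => [->//|/eqP ib].
        by apply: Dt; rewrite /J ia ib.
      move=> [Bt At]; split.
        by have := At a; have := At b; rewrite /C' ba !eqxx.
      split=> // i /andP[/negbTE ia /negbTE ib].
      by have := At i; rewrite /C' ia ib.
    rewrite indX// (prodE C'); last first.
      by move=> i /andP[/negbTE ia /negbTE ib]; rewrite /C' ia ib.
    rewrite /C' ba !eqxx [in RHS]muleC [(K%:E * P _)%E]muleC.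
    by rewrite muleCA.
  move: Q12; rewrite Q1E Q2E h_id EFinM fineK ?fin_num_measure// => <-.
  by rewrite setIA [_ `&` W @^-1` _]setIC.
have QP Z : measurable Z -> Q Z = (LW \x g2R)%E Z.
  apply: measure_eq_rectangles.
    rewrite QE preimage_setT setTI; apply: le_lt_trans (ltry 1).
    exact: probability_le1.
  move=> B1 C mB1 mC.
  transitivity (LW B1 * g2R C)%E; last exact/esym/(product_measure1E LW g2R mB1 mC).
  by rewrite QE LWE g2RE -rect// setIA; congr (P (_ `&` _)); apply/seteqP; split.
pose Z := [set z : T0 * (R * R) | [/\ B z.1,
  A a (c z.1 * z.2.1 + s z.1 * z.2.2) & A b (c z.1 * z.2.2 - s z.1 * z.2.1)]].
have mZ : measurable Z.
  rewrite (_ : Z = fst @^-1` B `&`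
    ((fun z : T0 * (R * R) => c z.1 * z.2.1 + s z.1 * z.2.2) @^-1` (A a) `&`
     (fun z : T0 * (R * R) => c z.1 * z.2.2 - s z.1 * z.2.1) @^-1` (A b))).
    apply: measurableI.
      by rewrite -[X in measurable X]setTI; exact: measurable_fst.
    have m1 : measurable_fun [set: T0 * (R * R)] (fun z => z.2.1).
      exact: measurableT_comp.
    have m2 : measurable_fun [set: T0 * (R * R)] (fun z => z.2.2).
      exact: measurableT_comp.
    have m3 : measurable_fun [set: T0 * (R * R)] (fun z => c z.1).
      exact: measurableT_comp.
    have m4 : measurable_fun [set: T0 * (R * R)] (fun z => s z.1).
      exact: measurableT_comp.
    have m5 : measurable_fun [set: T0 * (R * R)]
        (fun z => c z.1 * z.2.1 + s z.1 * z.2.2).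
      by apply: measurable_funD; exact: measurable_funM.
    have m6 : measurable_fun [set: T0 * (R * R)]
        (fun z => c z.1 * z.2.2 - s z.1 * z.2.1).
      by apply: measurable_funB; exact: measurable_funM.
    by apply: measurableI; rewrite -[X in measurable X]setTI; [exact: m5|exact: m6].
  by apply/seteqP; split => z /=; [case|case=> ? []].
have ba : (b == a) = false by rewrite eq_sym; exact/negbTE.
transitivity (Q Z).
  rewrite QE; congr (P _); apply/seteqP; split => t /=.
    move=> [Bt At]; split.
      split=> //; first by have := At a; rewrite /givens eqxx.
      by have := At b; rewrite /givens ba eqxx.
    move=> i /andP[/negbTE ia /negbTE ib].
    by have := At i; rewrite /givens ia ib.
  move=> [[Bt Aat Abt] Dt]; split=> // i; rewrite /givens.
  case: eqP => [->//|/eqP ia]; case: eqP => [->//|/eqP ib].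
  by apply: Dt; rewrite /J ia ib.
rewrite QP// [LHS]/product_measure1.
(* The section of [Z] above [w] is a rotated rectangle if [w] is in [B] and empty otherwise, so its
   mass is constant on [B]. *)
transitivity (\int[LW]_w ((normal_prob 0 1 (A a) * normal_prob 0 1 (A b))
    * (\1_B w)%:E))%E.
  apply: eq_integral => w _ /=.
  rewrite indicE g2RE; case: (boolP (w \in B)) => Bw; last first.
    rewrite mule0 (_ : xsection Z w = set0) ?measure0//.
    apply/seteqP; split => u //; rewrite /xsection /= inE => -[/= Bw' _ _].
    by move/negP: Bw; rewrite inE.
  rewrite mule1.
  have [s0|s0] := eqVneq (s w) 0.
    transitivity (g2 (A a `*` A b)); last exact: (g2E _ _ (mA a) (mA b)).
    rewrite h_id; congr (g2 _).
    apply/seteqP; split => -[u1 u2]; rewrite /xsection /= inE /Z /= s0 c1//.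
      by rewrite !mul1r !mul0r addr0 subr0 => -[].
    by rewrite !mul1r !mul0r addr0 subr0 => -[? ?]; split => //; exact/set_mem.
  apply: etrans (normal_prob_rotation (cs1 w) s0 (mA a) (mA b)).
  rewrite h_id; congr (g2 _).
  apply/seteqP; split => -[u1 u2]; rewrite /xsection /= inE /Z /=; first by case.
  by move=> [? ?]; split => //; exact/set_mem.
rewrite ge0_integralZl//; last 2 first.
- exact/measurable_EFinP/measurable_indic.
- by rewrite mule_ge0.
rewrite integral_indic// setIT LWE (prodE A)//.
by rewrite muleA muleC.
Qed.

Definition givens_mx (N : nat) (a b : 'I_N) (c s : R) : 'M[R]_N :=
  \matrix_(i, j) givens a b c s (fun k => (k == j)%:R) i.

Lemma mul_givens_mx (N k : nat) (a b : 'I_N) (c s : R) (M : 'M[R]_(N, k)) i j :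
  (givens_mx a b c s *m M) i j = givens a b c s (M^~ j) i.
Proof.
have sel (l : 'I_N) : \sum_h (l == h)%:R * M h j = M l j.
  rewrite (bigD1 l)//= eqxx mul1r big1 ?addr0// => h hl.
  by rewrite eq_sym (negbTE hl) mul0r.
rewrite mxE /givens; under eq_bigr do rewrite mxE /givens.
case: (i == a).
  under eq_bigr do rewrite mulrDl -!mulrA.
  by rewrite big_split/= -!mulr_sumr !sel.
case: (i == b) => //.
under eq_bigr do rewrite mulrBl -!mulrA.
by rewrite sumrB -!mulr_sumr !sel.
Qed.

Lemma givens_mx_orthogonal (N : nat) (a b : 'I_N) (c s : R) :
  a != b -> c ^+ 2 + s ^+ 2 = 1 ->
  givens_mx a b c s *m (givens_mx a b c s)^T = 1%:M.
Proof.
move=> ab cs1; apply/matrixP => i j; rewrite mul_givens_mx /givens !mxE /givens.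
have ba : (b == a) = false by rewrite eq_sym; exact/negbTE.
have cc : c * c + s * s = 1 by rewrite -!expr2.
rewrite (eq_sym a b) ba !eqxx !(mulr1, mulr0, addr0, add0r, subr0, sub0r).
have [->|ia] := eqVneq i a.
  have [_|ja] := eqVneq j a; first exact: cc.
  have [_|jb] := eqVneq j b; first by rewrite ?mulr0n; ring.
  by rewrite !mulr0 addr0.
have [->|ib] := eqVneq i b.
  have [ja|ja] := eqVneq j a; first by rewrite ja ba ?mulr0n; ring.
  have [_|jb] := eqVneq j b; first by rewrite mulrN opprK.
  by rewrite !mulr0 subr0.
have [->|ja] := eqVneq j a.
  by rewrite (negbTE ia) !(mulr0, addr0).
have [->|jb] := eqVneq j b.
  by rewrite (negbTE ib) !(mulr0, subr0).
by rewrite eq_sym.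
Qed.

Lemma measurable_mulmx (d1 : measure_display) (T1 : measurableType d1)
    (k l h : nat) (A : T1 -> 'M[R]_(k, l)) (B : T1 -> 'M[R]_(l, h)) :
  (forall i j, measurable_fun [set: T1] (fun w => A w i j)) ->
  (forall i j, measurable_fun [set: T1] (fun w => B w i j)) ->
  forall i j, measurable_fun [set: T1] (fun w => (A w *m B w) i j).
Proof.
move=> mA mB i j; under eq_fun do rewrite mxE.
by apply: measurable_sum => r; exact: measurable_funM.
Qed.

Lemma measurable_trmx (d1 : measure_display) (T1 : measurableType d1)
    (k l : nat) (A : T1 -> 'M[R]_(k, l)) :
  (forall i j, measurable_fun [set: T1] (fun w => A w i j)) ->
  forall i j, measurable_fun [set: T1] (fun w => (A w)^T i j).
Proof. by move=> mA i j; under eq_fun do rewrite mxE; exact: mA. Qed.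

(* The rotation [H] may depend on [W], since conditionally on [W] the vector
   [X] is rotation invariant. *)
Lemma triangularize (N q : nat) (X : 'I_N -> T -> R) (A : T0 -> 'M[R]_(q, N)) :
  (forall i j, measurable_fun [set: T0] (fun w => A w i j)) ->
  indep_normal X ->
  exists H : T0 -> 'M[R]_N,
    [/\ forall w, H w *m (H w)^T = 1%:M,
        indep_normal (fun i t => (H (W t) *m \col_k X k t) i 0) &
        forall w (i : 'I_q) (j : 'I_N), (i < j)%N -> (A w *m (H w)^T) i j = 0].
Proof.
move=> mA iX.
(* Elimination runs row by row: at stage (k, l), the entries right of the diagonal vanish in the
   rows before [k] and, within row [k], in the columns before [l]. *)
pose good k l := exists H : T0 -> 'M[R]_N,
    [/\ forall i j, measurable_fun [set: T0] (fun w => H w i j),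
        forall w, H w *m (H w)^T = 1%:M,
        indep_normal (fun i t => (H (W t) *m \col_k X k t) i 0) &
        forall w (i : 'I_q) (j : 'I_N), (i < j)%N ->
          (i < k)%N || (i == k :> nat) && (j < l)%N -> (A w *m (H w)^T) i j = 0].
have good0 : good 0%N 0%N.
  exists (fun=> 1%:M); split => //.
  - by move=> w; rewrite trmx1 mulmx1.
  - have -> // : (fun i t => (1%:M *m \col_k X k t) i 0) = X.
    by apply/funext => i; apply/funext => t; rewrite mul1mx mxE.
  - by move=> w i j _; rewrite !ltn0 andbF.
have goodN k : good k N -> good k.+1 0%N.
  move=> [H [mH HH iH zH]]; exists H; split => // w i j ij.
  rewrite ltn0 andbF orbF ltnS leq_eqVlt => /orP[ik|ik]; apply: zH => //.
    by rewrite ik ltn_ord orbT.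
  by rewrite ik.
have goodS k l : good k l -> good k l.+1.
  move=> [H [mH HH iH zH]].
  (* Outside this range the entry (k, l) does not exist or is not right of the diagonal, and there
     is nothing to eliminate. *)
  have [/andP[/andP[kq lN] kl]|triv] := boolP ((k < q) && (l < N) && (k < l))%N; last first.
    exists H; split => // w i j ij /orP[ik|/andP[ik jl]]; apply: zH => //.
      by rewrite ik.
    move: triv; rewrite (eqP ik) eqxx /= -(eqP ik) ltn_ord /= ltnn /=.
    have [_|Nl _] := ltnP l N; last by rewrite (leq_trans (ltn_ord j)).
    by rewrite (leq_trans ij).
  have kN := ltn_trans kl lN.
  pose a := Ordinal kN; pose b := Ordinal lN; pose r := Ordinal kq.
  have ab : a != b by rewrite -val_eqE /= ltn_eqF.
  pose M w := A w *m (H w)^T.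
  have mM i j : measurable_fun [set: T0] (fun w => M w i j).
    by apply: measurable_mulmx => //; exact: measurable_trmx.
  pose n w := Num.sqrt (M w r a ^+ 2 + M w r b ^+ 2).
  have n2 w : n w ^+ 2 = M w r a ^+ 2 + M w r b ^+ 2.
    by rewrite sqr_sqrtr// addr_ge0// sqr_ge0.
  (* An entry that is already zero calls for the identity; this avoids dividing by a zero norm and
     ensures [s w = 0 -> c w = 1]. *)
  pose c w := if M w r b == 0 then 1 else M w r a / n w.
  pose s w := if M w r b == 0 then 0 else M w r b / n w.
  have n0 w : M w r b != 0 -> n w != 0.
    apply: contra_neq => n0; apply/eqP; rewrite -sqrf_eq0.
    move/eqP: (n2 w); rewrite n0 expr0n /= eq_sym paddr_eq0 ?sqr_ge0//.
    by case/andP.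
  have mn : measurable_fun [set: T0] n.
    apply: measurable_fun_sqrt; first by move=> w; rewrite addr_ge0// sqr_ge0.
    by apply: measurable_funD; exact: measurable_funX.
  have mc : measurable_fun [set: T0] c.
    apply: measurable_fun_ifT => //; first exact: measurable_fun_eqr.
    by apply: measurable_funM => //; exact: measurable_funV.
  have ms : measurable_fun [set: T0] s.
    apply: measurable_fun_ifT => //; first exact: measurable_fun_eqr.
    by apply: measurable_funM => //; exact: measurable_funV.
  have cs1 w : c w ^+ 2 + s w ^+ 2 = 1.
    rewrite /c /s; have [_|b0] := eqVneq (M w r b) 0.
      by rewrite expr0n addr0 expr1n.
    rewrite !expr_div_n -mulrDl -n2 divff// expf_neq0//; exact: n0.
  have s0c w : s w = 0 -> c w = 1.
    rewrite /c /s; have [//|b0] := eqVneq (M w r b) 0.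
    by move/eqP; rewrite mulf_eq0 invr_eq0 (negbTE b0) (negbTE (n0 _ b0)).
  have elim w : c w * M w r b = s w * M w r a.
    rewrite /c /s; have [->|b0] := eqVneq (M w r b) 0; first by rewrite mulr0 mul0r.
    by rewrite mulrAC [RHS]mulrAC (mulrC (M w r b)).
  exists (fun w => givens_mx a b (c w) (s w) *m H w); split.
  - apply: measurable_mulmx => // i j; under eq_fun do rewrite mxE.
    exact: (measurable_givens a b mc ms (X := fun k _ => (k == j)%:R)).
  - move=> w; rewrite trmx_mul mulmxA -(mulmxA _ (H w)) HH mulmx1.
    exact: givens_mx_orthogonal.
  - have := indep_normal_givens ab mc ms cs1 s0c iH.
    congr indep_normal; apply/funext => i; apply/funext => t.
    by rewrite -mulmxA mul_givens_mx.
  - move=> w i j ij ijkl.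
    rewrite trmx_mul mulmxA -/(M w).
    have -> : (M w *m (givens_mx a b (c w) (s w))^T) i j
        = givens a b (c w) (s w) (M w i) j.
      have := mul_givens_mx a b (c w) (s w) (M w)^T j i.
      move=> e; rewrite -{1}(trmxK (M w)) -trmx_mul mxE e.
      by rewrite /givens !mxE.
    rewrite /givens.
    (* In the earlier rows both rotated columns already vanish, so the rotation preserves these
       zeros. *)
    have ia : (i < a)%N -> M w i a = 0 by move=> ik; apply: zH; rewrite // ik.
    have ib : (i < a)%N -> M w i b = 0.
      by move=> ik; apply: zH; [exact: ltn_trans kl|rewrite ik].
    have [ja|ja] := eqVneq j a.
      by rewrite ja in ij; rewrite ia// ib// !mulr0 addr0.
    have [jb|jb] := eqVneq j b.
      move: ijkl => /orP[ik|/andP[ik _]].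
        by rewrite ia// ib// !mulr0 subr0.
      by rewrite (_ : i = r) ?elim ?subrr//; apply: val_inj; exact/eqP.
    apply: zH => //; move: ijkl => /orP[->//|/andP[-> jl]].
    rewrite /= orbC; apply/orP; left.
    by rewrite ltn_neqAle -ltnS jl andbT -(inj_eq val_inj) in jb *.
have goodl k l : good k 0%N -> good k l.
  by move=> g; elim: l => // l IH; exact: goodS.
have goodk k : good k 0%N.
  by elim: k => // k IH; apply: goodN; exact: goodl.
have [H [_ HH iH zH]] := goodk q.
exists H; split => // w i j ij; apply: zH => //; by rewrite ltn_ord.
Qed.

(** Coordinates outside the image are left unconstrained and contribute the factor 1. *)
Lemma indep_normal_reindex (I J : finType) (f : J -> I) (X : I -> T -> R) :
  injective f -> indep_normal X -> indep_normal (fun j => X (f j)).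
Proof.
move=> fI [mW mX iX]; split => // B A mB mA.
pose A' i := if [pick j | f j == i] is Some j then A j else setT.
have A'f j : A' (f j) = A j.
  rewrite /A'; case: pickP => [k /eqP/fI->//|/(_ j)].
  by rewrite eqxx.
have A'T i : i \notin codom f -> A' i = setT.
  rewrite /A'; case: pickP => // k /eqP <-.
  by rewrite codom_f.
have mA' i : measurable (A' i) by rewrite /A'; case: pickP.
transitivity (P (W @^-1` B `&` [set t | forall i, A' i (X i t)])).
  congr (P (_ `&` _)); apply/seteqP; split => t /= At.
    move=> i; have [/codomP[j ->]|/A'T->//] := boolP (i \in codom f).
    by rewrite A'f.
  by move=> j; rewrite -A'f.
rewrite iX//; congr (_ * _)%E.
rewrite (bigID (mem (codom f)))/= [X in (_ * X)%E]big1 ?mule1; last first.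
  by move=> i /A'T ->; exact: probability_setT.
rewrite -big_uniq; last by rewrite map_inj_uniq// enum_uniq.
by rewrite big_map big_enum; apply: eq_bigr => j _; rewrite A'f.
Qed.

Lemma indep_normal_marginal (I : finType) (X : I -> T -> R) (i : I) A :
  measurable A -> indep_normal X -> P (X i @^-1` A) = normal_prob 0 1 A.
Proof.
move=> mA iX.
have unitI : injective (fun _ : unit => i) by case=> -[].
have [_ _ /(_ setT (fun=> A) measurableT (fun=> mA))] :=
  indep_normal_reindex unitI iX.
rewrite preimage_setT setTI probability_setT mul1e big_const card_unit /= mule1 => <-.
by congr (P _); apply/seteqP; split => t /=; [move=> ? []|exact].
Qed.

(** After triangularization the coefficient matrix is [L1 0] with L1 square. Then U = L1 y and J =
    L1 L1^T, hence U^T J^-1 U = y^T y, where y consists of the first [q] rotated coordinates. These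
    are defined, and normal, also where J is singular. *)
Lemma chi2_representation (I : finType) (q : nat) (X : I -> T -> R)
    (A : T0 -> 'I_q -> I -> R) :
  (q <= #|I|)%N ->
  (forall a i, measurable_fun [set: T0] (fun w => A w a i)) ->
  indep_normal X ->
  exists2 Z : 'I_q -> T -> R, indep_normal Z &
    forall t (J : 'M[R]_q) (U : 'cV[R]_q),
      (forall a b, J a b = \sum_i A (W t) a i * A (W t) b i) ->
      (forall a, U a 0 = \sum_i A (W t) a i * X i t) ->
      J \in unitmx -> \sum_a Z a t ^+ 2 = (U^T *m invmx J *m U) 0 0.
Proof.
move=> qI mA iX.
pose A' w : 'M[R]_(q, #|I|) := \matrix_(a, k) A w a (enum_val k).
have mA' a k : measurable_fun [set: T0] (fun w => A' w a k).
  by under eq_fun do rewrite mxE; exact: mA.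
have [H [HH iH tH]] :=
  triangularize mA' (indep_normal_reindex (@enum_val_inj _ _) iX).
exists (fun a t => (H (W t) *m \col_k X (enum_val k) t) (widen_ord qI a) 0).
  apply: (indep_normal_reindex _ iH) => a b /(congr1 val) ab.
  exact: val_inj.
move=> t J U JE UE unitJ; set w := W t in JE UE *.
set x := \col_k X (enum_val k) t.
have HH' : (H w)^T *m H w = 1%:M by apply: mulmx1C.
pose L := A' w *m (H w)^T.
pose L1 : 'M[R]_q := \matrix_(a, b) L a (widen_ord qI b).
pose y := H w *m x.
pose y1 : 'cV[R]_q := \col_a y (widen_ord qI a) 0.
(* The columns from [q] on lie right of the diagonal in every row, so they vanish. *)
have Lsum (f : 'I_#|I| -> R) a :
    \sum_k L a k * f k = \sum_b L1 a b * f (widen_ord qI b).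
  transitivity (\sum_(k < #|I| | (k < q)%N) L a k * f k).
    rewrite (bigID (fun k : 'I_#|I| => (k < q)%N))/= [X in _ + X]big1 ?addr0//.
    move=> k; rewrite -leqNgt => qk; rewrite /L tH ?mul0r//.
    exact: leq_trans (ltn_ord a) qk.
  by rewrite big_ord_narrow; apply: eq_bigr => b _; rewrite [L1 _ _]mxE.
have UL : U = L1 *m y1.
  have Ux : U = L *m y.
    rewrite /L /y mulmxA -(mulmxA (A' w)) HH' mulmx1.
    apply/colP => a; rewrite UE mxE (reindex (@enum_val I xpredT))/=; last first.
      by apply: onW_bij; exact: enum_val_bij.
    by apply: eq_bigr => k _; rewrite !mxE.
  apply/colP => a; rewrite Ux mxE Lsum mxE.
  by apply: eq_bigr => b _; rewrite [y1 b 0]mxE.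
have JL : J = L1 *m L1^T.
  have JL' : J = L *m L^T.
    rewrite /L trmx_mul trmxK mulmxA -(mulmxA (A' w)) HH' mulmx1.
    apply/matrixP => a b; rewrite JE mxE (reindex (@enum_val I xpredT))/=; last first.
      by apply: onW_bij; exact: enum_val_bij.
    by apply: eq_bigr => k _; rewrite !mxE.
  apply/matrixP => a b; rewrite JL' mxE.
  under eq_bigr do rewrite [L^T _ _]mxE.
  rewrite Lsum mxE; apply: eq_bigr => c _; congr (_ * _); by rewrite !mxE.
have unitL : L1 \in unitmx by move: unitJ; rewrite JL unitmx_mul => /andP[].
have unitLT : L1^T \in unitmx by rewrite unitmx_tr.
have -> : U^T *m invmx J *m U = y1^T *m y1.
  have JyU : J *m (invmx L1^T *m y1) = U.
    by rewrite JL UL mulmxA -(mulmxA L1) mulmxV// mulmx1.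
  rewrite -mulmxA -[in LHS]JyU mulKmx// JyU UL trmx_mul mulmxA.
  by rewrite -(mulmxA y1^T) mulmxV// mulmx1.
rewrite mxE; apply: eq_bigr => a _.
by rewrite !mxE expr2.
Qed.
End IndepNormal.

(** Joint laws that agree on boxes agree as measures on tuples; this allows comparing expectations
    across different probability spaces. *)
Lemma expectation_eq_boxes (R : realType) d1 d2 (T1 : measurableType d1)
    (T2 : measurableType d2) (P1 : probability T1 R) (P2 : probability T2 R)
    (n : nat) (X1 : 'I_n -> T1 -> R) (X2 : 'I_n -> T2 -> R) (F : n.-tuple R -> R) :
  (forall i, measurable_fun [set: T1] (X1 i)) ->
  (forall i, measurable_fun [set: T2] (X2 i)) ->
  (forall A : 'I_n -> set R, (forall i, measurable (A i)) ->
    P1 [set t | forall i, A i (X1 i t)] = P2 [set t | forall i, A i (X2 i t)]) ->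
  measurable_fun [set: n.-tuple R] F -> (exists M, forall u, `|F u| <= M) ->
  (\int[P1]_t (F [tuple X1 i t | i < n])%:E
   = \int[P2]_t (F [tuple X2 i t | i < n])%:E)%E.
Proof.
move=> mX1 mX2 X12 mF [M FM].
have mt d' (T' : measurableType d') (X : 'I_n -> T' -> R) :
    (forall i, measurable_fun [set: T'] (X i)) ->
    measurable_fun [set: T'] (fun t => [tuple X i t | i < n]).
  move=> mX; apply/measurable_fun_tnthP => i.
  rewrite (_ : _ \o _ = X i)//; apply/funext => t /=.
  by rewrite tnth_mktuple.
pose Y1 : {mfun T1 >-> n.-tuple R} :=
  HB.pack (fun t => [tuple X1 i t | i < n]) (isMeasurableFun.Build _ _ _ _ _ (mt _ _ _ mX1)).
pose Y2 : {mfun T2 >-> n.-tuple R} :=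
  HB.pack (fun t => [tuple X2 i t | i < n]) (isMeasurableFun.Build _ _ _ _ _ (mt _ _ _ mX2)).
have law X : measurable X -> distribution P1 Y1 X = distribution P2 Y2 X.
  apply: measure_eq_boxes.
    by apply: le_lt_trans (ltry 1); apply: probability_le1.
  move=> A mA; have := X12 A mA.
  rewrite /distribution /pushforward /preimage /=.
  under [in RHS]eq_set => t do rewrite /=.
  move=> e; transitivity (P1 [set t | forall i, A i (X1 i t)]).
    by congr (P1 _); apply/seteqP; split => t /= H i; have := H i; rewrite tnth_mktuple.
  rewrite e.
  by congr (P2 _); apply/seteqP; split => t /= H i; have := H i; rewrite tnth_mktuple.
have int d' (T' : measurableType d') (P' : probability T' R) (Y : {mfun T' >-> n.-tuple R}) :
   (\int[distribution P' Y]_u (F u)%:E = \int[P']_t (F (Y t))%:E)%E.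
  rewrite integral_pushforward//.
    exact/measurable_EFinP.
  apply: measurable_bounded_integrable => //.
  - exact: measurableT.
  - exact: (le_lt_trans (probability_le1 P' measurableT) (ltry 1)).
  - exact: (measurableT_comp mF (@measurable_funPT _ _ _ _ Y)).
  - exists M; split; first exact: num_real.
    by move=> K MK u _; exact: le_trans (FM _) (ltW MK).
have -> := esym (int _ _ P1 Y1).
have -> := esym (int _ _ P2 Y2).
by apply: eq_measure_integral => X mX _; exact: law.
Qed.

(** * Deterministic asymptotics along an ultrafilter *)

Section Tends.
Variables (R : realType) (O : Type) (F : set_system O).
Implicit Types f g : O -> R.

Definition tends f (l : R) : Prop := f x @[x --> F] --> l.

Lemma tends_eq f g a b : f =1 g -> a = b -> tends f a -> tends g b.
Proof. by move=> /funext -> ->. Qed.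

Section Filter.
Hypothesis FF : Filter F.

Lemma tends_cst (l : R) : tends (fun=> l) l. Proof. exact: cvg_cst. Qed.

Lemma tendsD f g a b : tends f a -> tends g b ->
  tends (fun o => f o + g o) (a + b).
Proof. exact: cvgD. Qed.

Lemma tendsN f a : tends f a -> tends (fun o => - f o) (- a).
Proof. exact: cvgN. Qed.

Lemma tendsM f g a b : tends f a -> tends g b ->
  tends (fun o => f o * g o) (a * b).
Proof. exact: cvgM. Qed.

Lemma tendsV f a : a != 0 -> tends f a -> tends (fun o => (f o)^-1) a^-1.
Proof. exact: cvgV. Qed.

Lemma tends_sqr f a : tends f a -> tends (fun o => f o ^+ 2) (a ^+ 2).
Proof. by move=> fa; exact: tendsM. Qed.

Lemma tends_sum (I : Type) (r : seq I) (P : pred I) (f : O -> I -> R) a :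
  (forall i, P i -> tends (f^~ i) (a i)) ->
  tends (fun o => \sum_(i <- r | P i) f o i) (\sum_(i <- r | P i) a i).
Proof.
have cD : continuous (fun z : R * R => z.1 + z.2) by move=> z; exact: add_continuous.
by move=> fa; exact: (@cvg_big _ _ +%R 0 P cD _ F r (fun i o => f o i) a FF).
Qed.

Lemma tends_prod (I : Type) (r : seq I) (P : pred I) (f : O -> I -> R) a :
  (forall i, P i -> tends (f^~ i) (a i)) ->
  tends (fun o => \prod_(i <- r | P i) f o i) (\prod_(i <- r | P i) a i).
Proof.
move=> fa; elim: r => [|i r IH].
  by apply: (@tends_eq (fun=> 1) _ 1) => [w||]; rewrite ?big_nil//; exact: tends_cst.
have [Pi|nPi] := boolP (P i).
  by apply: (tends_eq _ _ (tendsM (fa _ Pi) IH)) => [w|]; rewrite ?big_cons ?Pi.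
by apply: (tends_eq _ _ IH) => [w|]; rewrite ?big_cons ?(negbTE nPi).
Qed.

Lemma tends_near f g a : (\forall o \near F, f o = g o) -> tends f a -> tends g a.
Proof.
move=> fg fa; apply: cvg_trans fa; apply: near_eq_cvg.
by apply: filterS fg => o ->.
Qed.

Lemma tends_ln f a : 0 < a -> tends f a -> tends (fun o => ln (f o)) (ln a).
Proof.
move=> a0 fa; apply: (continuous_cvg _ _ fa); exact: continuous_ln.
Qed.

Lemma tends_det n (A : O -> 'M[R]_n) (B : 'M[R]_n) :
  (forall i j, tends (fun o => A o i j) (B i j)) ->
  tends (fun o => \det (A o)) (\det B).
Proof.
move=> AB; rewrite /determinant; apply: tends_sum => s _.
apply: tendsM; first exact: tends_cst.
by apply: tends_prod => i _.
Qed.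

Lemma tends_invmx n (A : O -> 'M[R]_n) (B : 'M[R]_n) :
  (forall o, A o \in unitmx) -> B \in unitmx ->
  (forall i j, tends (fun o => A o i j) (B i j)) ->
  forall i j, tends (fun o => invmx (A o) i j) (invmx B i j).
Proof.
move=> uA uB AB i j; rewrite /invmx uB mxE.
apply: (@tends_eq (fun o => (\det (A o))^-1 * (\adj (A o)) i j)) => //.
  by move=> o; rewrite uA [RHS]mxE.
apply: tendsM; first by apply: tendsV; [rewrite -unitfE -unitmxE|exact: tends_det].
rewrite mxE; apply: (@tends_eq (fun o => cofactor (A o) j i)) => //.
  by move=> o; rewrite mxE.
rewrite /cofactor; apply: tendsM; first exact: tends_cst.
apply: tends_det => k l; rewrite !mxE.
by apply: tends_eq (AB _ _) => // o; rewrite !mxE.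
Qed.
End Filter.

Lemma tends_unique (PF : ProperFilter F) f a b : tends f a -> tends f b -> a = b.
Proof. exact: (@cvg_unique _ (@Rhausdorff R)). Qed.

(** The image of an ultrafilter is an ultrafilter, and an ultrafilter on a compact segment
    converges. This replaces the extraction of subsequences, and one ultrafilter serves all
    quantities at once. *)
Lemma ultra_bounded_tends (UF : UltraFilter F) f (M : R) :
  (forall o, `|f o| <= M) -> exists l, tends f l.
Proof.
move=> fM.
have fF : UltraFilter (f @ F).
  split; first exact: fmap_proper_filter.
  move=> G GF sG; apply/seteqP; split => // A GA.
  have [//|FnA] := in_ultra_setVsetC (f @^-1` A) UF.
  have GnA : G (~` A) by apply: sG.
  have GFF : Filter G by exact: GF.
  have Gn : G (A `&` ~` A) by exact: filterI.
  by have [z []] := filter_ex Gn.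
have := @segment_compact R (- M) M.
rewrite compact_ultra => /(_ _ fF) [|l [_ fl]]; last by exists l.
have FF : Filter F by exact: ultra_proper.
by apply: (@filterE _ F) => o /=; rewrite in_itv/= -ler_norml.
Qed.

(** [f] is bounded only along the filter, so the previous lemma is applied to a truncation that
    eventually coincides with [f]. The level |a| + 2 works because b <= (b + 1)^2 for b = |a| +
    1. *)
Lemma ultra_sqr_tends (UF : UltraFilter F) f g a :
  (forall o, f o ^+ 2 <= g o) -> tends g a -> exists l, tends f l.
Proof.
move=> fg ga.
pose M : R := `|a| + 1 + 1.
have fM o : `|if `|f o| <= M then f o else 0| <= M.
  by case: ifP => // _; rewrite normr0 !addr_ge0.
have [l hl] := ultra_bounded_tends UF fM.
exists l; apply: tends_near hl.
have a1 : a < `|a| + 1 by rewrite (le_lt_trans (ler_norm a))// ltrDl.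
have FF : Filter F by exact: ultra_proper.
have /(_ FF) := cvgr_lt _ ga _ a1.
apply: filterS => o ho; rewrite ifT//.
have : `|f o| ^+ 2 <= M ^+ 2.
  rewrite real_normK ?num_real// (le_trans (fg o))// (le_trans (ltW ho))//.
  rewrite /M; set b : R := `|a| + 1; have b1 : 1 <= b by rewrite lerDr.
  by nra.
by rewrite ler_sqr// nnegrE// !addr_ge0.
Qed.

End Tends.

(** * Weighted regression on the bias directions *)

Section Information.
Variables (R : realType) (I J : finType) (q : nat) (da db : 'I_q -> I -> R).
Implicit Types (k z : I -> J -> R) (b : I -> R) (x : J -> R).

(** Derivative of alpha_i + beta_i x_j in the bias direction [a]. *)
Definition tangent x (a : 'I_q) (i : I) (j : J) : R := da a i + x j * db a i.

(* In level [j] the tangent is projected, for the weights [k], orthogonally to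
   [b]: this eliminates the nuisance perturbation of the level itself. *)
Definition leverage k b x (a : 'I_q) (j : J) : R :=
  (\sum_i k i j * b i * tangent x a i j) / (\sum_i k i j * b i ^+ 2).

Definition residual k b x (a : 'I_q) (i : I) (j : J) : R :=
  tangent x a i j - b i * leverage k b x a j.

Definition info k b x : 'M[R]_q :=
  \matrix_(a, c) \sum_j \sum_i k i j * residual k b x a i j * residual k b x c i j.

Definition score k b x z : 'cV[R]_q :=
  \col_a \sum_j \sum_i k i j * residual k b x a i j * z i j.

Lemma residual_orthogonal k b x a j : \sum_i k i j * b i ^+ 2 != 0 ->
  \sum_i k i j * residual k b x a i j * b i = 0.
Proof.
move=> D0.
rewrite (eq_bigr (fun i => k i j * b i * tangent x a i j
    - leverage k b x a j * (k i j * b i ^+ 2))); last first.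
  by move=> i _; rewrite /residual; ring.
by rewrite sumrB -mulr_sumr /leverage divfK// subrr.
Qed.

(** The residuals are orthogonal to [b], so projecting one of the two factors is enough. *)
Lemma info_tangent k b x a c : (forall j, \sum_i k i j * b i ^+ 2 != 0) ->
  info k b x a c = \sum_j \sum_i k i j * residual k b x a i j * tangent x c i j.
Proof.
move=> D0; rewrite mxE; apply: eq_bigr => j _.
rewrite (eq_bigr (fun i => k i j * residual k b x a i j * tangent x c i j
    - leverage k b x c j * (k i j * residual k b x a i j * b i))); last first.
  by move=> i _; rewrite /residual; ring.
by rewrite sumrB -mulr_sumr residual_orthogonal// mulr0 subr0.
Qed.

(** This is the Schur complement left by eliminating the level coefficients, the form in which the
    normalized observed information converges. *)
Lemma info_schur k b x a c : (forall j, \sum_i k i j * b i ^+ 2 != 0) ->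
  info k b x a c = \sum_j (\sum_i k i j * tangent x a i j * tangent x c i j
    - (\sum_i k i j * b i * tangent x a i j) * (\sum_i k i j * b i * tangent x c i j)
      / (\sum_i k i j * b i ^+ 2)).
Proof.
move=> D0; rewrite info_tangent//; apply: eq_bigr => j _.
rewrite (eq_bigr (fun i => k i j * tangent x a i j * tangent x c i j
    - leverage k b x a j * (k i j * b i * tangent x c i j))); last first.
  by move=> i _; rewrite /residual; ring.
by rewrite sumrB -mulr_sumr /leverage mulrAC.
Qed.

Lemma info_sym k b x : (info k b x)^T = info k b x.
Proof.
apply/matrixP => a c; rewrite !mxE; apply: eq_bigr => j _; apply: eq_bigr => i _.
by ring.
Qed.

Variables (i0 : I) (j0 j1 : J).
Hypothesis reference : forall a, da a i0 = 0 /\ db a i0 = 0.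
Hypothesis identifiable : forall a,
  (exists i, forall h : 'I_q -> R, \sum_c h c * da c i = h a) \/
  (exists i, forall h : 'I_q -> R, \sum_c h c * db c i = h a).

(** A kernel vector makes a weighted sum of squares vanish, hence every combined residual. The
    reference laboratory, with zero tangents and slope 1, kills the level coefficients; two distinct
    levels separate the intercept part from the slope part; [identifiable] then recovers each
    coordinate. *)
Lemma info_unit k b x : (forall i j, 0 < k i j) -> b i0 = 1 -> x j0 != x j1 ->
  info k b x \in unitmx.
Proof.
move=> k0 b1 xj.
rewrite -row_free_unit; apply: inj_row_free => v vJ.
pose rv i j := \sum_a v 0 a * residual k b x a i j.
have sq : \sum_j \sum_i k i j * rv i j ^+ 2 = 0.
  transitivity ((v *m info k b x *m v^T) 0 0); last by rewrite vJ mul0mx mxE.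
  pose t j i c a := v 0 a * (k i j * residual k b x a i j * residual k b x c i j) * v 0 c.
  transitivity (\sum_j \sum_i \sum_c \sum_a t j i c a).
    apply: eq_bigr => j _; apply: eq_bigr => i _.
    rewrite expr2 {1}/rv mulr_suml mulr_sumr; apply: eq_bigr => c _.
    by rewrite /rv !mulr_sumr; apply: eq_bigr => a _; rewrite /t; ring.
  transitivity (\sum_c \sum_a \sum_j \sum_i t j i c a); last first.
    rewrite mxE; apply: eq_bigr => c _; rewrite mxE [v^T _ _]mxE mulr_suml.
    apply: eq_bigr => a _; rewrite mxE mulr_sumr mulr_suml.
    by apply: eq_bigr => j _; rewrite mulr_sumr mulr_suml.
  transitivity (\sum_j \sum_c \sum_i \sum_a t j i c a).
    by apply: eq_bigr => j _; rewrite exchange_big.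
  rewrite exchange_big; apply: eq_bigr => c _.
  transitivity (\sum_j \sum_a \sum_i t j i c a); last by rewrite exchange_big.
  by apply: eq_bigr => j _; rewrite exchange_big.
have rv0 i j : rv i j = 0.
  have ge0 j' : 0 <= \sum_i k i j' * rv i j' ^+ 2.
    by apply: sumr_ge0 => i' _; rewrite mulr_ge0 ?sqr_ge0// ltW.
  move/eqP: sq; rewrite psumr_eq0// => /allP/(_ j (mem_index_enum j)) /=.
  rewrite psumr_eq0 => [/allP/(_ i (mem_index_enum i)) /=|i' _]; last first.
    by rewrite mulr_ge0 ?sqr_ge0// ltW.
  by rewrite mulf_eq0 gt_eqF//= sqrf_eq0 => /eqP.
pose ha i := \sum_a v 0 a * da a i.
pose hb i := \sum_a v 0 a * db a i.
pose g j := \sum_a v 0 a * leverage k b x a j.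
have rvE i j : rv i j = ha i + x j * hb i - b i * g j.
  rewrite /ha /hb /g !mulr_sumr -sumrN -!big_split/=; apply: eq_bigr => a _.
  by rewrite /residual /tangent; ring.
have g0 j : g j = 0.
  have := rv0 i0 j; rewrite rvE b1 mul1r /ha /hb.
  rewrite !big1 ?mulr0 ?addr0 ?add0r; last 2 first.
  - by move=> a _; rewrite (reference a).2 mulr0.
  - by move=> a _; rewrite (reference a).1 mulr0.
  by move/eqP; rewrite oppr_eq0 => /eqP.
have hb0 i : hb i = 0.
  have := rv0 i j0; have := rv0 i j1; rewrite !rvE !g0 !mulr0 !subr0 => e1 e0.
  have : (x j0 - x j1) * hb i = 0 by rewrite mulrBl; lra.
  by move/eqP; rewrite mulf_eq0 subr_eq0 (negbTE xj) => /eqP.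
have ha0 i : ha i = 0.
  by have := rv0 i j0; rewrite rvE g0 hb0 !mulr0 subr0 addr0.
apply/rowP => a; rewrite mxE.
by case: (identifiable a) => -[i] <-; [exact: ha0|exact: hb0].
Qed.
End Information.

Arguments tends_cst {R O F FF}.
Arguments tendsD {R O F FF f g a b}.
Arguments tendsN {R O F FF f a}.
Arguments tendsM {R O F FF f g a b}.
Arguments tendsV {R O F FF f a}.
Arguments tends_sqr {R O F FF f a}.
Arguments tends_sum {R O F FF I r P f a}.
Arguments tends_near {R O F FF f g a}.
Arguments tends_ln {R O F FF f a}.
Arguments tends_invmx {R O F FF n A B}.
Arguments tends_unique {R O F PF f a b}.

(** Limits follow the syntax of the expression. Inverses have no rule, since they need a nonzero
    limit; their limits are taken from the context. *)
Ltac tnd := cbv beta; lazymatch goal with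
  | |- tends _ (fun w => (@?f w + @?g w)%R) _ => apply: tendsD; tnd
  | |- tends _ (fun w => (- @?f w)%R) _ => apply: tendsN; tnd
  | |- tends _ (fun w => (@?f w ^+ 2)%R) _ => apply: tends_sqr; tnd
  | |- tends _ (fun w => (@?f w * @?g w)%R) _ => apply: tendsM; tnd
  | |- tends _ (fun w => @bigop.body _ _ _ _ _) _ => apply: tends_sum => ? _; tnd
  | |- _ => first [solve [eauto] | exact: tends_cst]
  end.

(** The divisor [g] is nonzero only eventually, so [f] is recovered from the product [h] along the
    filter. *)
Lemma tends_div (R : realType) (O : Type) (F : set_system O) (FF : Filter F)
    (f g h : O -> R) (a b : R) : b != 0 -> (forall w, h w = f w * g w) ->
  tends F h a -> tends F g b -> tends F f (a / b).
Proof.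
move=> b0 hfg ha gb.
apply: (@tends_near _ _ _ _ (fun w => h w * (g w)^-1)); last first.
  by apply: tendsM => //; exact: tendsV.
have /(_ FF) := cvgr_neq0 _ gb b0.
by apply: filterS => w gw; rewrite hfg mulfK.
Qed.

(** * Likelihood after integrating out the levels *)

Section ReducedLikelihood.
Variables (R : realType) (I J : finType) (q : nat) (da db : 'I_q -> I -> R).
Variable (s : J -> R).
Implicit Types (a y : I -> J -> R) (al b : I -> R) (mu : J -> R).

(* [I] indexes laboratories, [J] levels, [s] the variances of the levels; [a] is
   the precision of the sample means [y], and [da], [db] the derivatives of
   [al], [b] in the bias directions. [profile_criterion] is -2 log-likelihood up
   to a constant, [bias_score] and [- bias_obs_info] its first and second
   derivatives in the bias directions, divided by -2. *)
Definition precision a b j : R := \sum_i a i j * b i ^+ 2 + (s j)^-1.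

(** Conditional mean of level [j] given the data, and minimizer of its penalized least-squares
    criterion; [precision] is the conditional precision. *)
Definition latent_mean a b y al mu j : R :=
  (\sum_i a i j * b i * (y i j - al i) + mu j / s j) / precision a b j.

Definition misfit a b y al mu i j : R :=
  y i j - al i - b i * latent_mean a b y al mu j.

Definition bias_score a b y al mu c : R :=
  let u := latent_mean a b y al mu in
  \sum_j (\sum_i a i j * tangent da db u c i j * misfit a b y al mu i j
    - (\sum_i a i j * b i * db c i) / precision a b j).

(** Divided by [precision], this is the derivative of [latent_mean] in the bias direction [c]. *)
Definition latent_slope a b y al mu c j : R :=
  \sum_i a i j * (misfit a b y al mu i j * db c i
    - b i * tangent da db (latent_mean a b y al mu) c i j).

Definition bias_obs_info a b y al mu : 'M[R]_q := \matrix_(c, e)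
  let u := latent_mean a b y al mu in
  \sum_j ((\sum_i a i j * db c i * db e i) / precision a b j
    - 2 * (\sum_i a i j * b i * db c i) * (\sum_i a i j * b i * db e i)
        / precision a b j ^+ 2
    + \sum_i a i j * tangent da db u c i j * tangent da db u e i j
    - latent_slope a b y al mu c j * latent_slope a b y al mu e j
        / precision a b j).

Definition profile_criterion a b y al mu : R :=
  \sum_j (ln (precision a b j) + (\sum_i a i j * misfit a b y al mu i j ^+ 2
    + (latent_mean a b y al mu j - mu j) ^+ 2 / s j)).
End ReducedLikelihood.

(** * Common limit of the Wald and score forms *)

Section Limit.
Variables (R : realType) (I J : finType) (q : nat) (da db : 'I_q -> I -> R).
Variables (i0 : I) (j0 j1 : J).
Hypothesis reference : forall a, da a i0 = 0 /\ db a i0 = 0.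
Hypothesis identifiable : forall a,
  (exists i, forall h : 'I_q -> R, \sum_c h c * da c i = h a) \/
  (exists i, forall h : 'I_q -> R, \sum_c h c * db c i = h a).
Variables (O : Type) (U : set_system O) (UU : UltraFilter U).
Variables (M : O -> R) (k z : O -> I -> J -> R) (al be : O -> I -> R).
Variables (x mu : O -> J -> R) (s : J -> R) (dl : O -> 'I_q -> R).
Variables (k' z' : I -> J -> R) (be' : I -> R) (x' : J -> R).
Hypothesis s0 : forall j, 0 < s j.
Hypothesis M0 : forall w, 0 < M w.
Hypothesis MV : tends U (fun w => (M w)^-1) 0.
Hypothesis k0 : forall w i j, 0 < k w i j.
Hypothesis k'0 : forall i j, 0 < k' i j.
Hypothesis kl : forall i j, tends U (fun w => k w i j) (k' i j).
Hypothesis zl : forall i j, tends U (fun w => z w i j) (z' i j).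
Hypothesis bel : forall i, tends U (fun w => be w i) (be' i).
Hypothesis xl : forall j, tends U (fun w => x w j) (x' j).
Arguments MV : clear implicits.
Arguments kl : clear implicits.
Arguments zl : clear implicits.
Arguments bel : clear implicits.
Arguments xl : clear implicits.
Hypothesis be1 : forall w, be w i0 = 1.
Hypothesis x01 : forall w, x w j0 != x w j1.
Hypothesis x'01 : x' j0 != x' j1.

Let a w i j := M w ^+ 2 * k w i j.
Let y w i j := al w i + be w i * x w j + z w i j / M w.
Let alh w i := al w i + \sum_c dl w c * da c i.
Let beh w i := be w i + \sum_c dl w c * db c i.
Let u w := latent_mean s (a w) (beh w) (y w) (alh w) (mu w).
Let rs w i j := misfit s (a w) (beh w) (y w) (alh w) (mu w) i j.
Let A w j := precision s (a w) (beh w) j.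

Hypothesis better_than_truth : forall w,
  profile_criterion s (a w) (beh w) (y w) (alh w) (mu w)
  <= \sum_j (ln (precision s (a w) (be w) j) + \sum_i a w i j * (z w i j / M w) ^+ 2).
Hypothesis first_order : forall w c,
  bias_score da db s (a w) (beh w) (y w) (alh w) (mu w) c = 0.

Let res w i j := M w * rs w i j.
(** [D0] and [D] are the precisions at the true and at the estimated slopes, divided by
    [M w ^+ 2]. *)
Let D0 w j := \sum_i k w i j * be w i ^+ 2 + (s j)^-1 * (M w)^-1 ^+ 2.
Let D w j := \sum_i k w i j * beh w i ^+ 2 + (s j)^-1 * (M w)^-1 ^+ 2.

Let Mn0 w : M w != 0. Proof. by rewrite gt_eqF. Qed.
Let FU : Filter U. Proof. exact: ultra_proper. Qed.

Let beh1 w : beh w i0 = 1.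
Proof.
by rewrite /beh be1 big1 ?addr0// => c _; rewrite (reference c).2 mulr0.
Qed.

Let be'1 : be' i0 = 1.
Proof.
have h : tends U (fun w => be w i0) 1.
  by apply: (@tends_eq _ _ _ (fun=> 1) _ 1) => [w||]; rewrite ?be1//; exact: tends_cst.
exact: (tends_unique (bel i0) h).
Qed.

Let precD b w j : precision s (a w) b j
  = M w ^+ 2 * (\sum_i k w i j * b i ^+ 2 + (s j)^-1 * (M w)^-1 ^+ 2).
Proof.
rewrite /precision mulrDr mulrCA exprVn mulfV ?expf_neq0// mulr1 mulr_sumr.
by congr (_ + _); apply: eq_bigr => i _; rewrite /a mulrA.
Qed.

(** The reference slope alone keeps the precision away from zero, for arbitrary slopes of the other
    laboratories. *)
Let sum_ge b w j : b i0 = 1 ->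
  k w i0 j <= \sum_i k w i j * b i ^+ 2 + (s j)^-1 * (M w)^-1 ^+ 2.
Proof.
move=> b1; rewrite (bigD1 i0)//= b1 expr1n mulr1 -addrA lerDl addr_ge0//.
  by apply: sumr_ge0 => i _; rewrite mulr_ge0 ?sqr_ge0// ltW.
by rewrite mulr_ge0 ?sqr_ge0// invr_ge0 ltW.
Qed.

Let Dpos w j : 0 < D w j.
Proof. exact: lt_le_trans (k0 w i0 j) (sum_ge _ _ (beh1 w)). Qed.

Let K w := \sum_j (ln (D0 w j) - ln (k w i0 j) + \sum_i k w i j * z w i j ^+ 2).

Let Kl : exists K', tends U K K'.
Proof.
exists (\sum_j (ln (\sum_i k' i j * be' i ^+ 2 + (s j)^-1 * 0 ^+ 2) - ln (k' i0 j)
  + \sum_i k' i j * z' i j ^+ 2)).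
have D'0 j : 0 < \sum_i k' i j * be' i ^+ 2 + (s j)^-1 * 0 ^+ 2.
  rewrite expr0n/= mulr0 addr0 (bigD1 i0)//= be'1 expr1n mulr1.
  rewrite ltr_pwDl//; apply: sumr_ge0 => i _.
  by rewrite mulr_ge0 ?sqr_ge0// ltW.
apply: tends_sum => j _; apply: tendsD; last by tnd.
apply: tendsD; last by apply: tendsN; exact: tends_ln.
by apply: tends_ln => //; rewrite /D0; tnd.
Qed.

(** In the comparison with the truth the terms ln M^2 of the two log-precisions cancel; what
    remains, [K w], has a finite limit. *)
Let bounded w : \sum_j (\sum_i k w i j * res w i j ^+ 2
  + (u w j - mu w j) ^+ 2 / s j) <= K w.
Proof.
have H := better_than_truth w.
apply: (@le_trans _ _ (\sum_j (ln (precision s (a w) (be w) j)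
    + \sum_i a w i j * (z w i j / M w) ^+ 2)
  - \sum_j ln (precision s (a w) (beh w) j))).
  rewrite lerBrDl -big_split/=; apply: le_trans H; rewrite le_eqVlt; apply/orP; left.
  apply/eqP; apply: eq_bigr => j _; congr (_ + (_ + _)).
  by apply: eq_bigr => i _; rewrite /res exprMn /a mulrA (mulrC (k w i j)).
rewrite -sumrB; apply: ler_sum => j _.
rewrite addrAC lerD//; last first.
  apply: ler_sum => i _; rewrite /a le_eqVlt; apply/orP; left; apply/eqP.
  by field.
rewrite !precD lnM ?posrE ?exprn_gt0//; last first.
  exact: lt_le_trans (k0 w i0 j) (sum_ge _ _ (be1 w)).
rewrite lnM ?posrE ?exprn_gt0//; last exact: Dpos.
rewrite opprD addrACA subrr add0r lerB//.
by rewrite ler_ln ?posrE//; [exact: sum_ge|exact: Dpos].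
Qed.

Let term_ge0 w j : 0 <= \sum_i k w i j * res w i j ^+ 2
  + (u w j - mu w j) ^+ 2 / s j.
Proof.
apply: addr_ge0; last by rewrite divr_ge0 ?sqr_ge0// ltW.
by apply: sumr_ge0 => i _; rewrite mulr_ge0 ?sqr_ge0// ltW.
Qed.

Let res_le w i j : k w i j * res w i j ^+ 2 <= K w.
Proof.
apply: le_trans (bounded w); rewrite (bigD1 j)//=.
apply: ler_wpDr; first by apply: sumr_ge0 => j' _; exact: term_ge0.
apply: ler_wpDr; first by rewrite divr_ge0 ?sqr_ge0// ltW.
rewrite (bigD1 i)//= lerDl.
by apply: sumr_ge0 => i' _; rewrite mulr_ge0 ?sqr_ge0// ltW.
Qed.

Let resl : exists r : I -> J -> R, forall i j, tends U (fun w => res w i j) (r i j).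
Proof.
have [K' KK'] := Kl.
have /choice[r rP] : forall ij : I * J, exists l, tends U (fun w => res w ij.1 ij.2) l.
  move=> [i j] /=; apply: (@ultra_sqr_tends _ _ _ _ _ (fun w => K w / k w i j)).
    by move=> w; rewrite ler_pdivlMr// mulrC; exact: res_le.
  exact (tendsM KK' (tendsV (lt0r_neq0 (k'0 i j)) (kl i j))).
by exists (fun i j => r (i, j)) => i j; exact: (rP (i, j)).
Qed.

Let shrinkl : exists v : J -> R, forall j, tends U (fun w => u w j - mu w j) (v j).
Proof.
have [K' KK'] := Kl.
suff /choice[v vP] : forall j, exists l, tends U (fun w => u w j - mu w j) l by exists v.
move=> j; apply: (@ultra_sqr_tends _ _ _ _ _ (fun w => K w * s j)).
  move=> w; rewrite -ler_pdivrMr//; apply: le_trans (bounded w); rewrite (bigD1 j)//=.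
  apply: ler_wpDr; first by apply: sumr_ge0 => j' _; exact: term_ge0.
  rewrite lerDr; apply: sumr_ge0 => i' _; by rewrite mulr_ge0 ?sqr_ge0// ltW.
by tnd.
Qed.

Let h w c := M w * dl w c.
Let ha w i := \sum_c h w c * da c i.
Let hb w i := \sum_c h w c * db c i.
Let g w j := M w * (u w j - x w j).

Let haE w i : ha w i = M w * \sum_c dl w c * da c i.
Proof. by rewrite mulr_sumr; apply: eq_bigr => c _; rewrite mulrA. Qed.

Let hbE w i : hb w i = M w * \sum_c dl w c * db c i.
Proof. by rewrite mulr_sumr; apply: eq_bigr => c _; rewrite mulrA. Qed.

(** An exact linearization: with the slope error evaluated at the estimated level [u], there is no
    second-order remainder. *)
Let resE w i j : res w i j = z w i j - (ha w i + u w j * hb w i) - be w i * g w j.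
Proof.
rewrite haE hbE /res /rs /misfit -/(u w) /y /alh /beh /g.
by field.
Qed.

Let ha0 w : ha w i0 = 0.
Proof. by rewrite /ha big1// => c _; rewrite (reference c).1 mulr0. Qed.

Let hb0 w : hb w i0 = 0.
Proof. by rewrite /hb big1// => c _; rewrite (reference c).2 mulr0. Qed.

(** The right-hand side stems from the log-precision and carries a factor 1/M: in the limit only
    least squares remains. *)
Let first_order_scaled w c :
  \sum_j \sum_i k w i j * tangent da db (u w) c i j * res w i j
  = (M w)^-1 * \sum_j (\sum_i k w i j * beh w i * db c i) / D w j.
Proof.
have /eqP := first_order w c.
rewrite /bias_score /= sumrB subr_eq0 => /eqP H.
apply: (mulfI (Mn0 w)); rewrite mulrA mulfV// mul1r mulr_sumr.
transitivity (\sum_j (\sum_i a w i j * beh w i * db c i) / precision s (a w) (beh w) j); last first.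
  apply: eq_bigr => j _; rewrite precD -/(D w j) /a.
  rewrite invfM mulrA; congr (_ / _).
  rewrite mulr_suml; apply: eq_bigr => i _.
  by field.
rewrite -H; apply: eq_bigr => j _; rewrite mulr_sumr; apply: eq_bigr => i _.
by rewrite /res /rs /a -/(u w); ring.
Qed.

(** Normal equation of the level. The prior enters with the factor 1/M and, since [u - mu]
    converges, disappears in the limit. *)
Let latent_scaled w j :
  \sum_i k w i j * beh w i * res w i j = (M w)^-1 * ((u w j - mu w j) / s j).
Proof.
have An0 : precision s (a w) (beh w) j != 0.
  by rewrite precD mulf_neq0 ?expf_neq0// gt_eqF//; exact: Dpos.
have e : precision s (a w) (beh w) j * u w j
    = \sum_i a w i j * beh w i * (y w i j - alh w i) + mu w j / s j.
  by rewrite /u /latent_mean mulrCA mulfV// mulr1.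
apply: (mulfI (Mn0 w)); rewrite mulrA mulfV// mul1r mulr_sumr.
transitivity (\sum_i a w i j * beh w i * (y w i j - alh w i)
    - (\sum_i a w i j * beh w i ^+ 2) * u w j).
  rewrite mulr_suml -sumrB; apply: eq_bigr => i _.
  by rewrite /res /rs /misfit -/(u w) /a; ring.
move: e; rewrite /precision mulrDl => /eqP; rewrite eq_sym -subr_eq => /eqP <-.
rewrite mulrBl; field.
by rewrite gt_eqF.
Qed.

(** At the reference laboratory the linearization reads res = z - g, so the level errors shrink at
    rate 1/M and the estimated levels have the limits of the true ones. At each laboratory the
    levels [j0] and [j1] then give two linear equations for the scaled intercept and slope errors,
    solvable because [x' j0 != x' j1]. *)
Let limits : exists r : I -> J -> R, exists h' : 'I_q -> R, exists g' : J -> R,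
  [/\ forall i j, tends U (fun w => res w i j) (r i j),
      forall c, tends U (fun w => h w c) (h' c),
      forall j, tends U (fun w => g w j) (g' j) &
      forall j, tends U (fun w => u w j) (x' j)].
Proof.
have [r rP] := resl.
pose g' j := z' i0 j - r i0 j.
have gP j : tends U (fun w => g w j) (g' j).
  apply: (@tends_eq _ _ _ (fun w => z w i0 j - res w i0 j)) => //; last by tnd.
  by move=> w; rewrite resE ha0 hb0 be1; ring.
have uP j : tends U (fun w => u w j) (x' j).
  apply: (@tends_eq _ _ _ (fun w => x w j + g w j * (M w)^-1) _ (x' j + g' j * 0)).
  - by move=> w; rewrite /g mulrAC mulfV// mul1r; ring.
  - by rewrite mulr0 addr0.
  - by tnd.
pose kk w i j := ha w i + u w j * hb w i.
have kkP i j : tends U (fun w => kk w i j) (z' i j - r i j - be' i * g' j).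
  apply: (@tends_eq _ _ _ (fun w => z w i j - res w i j - be w i * g w j)) => //.
    by move=> w; rewrite resE /kk; ring.
  by tnd.
have hbP i : exists l, tends U (fun w => hb w i) l.
  exists ((z' i j0 - r i j0 - be' i * g' j0 - (z' i j1 - r i j1 - be' i * g' j1)) / (x' j0 - x' j1)).
  apply: (@tends_div _ _ _ _ _ (fun w => u w j0 - u w j1) (fun w => kk w i j0 - kk w i j1)).
  - by rewrite subr_eq0.
  - by move=> w; rewrite /kk; ring.
  - by apply: tendsD => //; exact: tendsN.
  - by apply: tendsD => //; exact: tendsN.
have haP i : exists l, tends U (fun w => ha w i) l.
  have [l hl] := hbP i.
  exists (z' i j0 - r i j0 - be' i * g' j0 - x' j0 * l).
  apply: (@tends_eq _ _ _ (fun w => kk w i j0 - u w j0 * hb w i)) => //.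
    by move=> w; rewrite /kk; ring.
  by apply: tendsD => //; apply: tendsN; exact: tendsM.
have /choice [h' hP] : forall c, exists l, tends U (fun w => h w c) l.
  move=> c; case: (identifiable c) => -[i ic].
    have [l hl] := haP i; exists l; apply: tends_eq hl => // w.
    by rewrite /ha ic.
  have [l hl] := hbP i; exists l; apply: tends_eq hl => // w.
  by rewrite /hb ic.
by exists r, h', g'.
Qed.

(** In the limit the residuals satisfy the normal equations of the weighted regression of [z'],
    whose solution is the limit h' of the scaled bias errors. Hence score = info h', and both forms
    tend to h'^T info h'. *)
Theorem quadratic_forms_merge : exists l : R,
  tends U (fun w => \sum_c \sum_e dl w c *
    bias_obs_info da db s (a w) (beh w) (y w) (alh w) (mu w) c e * dl w e) l /\
  tends U (fun w => ((score da db (k w) (be w) (x w) (z w))^T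
    *m invmx (info da db (k w) (be w) (x w))
    *m score da db (k w) (be w) (x w) (z w)) 0 0) l.
Proof.
have [r [h' [g' [rP hP gP uP]]]] := limits.
have [v vP] := shrinkl.
have dlP c : tends U (fun w => dl w c) 0.
  apply: (@tends_eq _ _ _ (fun w => h w c * (M w)^-1) _ (h' c * 0)).
  - by move=> w; rewrite /h mulrAC mulfV// mul1r.
  - by rewrite mulr0.
  - by tnd.
have behP i : tends U (fun w => beh w i) (be' i).
  apply: (@tends_eq _ _ _ (beh^~ i) _ (be' i + \sum_c 0 * db c i)) => //.
    by rewrite big1 ?addr0// => c _; rewrite mul0r.
  by rewrite /beh; tnd.
pose D' j := \sum_i k' i j * be' i ^+ 2.
have D'0 j : 0 < D' j.
  rewrite /D' (bigD1 i0)//= be'1 expr1n mulr1 ltr_pwDl//.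
  by apply: sumr_ge0 => i _; rewrite mulr_ge0 ?sqr_ge0// ltW.
have D'n0 j : D' j != 0 by rewrite gt_eqF.
have DP j : tends U (fun w => D w j) (D' j).
  apply: (@tends_eq _ _ _ (D^~ j) _ (D' j + (s j)^-1 * 0 ^+ 2)) => //.
    by rewrite expr0n/= mulr0 addr0.
  by rewrite /D /D'; tnd.
have DVP j : tends U (fun w => (D w j)^-1) (D' j)^-1 by exact: tendsV.
have tanP c i j : tends U (fun w => tangent da db (u w) c i j)
    (tangent da db x' c i j) by rewrite /tangent; tnd.
have fo c : \sum_j \sum_i k' i j * tangent da db x' c i j * r i j = 0.
  have e1 : tends U (fun w => \sum_j \sum_i k w i j * tangent da db (u w) c i j * res w i j)
      (\sum_j \sum_i k' i j * tangent da db x' c i j * r i j) by tnd.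
  apply: (tends_unique e1).
  apply: (@tends_eq _ _ _ (fun w => (M w)^-1 * \sum_j (\sum_i k w i j * beh w i * db c i) / D w j)
     _ (0 * \sum_j (\sum_i k' i j * be' i * db c i) / D' j)).
  - by move=> w; rewrite first_order_scaled.
  - by rewrite mul0r.
  - by tnd.
have lo j : \sum_i k' i j * be' i * r i j = 0.
  have e1 : tends U (fun w => \sum_i k w i j * beh w i * res w i j)
      (\sum_i k' i j * be' i * r i j) by tnd.
  apply: (tends_unique e1).
  apply: (@tends_eq _ _ _ (fun w => (M w)^-1 * ((u w j - mu w j) / s j)) _ (0 * (v j / s j))).
  - by move=> w; rewrite latent_scaled.
  - by rewrite mul0r.
  - by apply: tendsM; [exact: MV|apply: tendsM; [exact: vP|exact: tends_cst]].
have rE i j : r i j = z' i j - \sum_e h' e * tangent da db x' e i j - be' i * g' j.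
  apply: (tends_unique (rP i j)).
  apply: (@tends_eq _ _ _ (fun w => z w i j - \sum_e h w e * tangent da db (u w) e i j - be w i * g w j)) => //; last by tnd.
  move=> w; rewrite resE; congr (_ - _ - _).
  rewrite /ha /hb mulr_sumr -big_split; apply: eq_bigr => c _ /=.
  by rewrite /tangent; ring.
pose Jl := info da db k' be' x'.
pose Ul := score da db k' be' x' z'.
pose hl : 'cV[R]_q := \col_c h' c.
(* Expanding z' by [rE], the part in [r] is annihilated by [fo] and [lo], and the part in [g'] by
   orthogonality of the residuals to the slopes. *)
have UJ : Ul = Jl *m hl.
  apply/colP => c; rewrite !mxE.
  transitivity (\sum_j \sum_i (k' i j * tangent da db x' c i j * r i j
     - leverage da db k' be' x' c j * (k' i j * be' i * r i j)
     + (\sum_e h' e * (k' i j * residual da db k' be' x' c i j * tangent da db x' e i j)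
        + g' j * (k' i j * residual da db k' be' x' c i j * be' i)))).
    apply: eq_bigr => j _; apply: eq_bigr => i _.
    rewrite -[z' i j](_ : r i j + \sum_e h' e * tangent da db x' e i j + be' i * g' j = _).
      rewrite [X in _ + (X + _)](_ : _ = k' i j * residual da db k' be' x' c i j * \sum_e h' e * tangent da db x' e i j).
        by rewrite /residual; ring.
      by rewrite mulr_sumr; apply: eq_bigr => e _; ring.
    by rewrite rE; ring.
  transitivity (\sum_j \sum_i \sum_e h' e * (k' i j * residual da db k' be' x' c i j * tangent da db x' e i j)).
    transitivity (\sum_j \sum_i k' i j * tangent da db x' c i j * r i j
      + \sum_j \sum_i \sum_e h' e *
        (k' i j * residual da db k' be' x' c i j * tangent da db x' e i j)); last first.
      by rewrite fo add0r.
    rewrite -big_split; apply: eq_bigr => j _ /=.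
    rewrite big_split sumrB -mulr_sumr lo mulr0 subr0; congr (_ + _).
    rewrite big_split -[X in _ + X = _]mulr_sumr residual_orthogonal ?mulr0 ?addr0//.
    exact: D'n0.
  transitivity (\sum_j \sum_e \sum_i h' e * (k' i j * residual da db k' be' x' c i j * tangent da db x' e i j)).
    by apply: eq_bigr => j _; rewrite exchange_big.
  rewrite exchange_big; apply: eq_bigr => e _ /=.
  rewrite [hl e 0]mxE info_tangent// mulr_suml; apply: eq_bigr => j _.
  by rewrite mulr_suml; apply: eq_bigr => i _; ring.
have unitJ w : info da db (k w) (be w) (x w) \in unitmx.
  exact: (info_unit (i0 := i0) (j0 := j0) (j1 := j1)).
have unitJl : Jl \in unitmx.
  exact: (info_unit (i0 := i0) (j0 := j0) (j1 := j1)).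
have SbeP j : tends U (fun w => \sum_i k w i j * be w i ^+ 2) (D' j) by rewrite /D'; tnd.
have SbeVP j : tends U (fun w => (\sum_i k w i j * be w i ^+ 2)^-1) (D' j)^-1 by exact: tendsV.
have resiP c i j : tends U (fun w => residual da db (k w) (be w) (x w) c i j)
    (residual da db k' be' x' c i j).
  by rewrite /residual /leverage /tangent; tnd.
have JP c e : tends U (fun w => info da db (k w) (be w) (x w) c e) (Jl c e).
  rewrite mxE; apply: (@tends_eq _ _ _ (fun w => \sum_j \sum_i k w i j *
    residual da db (k w) (be w) (x w) c i j * residual da db (k w) (be w) (x w) e i j)) => //.
    by move=> w; rewrite mxE.
  by tnd.
have UP c : tends U (fun w => score da db (k w) (be w) (x w) (z w) c 0) (Ul c 0).
  rewrite mxE; apply: (@tends_eq _ _ _ (fun w => \sum_j \sum_i k w i j *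
    residual da db (k w) (be w) (x w) c i j * z w i j)) => //.
    by move=> w; rewrite mxE.
  by tnd.
have JVP c e : tends U (fun w => invmx (info da db (k w) (be w) (x w)) c e)
    (invmx Jl c e).
  exact (tends_invmx unitJ unitJl JP c e).
exists (\sum_c \sum_e h' c * Jl c e * h' e); split.
  (* After division by M^2 the log-precision terms and the misfit part of [latent_slope] vanish; the
     Schur form is left. *)
  have obsP c e : tends U (fun w => bias_obs_info da db s (a w) (beh w) (y w) (alh w) (mu w) c e
      * (M w)^-1 ^+ 2) (Jl c e).
    rewrite info_schur//.
    pose Ls w c j := \sum_i k w i j * (res w i j * (M w)^-1 * db c i
      - beh w i * tangent da db (u w) c i j).
    pose Ll c j := - \sum_i k' i j * be' i * tangent da db x' c i j.
    have LsP c' j : tends U (fun w => Ls w c' j) (Ll c' j).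
      apply: (@tends_eq _ _ _ (fun w => Ls w c' j) _ (\sum_i k' i j * (r i j * 0 * db c' i
          - be' i * tangent da db x' c' i j))) => //; last by rewrite /Ls; tnd.
      by rewrite /Ll -sumrN; apply: eq_bigr => i _; ring.
    apply: (@tends_eq _ _ _ (fun w => \sum_j (
        (\sum_i k w i j * db c i * db e i) * (D w j)^-1 * (M w)^-1 ^+ 2
      + - (2 * (\sum_i k w i j * beh w i * db c i) * (\sum_i k w i j * beh w i * db e i)
          * (D w j)^-1 ^+ 2 * (M w)^-1 ^+ 2)
      + \sum_i k w i j * tangent da db (u w) c i j * tangent da db (u w) e i j
      + - (Ls w c j * Ls w e j * (D w j)^-1))) _
     (\sum_j ((\sum_i k' i j * db c i * db e i) * (D' j)^-1 * 0 ^+ 2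
      + - (2 * (\sum_i k' i j * be' i * db c i) * (\sum_i k' i j * be' i * db e i)
          * (D' j)^-1 ^+ 2 * 0 ^+ 2)
      + \sum_i k' i j * tangent da db x' c i j * tangent da db x' e i j
      + - (Ll c j * Ll e j * (D' j)^-1)))); last by tnd.
    - move=> w; rewrite mxE mulr_suml; apply: eq_bigr => j _ /=.
      have Mn := Mn0 w; have Dn : D w j != 0 by rewrite gt_eqF.
      have aS (f : I -> R) : \sum_i a w i j * f i = M w ^+ 2 * \sum_i k w i j * f i.
        by rewrite mulr_sumr; apply: eq_bigr => i _; rewrite /a mulrA.
      have aS2 (f f' : I -> R) : \sum_i a w i j * f i * f' i
          = M w ^+ 2 * \sum_i k w i j * f i * f' i.
        by rewrite mulr_sumr; apply: eq_bigr => i _; rewrite /a !mulrA.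
      have slope c' : latent_slope da db s (a w) (beh w) (y w) (alh w) (mu w) c' j
          = M w ^+ 2 * Ls w c' j.
        rewrite /latent_slope aS; congr (_ * _); apply: eq_bigr => i _.
        by rewrite /res -/(rs w i j) (mulrC (M w) (rs w i j)) mulfK.
      rewrite !slope !aS2 precD -/(D w j) -/(u w).
      by field; rewrite Mn Dn.
    - apply: eq_bigr => j _; rewrite expr0n/= !mulr0 oppr0 add0r add0r.
      by rewrite /Ll mulrNN.
  apply: (@tends_eq _ _ _ (fun w => \sum_c \sum_e h w c *
    (bias_obs_info da db s (a w) (beh w) (y w) (alh w) (mu w) c e * (M w)^-1 ^+ 2) * h w e)) => //.
    move=> w; apply: eq_bigr => c _; apply: eq_bigr => e _.
    rewrite /h; field.
    exact: Mn0.
  apply: tends_sum => c _; apply: tends_sum => e _; apply: tendsM; last exact: hP.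
  by apply: tendsM; [exact: hP|exact: obsP].
apply: (@tends_eq _ _ _ (fun w => \sum_e (\sum_c score da db (k w) (be w) (x w) (z w) c 0
    * invmx (info da db (k w) (be w) (x w)) c e) * score da db (k w) (be w) (x w) (z w) e 0)
   _ (\sum_e (\sum_c Ul c 0 * invmx Jl c e) * Ul e 0)).
- move=> w; rewrite mxE; apply: eq_bigr => e _; congr (_ * _).
  by rewrite mxE; apply: eq_bigr => c _; rewrite [_^T _ _]mxE.
- transitivity ((Ul^T *m invmx Jl *m Ul) 0 0).
    rewrite mxE; apply: eq_bigr => e _; congr (_ * _).
    by rewrite mxE; apply: eq_bigr => c _; rewrite [Ul^T _ _]mxE.
  rewrite UJ trmx_mul /Jl info_sym -/Jl -!mulmxA mulKmx// mxE.
  apply: eq_bigr => c _; rewrite !mxE mulr_sumr; apply: eq_bigr => e _.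
  by rewrite [hl e 0]mxE mulrA.
- by tnd.
Qed.

End Limit.

(** * Derivatives of the reduced likelihood *)

Section Slope.
Variable R : realType.
Implicit Types f g : R -> R.

Definition slope f (h l : R) : Prop := is_derive h (1 : R) f l.

Lemma slope_eq f g h l l' : f =1 g -> l = l' -> slope f h l -> slope g h l'.
Proof. by move=> /funext -> ->. Qed.

Lemma slope_to f h l l' : slope f h l -> l = l' -> slope f h l'.
Proof. by move=> ? <-. Qed.

Lemma slope_cst (c h : R) : slope (fun=> c) h 0.
Proof. exact: is_derive_cst. Qed.

Lemma slope_affine (c k h : R) : slope (fun t => c + t * k) h k.
Proof.
apply: (@slope_eq (cst c + k \*: id) _ h (0 + k *: 1)).
- by move=> t; rewrite /= /GRing.scale/= mulrC.
- by rewrite add0r /GRing.scale/= mulr1.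
- by apply: is_deriveD; apply: is_deriveZ.
Qed.

Lemma slopeD f g h a b : slope f h a -> slope g h b ->
  slope (fun t => f t + g t) h (a + b).
Proof. exact: is_deriveD. Qed.

Lemma slopeB f g h a b : slope f h a -> slope g h b ->
  slope (fun t => f t - g t) h (a - b).
Proof. exact: is_deriveB. Qed.

Lemma slopeM f g h a b : slope f h a -> slope g h b ->
  slope (fun t => f t * g t) h (a * g h + f h * b).
Proof.
move=> fa gb; have := is_deriveM fa gb.
by apply: slope_eq => //; rewrite /GRing.scale/= addrC (mulrC (g h)).
Qed.

Lemma slope_sqr f h a : slope f h a -> slope (fun t => f t ^+ 2) h (2 * f h * a).
Proof.
by move=> fa; apply: (slope_eq _ _ (slopeM fa fa)) => //; ring.
Qed.

Lemma slope_ln f h a : 0 < f h -> slope f h a -> slope (fun t => ln (f t)) h (a / f h).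
Proof.
move=> f0 fa; have := is_derive1_comp (is_derive1_ln f0) fa.
by apply: slope_eq => //; rewrite mulrC.
Qed.

Lemma slopeV f h a : f h != 0 -> slope f h a ->
  slope (fun t => (f t)^-1) h (- a / f h ^+ 2).
Proof.
move=> f0 fa; have := is_deriveV f0 fa.
by apply: slope_eq => //; rewrite /GRing.scale/= !mulNr mulrC.
Qed.

Lemma slope_div f g h a b : g h != 0 -> slope f h a -> slope g h b ->
  slope (fun t => f t / g t) h ((a - f h / g h * b) / g h).
Proof.
move=> g0 fa gb; apply: slope_eq (slopeM fa (slopeV g0 gb)) => //.
by field.
Qed.

Lemma slope_sum (I : Type) (r : seq I) (P : pred I) (f : R -> I -> R) h a :
  (forall i, P i -> slope (f^~ i) h (a i)) ->
  slope (fun t => \sum_(i <- r | P i) f t i) h (\sum_(i <- r | P i) a i).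
Proof.
move=> fa; elim: r => [|i r IH].
  by apply: slope_eq (slope_cst 0 h) => [t|]; rewrite big_nil.
have [Pi|nPi] := boolP (P i).
  by apply: slope_eq (slopeD (fa _ Pi) IH) => [t|]; rewrite big_cons Pi.
by apply: slope_eq IH => [t|]; rewrite big_cons (negbTE nPi).
Qed.

Lemma slope_max f h l : (forall t, exists l', slope f t l') ->
  slope f h l -> (forall t, f t <= f h) -> l = 0.
Proof.
move=> df [_ <-] fmax.
have : is_derive h (1 : R) f 0.
  apply: (@derive1_at_max _ f (h - 1) (h + 1)) => //.
  - by lra.
  - by move=> t _; have [l' []] := df t.
  - by rewrite in_itv/=; apply/andP; split; lra.
by case.
Qed.
End Slope.

(** The derivative is an existential variable filled in along the syntax; used after [slope_to], it
    leaves only an algebraic identity. *)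
Ltac slp := cbv beta; lazymatch goal with
  | |- slope (fun t => (@?f t - @?g t)%R) _ _ => eapply slopeB; slp
  | |- slope (fun t => (@?f t + @?g t)%R) _ _ => eapply slopeD; slp
  | |- slope (fun t => (@?f t / @?g t)%R) _ _ => first
       [ solve [eapply slope_cst]
       | eapply slope_div; [solve [eauto | rewrite gt_eqF; eauto] | slp | slp] ]
  | |- slope (fun t => (@?f t ^+ 2)%R) _ _ => eapply slope_sqr; slp
  | |- slope (fun t => (@?f t * @?g t)%R) _ _ => eapply slopeM; slp
  | |- slope (fun t => ln (@?f t)) _ _ => eapply slope_ln; [solve [eauto] | slp]
  | |- slope (fun t => @bigop.body _ _ _ _ _) _ _ =>
       eapply slope_sum; let i := fresh "i" in intros i _; slp
  | |- _ => first [solve [eauto] | eapply slope_cst]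
  end.

Section CriterionSlope.
Variables (R : realType) (I J : finType) (q : nat) (da db : 'I_q -> I -> R).
Variables (s : J -> R) (a y : I -> J -> R) (mu : J -> R).
Hypothesis s0 : forall j, 0 < s j.
Hypothesis a0 : forall i j, 0 <= a i j.
Variables (al b : I -> R) (c : 'I_q).

Let al' (t : R) i := al i + t * da c i.
Let b' (t : R) i := b i + t * db c i.

Lemma precision_gt0 (b1 : I -> R) j : 0 < precision s a b1 j.
Proof.
rewrite /precision ltr_wpDl ?invr_gt0//.
by apply: sumr_ge0 => i _; rewrite mulr_ge0 ?sqr_ge0.
Qed.

Let Pn0 (b1 : I -> R) j : precision s a b1 j != 0.
Proof. by rewrite gt_eqF// precision_gt0. Qed.

Lemma slope_precision h j : slope (fun t => precision s a (b' t) j) h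
  (2 * \sum_i a i j * b' h i * db c i).
Proof.
have sb i : slope (fun t => b' t i) h (db c i) by exact: slope_affine.
rewrite /precision.
apply: slope_to; first by slp.
by rewrite addr0 mulr_sumr; apply: eq_bigr => i _; ring.
Qed.

(** Stationarity of the penalized criterion at its minimizer [latent_mean]. *)
Lemma latent_balance (al1 b1 : I -> R) j :
  \sum_i a i j * b1 i * misfit s a b1 y al1 mu i j
  = (latent_mean s a b1 y al1 mu j - mu j) / s j.
Proof.
have e : precision s a b1 j * latent_mean s a b1 y al1 mu j
    = \sum_i a i j * b1 i * (y i j - al1 i) + mu j / s j.
  by rewrite /latent_mean mulrCA mulfV// mulr1.
transitivity (\sum_i a i j * b1 i * (y i j - al1 i)
    - (\sum_i a i j * b1 i ^+ 2) * latent_mean s a b1 y al1 mu j).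
  by rewrite mulr_suml -sumrB; apply: eq_bigr => i _; rewrite /misfit; ring.
move: e; rewrite {1}/precision mulrDl => /eqP; rewrite eq_sym -subr_eq => /eqP <-.
by field; rewrite gt_eqF.
Qed.

(** The linear term vanishes by [latent_balance]. The identity serves twice: for the minimality of
    the profile and for the Gaussian integral over the level. *)
Lemma completed_square (al1 b1 : I -> R) j (v : R) :
  \sum_i a i j * (y i j - al1 i - b1 i * v) ^+ 2 + (v - mu j) ^+ 2 / s j
  = precision s a b1 j * (v - latent_mean s a b1 y al1 mu j) ^+ 2
    + (\sum_i a i j * misfit s a b1 y al1 mu i j ^+ 2
       + (latent_mean s a b1 y al1 mu j - mu j) ^+ 2 / s j).
Proof.
have bal := latent_balance al1 b1 j.
set u0 := latent_mean _ _ _ _ _ _ _ in bal *.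
rewrite (eq_bigr (fun i => a i j * misfit s a b1 y al1 mu i j ^+ 2
   - 2 * (v - u0) * (a i j * b1 i * misfit s a b1 y al1 mu i j)
   + (v - u0) ^+ 2 * (a i j * b1 i ^+ 2))); last first.
  by move=> i _; rewrite /misfit -/u0; ring.
rewrite big_split/= sumrB -!mulr_sumr bal /precision.
by ring.
Qed.

Lemma profile_criterion_le (al1 b1 : I -> R) (v : J -> R) :
  profile_criterion s a b1 y al1 mu
  <= \sum_j (ln (precision s a b1 j)
      + (\sum_i a i j * (y i j - al1 i - b1 i * v j) ^+ 2 + (v j - mu j) ^+ 2 / s j)).
Proof.
apply: ler_sum => j _; rewrite lerD2l completed_square lerDr.
by rewrite mulr_ge0 ?sqr_ge0// ltW// precision_gt0.
Qed.

Let u t := latent_mean s a (b' t) y (al' t) mu.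

Lemma slope_latent_mean h j : slope (fun t => u t j) h
  (latent_slope da db s a (b' h) y (al' h) mu c j / precision s a (b' h) j).
Proof.
have sb i : slope (fun t => b' t i) h (db c i) by exact: slope_affine.
have sal i : slope (fun t => al' t i) h (da c i) by exact: slope_affine.
rewrite /u /latent_mean.
have sp := slope_precision h j.
apply: slope_to; first by slp.
rewrite addr0 -/(latent_mean s a (b' h) y (al' h) mu j); congr (_ / _).
rewrite mulr_sumr mulr_sumr -sumrB; apply: eq_bigr => i _.
by rewrite /misfit /tangent; ring.
Qed.

Lemma slope_misfit h i j :
  slope (fun t => misfit s a (b' t) y (al' t) mu i j) h
    (- tangent da db (u h) c i j
     - b' h i * (latent_slope da db s a (b' h) y (al' h) mu c j / precision s a (b' h) j)).
Proof.
have sb : slope (fun t => b' t i) h (db c i) by exact: slope_affine.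
have sal : slope (fun t => al' t i) h (da c i) by exact: slope_affine.
rewrite /misfit.
have sl := slope_latent_mean h j.
apply: slope_to; first by slp.
by rewrite /= -/(u h) /tangent; ring.
Qed.

(** An envelope argument: [latent_mean] moves with the bias, but by [latent_balance] its
    displacement contributes nothing at first order. *)
Lemma slope_profile_criterion h :
  slope (fun t => profile_criterion s a (b' t) y (al' t) mu) h
    (- 2 * bias_score da db s a (b' h) y (al' h) mu c).
Proof.
rewrite /profile_criterion.
have Pp b1 j := precision_gt0 b1 j.
have sp j := slope_precision h j.
have sm i j := slope_misfit h i j.
have sl j := slope_latent_mean h j.
apply: slope_to; first by slp.
rewrite /bias_score mulr_sumr; apply: eq_bigr => j _.
set v := latent_slope _ _ _ _ _ _ _ _ _ _ / _.
rewrite !subr0 !mulr0 subr0 -/(u h).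
rewrite [X in _ + (X + _)](eq_bigr (fun i => - 2 * (a i j * tangent da db (u h) c i j * misfit s a (b' h) y (al' h) mu i j)
   + (- 2 * v) * (a i j * b' h i * misfit s a (b' h) y (al' h) mu i j))); last first.
  by move=> i _; ring.
rewrite big_split/= -!mulr_sumr latent_balance -/(u h).
by ring.
Qed.

(** At second order the displacement of the latent mean does count; it produces the product of two
    [latent_slope] factors. *)
Lemma slope_bias_score h e :
  slope (fun t => bias_score da db s a (b' t) y (al' t) mu e) h
    (- bias_obs_info da db s a (b' h) y (al' h) mu c e).
Proof.
have sb i : slope (fun t => b' t i) h (db c i) by exact: slope_affine.
have st i j : slope (fun t => tangent da db (u t) e i j) h
    (latent_slope da db s a (b' h) y (al' h) mu c j / precision s a (b' h) j * db e i).
  have sl := slope_latent_mean h j.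
  rewrite /tangent; apply: slope_to; first by slp.
  by rewrite add0r mulr0 addr0.
rewrite /bias_score /=.
have sp j := slope_precision h j.
have sm i j := slope_misfit h i j.
apply: slope_to; first by slp.
rewrite mxE -sumrN; apply: eq_bigr => j _.
rewrite -/(u h).
set L := latent_slope _ _ _ _ _ _ _ _ c _.
set p := precision _ _ _ _.
have -> : latent_slope da db s a (b' h) y (al' h) mu e j
   = \sum_i (a i j * misfit s a (b' h) y (al' h) mu i j * db e i
      - a i j * b' h i * tangent da db (u h) e i j).
  by apply: eq_bigr => i _; rewrite -/(u h); ring.
rewrite (eq_bigr (fun i => L / p * (a i j * misfit s a (b' h) y (al' h) mu i j * db e i
      - a i j * b' h i * tangent da db (u h) e i j)
   - a i j * tangent da db (u h) c i j * tangent da db (u h) e i j)); last first.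
  by move=> i _; ring.
rewrite sumrB -mulr_sumr.
rewrite [X in _ - (X - _) / _](eq_bigr (fun i => a i j * db c i * db e i)); last first.
  by move=> i _; ring.
have p0 : p != 0 by exact: Pn0.
by field.
Qed.
End CriterionSlope.

(** * Closed form of the log-likelihood *)

Lemma iterated_integral_prod (R : realType) (m : nat) (c : R)
    (g : 'I_m -> R -> R) :
  0 <= c -> (forall j t, 0 <= g j t) ->
  (forall j, measurable_fun [set: R] (g j)) ->
  iterated_integral (fun u : 'rV[R]_m => (c * \prod_j g j (u 0 j))%:E)
  = (c%:E * \prod_j \int[lebesgue_measure]_t (g j t)%:E)%E.
Proof.
elim: m c g => [|m IH] c g c0 g0 mg; first by rewrite /= !big_ord0 mulr1 mule1.
rewrite /= big_ord_recl.
have mE j : measurable_fun [set: R] (fun t => (g j t)%:E) by exact/measurable_EFinP.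
transitivity (\int[lebesgue_measure]_t ((c%:E * (g ord0 t)%:E)
    * \prod_(j < m) \int[lebesgue_measure]_t (g (lift ord0 j) t)%:E))%E.
  apply: eq_integral => t _; rewrite -EFinM -IH//; last by rewrite mulr_ge0.
  congr iterated_integral; apply/funext => u; congr EFin.
  rewrite big_ord_recl mulrA; congr (_ * g _ _ * _).
    rewrite (_ : ord0 = lshift m (ord0 : 'I_1)); last exact: val_inj.
    by etransitivity; [exact: (row_mxEl (const_mx t : 'rV[R]_1) u 0 ord0) | rewrite mxE].
  apply: eq_bigr => j _; congr (g _ _).
  rewrite (_ : lift ord0 j = rshift 1 j); last exact: val_inj.
  exact: (row_mxEr (const_mx t : 'rV[R]_1) u 0 j).
have P0 : (0 <= \prod_(j < m) \int[lebesgue_measure]_t (g (lift ord0 j) t)%:E)%E.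
  by apply: prode_ge0 => j _; apply: integral_ge0 => t _; rewrite lee_fin.
rewrite ge0_integralZr//; last 2 first.
- by apply: measurable_funeM; exact: mE.
- by move=> t _; rewrite -EFinM lee_fin mulr_ge0.
by rewrite ge0_integralZl//; [rewrite muleA | exact: mE | move=> t _; rewrite lee_fin].
Qed.

Lemma ln_sqrt (R : realType) (x : R) : 0 < x -> ln (Num.sqrt x) = ln x / 2.
Proof.
move=> x0; rewrite -[in RHS](sqr_sqrtr (ltW x0)) lnXn ?sqrtr_gt0//.
by rewrite -[ln _ *+ 2]mulr_natr mulfK.
Qed.

Lemma ln_prod (R : realType) (I : finType) (f : I -> R) :
  (forall i, 0 < f i) -> ln (\prod_i f i) = \sum_i ln (f i).
Proof.
move=> f0; suff [] : ln (\prod_i f i) = \sum_i ln (f i) /\ 0 < \prod_i f i by [].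
elim/big_rec2: _ => [|i s P _ [<- P0]]; first by rewrite ln1.
by rewrite lnM ?posrE// mulr_gt0.
Qed.

(** Read off from the total mass of the normal density with standard deviation A^(-1/2). *)
Lemma integral_gaussian (R : realType) (A u0 : R) : 0 < A ->
  exists2 r : R, 0 < r /\ ln r = (ln (pi *+ 2) - ln A) / 2 &
  (\int[lebesgue_measure]_u (expR (- (A * (u - u0) ^+ 2) / 2))%:E = r%:E)%E.
Proof.
move=> A0; pose sd := (Num.sqrt A)^-1.
have sd0 : 0 < sd by rewrite invr_gt0 sqrtr_gt0.
have sd2 : sd ^+ 2 = A^-1 by rewrite exprVn sqr_sqrtr// ltW.
have p0 : 0 < normal_peak sd by rewrite normal_peak_gt0// gt_eqF.
exists (normal_peak sd)^-1.
  split; first by rewrite invr_gt0.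
  rewrite /normal_peak invrK sd2 -mulrnAr ln_sqrt; last first.
    by rewrite mulr_gt0 ?invr_gt0// mulrn_wgt0// pi_gt0.
  have twopi : (0 : R) < pi *+ 2 by rewrite mulrn_wgt0// pi_gt0.
  rewrite lnM ?posrE ?invr_gt0// lnV ?posrE//.
  by rewrite addrC.
have gaussE u : normal_pdf u0 sd u = normal_peak sd * expR (- (A * (u - u0) ^+ 2) / 2).
  rewrite normal_pdfE ?gt_eqF// /normal_fun sd2.
  by congr (_ * expR _); rewrite -mulr_natr invfM invrK; ring.
have := integral_normal_pdf u0 sd.
rewrite (eq_integral (fun u : measurableTypeR R =>
  (normal_peak sd)%:E * (expR (- (A * (u - u0) ^+ 2) / 2))%:E)%E); last first.
  by move=> u _; rewrite gaussE EFinM.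
rewrite ge0_integralZl//; last 2 first.
- apply/measurable_EFinP; apply: measurableT_comp => //.
  apply: measurable_funM => //; apply: measurableT_comp => //.
  apply: measurable_funM => //; apply: measurable_funX.
  exact: measurable_funB.
- by rewrite lee_fin ltW.
set G := integral _ _ _ => e.
by rewrite -[LHS]mul1e -(mulVf (lt0r_neq0 p0)) EFinM -muleA e mule1.
Qed.

Lemma normal_pdf_sqrt (R : realType) (m v x : R) : 0 < v ->
  normal_pdf m (Num.sqrt v) x
  = normal_peak (Num.sqrt v) * expR (- ((x - m) ^+ 2 / v) / 2).
Proof.
move=> v0; rewrite normal_pdfE ?gt_eqF ?sqrtr_gt0// /normal_fun sqr_sqrtr ?ltW//.
congr (_ * expR _); rewrite -mulr_natr; field.
by rewrite gt_eqF.
Qed.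

Section LoglikFormula.
Variables (R : realType) (p m : nat) (n : 'I_p -> nat).
Variables (s2x : 'I_m -> R) (s2 : 'I_p -> 'I_m -> R).
Hypothesis hs2x : forall j, 0 < s2x j.
Hypothesis hs2 : forall i j, 0 < s2 i j.
Variable y : sample R m n.
Arguments y : clear implicits.

Definition weight (i : 'I_p) (j : 'I_m) : R := (n i)%:R / s2 i j.

Definition sample_mean (i : 'I_p) (j : 'I_m) : R := (\sum_k y i j k) / (n i)%:R.

Lemma weight_ge0 i j : 0 <= weight i j.
Proof. by rewrite divr_ge0// ltW. Qed.

Let within j := \sum_i \sum_k (y i j k - sample_mean i j) ^+ 2 / s2 i j.

Let exponent (theta : param R p m) j (u : R) := (u - level_mean theta j) ^+ 2 / s2x j
  + \sum_i \sum_k (y i j k - (alpha theta i + beta theta i * u)) ^+ 2 / s2 i j.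

Let crit (theta : param R p m) j :=
  \sum_i weight i j * misfit s2x weight (beta theta) sample_mean (alpha theta)
     (level_mean theta) i j ^+ 2
  + (latent_mean s2x weight (beta theta) sample_mean (alpha theta) (level_mean theta) j
     - level_mean theta j) ^+ 2 / s2x j.

Let exponentE theta j u : exponent theta j u
  = precision s2x weight (beta theta) j
    * (u - latent_mean s2x weight (beta theta) sample_mean (alpha theta) (level_mean theta) j) ^+ 2
    + crit theta j + within j.
Proof.
set u0 := latent_mean _ _ _ _ _ _ _.
(* Decomposition around the sample mean: the within-group part is free of the parameter and goes
   into the constant of [loglikE]. An empty group gives only empty sums and weight 0. *)
have within_group i : \sum_k (y i j k - (alpha theta i + beta theta i * u)) ^+ 2 / s2 i j
    = weight i j * (sample_mean i j - (alpha theta i + beta theta i * u)) ^+ 2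
      + \sum_k (y i j k - sample_mean i j) ^+ 2 / s2 i j.
  set v := alpha theta i + _.
  have sm : \sum_k (y i j k - sample_mean i j) = 0.
    rewrite sumrB sumr_const card_ord -[sample_mean i j *+ _]mulr_natr /sample_mean.
    have [n0|n0] := eqVneq (n i) 0%N.
      rewrite [X in _ * X](_ : _ = 0) ?n0// mulr0 subr0; apply: big1 => k _.
      by case: k => k hk; exfalso; rewrite n0 in hk.
    by rewrite divfK ?subrr// pnatr_eq0.
  rewrite (eq_bigr (fun k => (sample_mean i j - v) ^+ 2 / s2 i j
      + (2 * (sample_mean i j - v) / s2 i j) * (y i j k - sample_mean i j)
      + (y i j k - sample_mean i j) ^+ 2 / s2 i j)); last first.
    by move=> k _; ring.
  rewrite !big_split/= sumr_const card_ord -mulr_sumr sm mulr0 addr0; congr (_ + _).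
  by rewrite -mulr_natl /weight; ring.
rewrite /exponent (eq_bigr _ (fun i _ => within_group i)) big_split/= addrA -/(within j).
congr (_ + _).
rewrite -[RHS](completed_square sample_mean (level_mean theta) hs2x weight_ge0).
by rewrite addrC; congr (_ + _); apply: eq_bigr => i _; rewrite opprD addrA.
Qed.

(** The joint density factors over the levels, each factor being a Gaussian function of its latent
    level with precision [A j]; its integral contributes - ln (A j) / 2, the log-precision of the
    criterion. *)
Lemma loglikE : exists K : R, forall theta : param R p m,
  loglik s2x s2 y theta = K - profile_criterion s2x weight (beta theta)
    sample_mean (alpha theta) (level_mean theta) / 2.
Proof.
pose c (j : 'I_m) : R := normal_peak (Num.sqrt (s2x j)) * \prod_i \prod_(k < n i) normal_peak (Num.sqrt (s2 i j)).
have peak0 v : 0 < v -> 0 < normal_peak (Num.sqrt v) :> R.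
  by move=> v0; rewrite normal_peak_gt0// gt_eqF// sqrtr_gt0.
have c0 j : 0 < c j.
  by rewrite mulr_gt0 ?peak0// prodr_gt0// => i _; rewrite prodr_gt0// => k _; exact: peak0.
exists (\sum_j (ln (c j) + ln (pi *+ 2) / 2 - within j / 2)) => theta.
pose A j := precision s2x weight (beta theta) j.
pose u0 := latent_mean s2x weight (beta theta) sample_mean (alpha theta) (level_mean theta).
have A0 j : 0 < A j by apply: precision_gt0 => //; exact: weight_ge0.
have densE u : complete_density s2x s2 y theta u
    = 1 * \prod_j (c j * expR (- exponent theta j (u 0 j) / 2)).
  rewrite mul1r /complete_density exchange_big -big_split/=; apply: eq_bigr => j _.
  rewrite normal_pdf_sqrt// /c -[LHS]mulrA -[RHS]mulrA; congr (_ * _).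
  under eq_bigr => i _ do (under eq_bigr => k _ do rewrite normal_pdf_sqrt//).
  under eq_bigr => i _ do rewrite big_split/= -expR_sum.
  rewrite big_split/= -expR_sum mulrCA; congr (_ * _).
  rewrite -expRD; congr expR; rewrite /exponent opprD mulrDl; congr (_ + _).
  rewrite -sumrN mulr_suml; apply: eq_bigr => i _.
  by rewrite -sumrN mulr_suml.
have mexp j : measurable_fun [set: R] (fun t => expR (- exponent theta j t / 2)).
  have -> : (fun t => expR (- exponent theta j t / 2))
    = (fun t => expR (- (A j * (t - u0 j) ^+ 2 + crit theta j + within j) / 2)).
    by apply/funext => t; rewrite exponentE.
  apply: measurableT_comp => //; apply: measurable_funM => //.
  apply: measurableT_comp => //; apply: measurable_funD => //.
  apply: measurable_funD => //; apply: measurable_funM => //.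
  by apply: measurable_funX; exact: measurable_funB.
rewrite /loglik (_ : (fun u => _) = fun u : 'rV[R]_m =>
  (1 * \prod_j (c j * expR (- exponent theta j (u 0 j) / 2)))%:E); last first.
  by apply/funext => u; rewrite densE.
rewrite (iterated_integral_prod (g := fun j t => c j * expR (- exponent theta j t / 2)))//; last 2 first.
- by move=> j t; rewrite mulr_ge0 ?expR_ge0// ltW.
- by move=> j; exact: measurable_funM.
have factor j : exists r : R, [/\ 0 < r,
    ln r = ln (c j) + ln (pi *+ 2) / 2 - within j / 2
         - (ln (A j) + crit theta j) / 2 &
    (\int[lebesgue_measure]_t (c j * expR (- exponent theta j t / 2))%:E = r%:E)%E].
  have [r [r0 lnr] rE] := integral_gaussian (u0 j) (A0 j).
  pose w : R := expR (- (crit theta j + within j) / 2).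
  have w0 : 0 < w by exact: expR_gt0.
  exists (c j * w * r); split.
  - by apply: mulr_gt0 => //; exact: mulr_gt0.
  - have -> : ln (c j * w * r) = ln (c j) + ln w + ln r.
      by rewrite lnM ?posrE//; [rewrite lnM ?posrE|exact: mulr_gt0].
    rewrite expRK lnr.
    by field.
  - transitivity (\int[lebesgue_measure]_t ((c j * w)%:E
       * (expR (- (A j * (t - u0 j) ^+ 2) / 2))%:E))%E.
      apply: eq_integral => t _; rewrite -EFinM exponentE -[in RHS]mulrA /w -expRD.
      by congr (_ * expR _)%:E; rewrite -/(A j) -/(u0 j); field.
    rewrite ge0_integralZl//; last 2 first.
    + apply/measurable_EFinP; apply: measurableT_comp => //.
      apply: measurable_funM => //; apply: measurableT_comp => //.
      apply: measurable_funM => //; apply: measurable_funX.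
      exact: measurable_funB.
    + by rewrite lee_fin ltW// mulr_gt0.
    by rewrite rE EFinM.
have /choice [r rP] := factor.
rewrite mul1e (eq_bigr (fun j => (r j)%:E)); last by move=> j _; have [] := rP j.
rewrite prodEFin /= ln_prod; last by move=> j; have [] := rP j.
rewrite /profile_criterion mulr_suml -sumrB; apply: eq_bigr => j _.
by have [_ -> _] := rP j.
Qed.
End LoglikFormula.

(** * Bias coordinates as intercept and slope directions *)

Section BiasDirections.
Variables (R : realType) (p m : nat).
Implicit Types (v : 'rV[R]_p.-1) (th : param R p m) (i : 'I_p).

(** The map is affine in [v]: its linear part is the one with reference constant 0, so only one
    summand keeps [c]. *)
Lemma with_referenceD c v v' i :
  with_reference c (v + v') i = with_reference c v i + with_reference 0 v' i.
Proof.
rewrite /with_reference; case: (nat_of_ord i) => [|l]; first by rewrite addr0.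
by case: insub => [l'|]; rewrite ?mxE ?addr0.
Qed.

Lemma with_referenceZ t v i :
  with_reference 0 (t *: v) i = t * with_reference 0 v i.
Proof.
rewrite /with_reference; case: (nat_of_ord i) => [|l]; first by rewrite mulr0.
by case: insub => [l'|]; rewrite ?mxE ?mulr0.
Qed.

Lemma with_reference_sum (K : finType) (F : K -> 'rV[R]_p.-1) i :
  with_reference 0 (\sum_c F c) i = \sum_c with_reference 0 (F c) i.
Proof.
apply: (big_morph (fun v => with_reference 0 v i)) => [v v'|].
  exact: with_referenceD.
rewrite /with_reference; case: (nat_of_ord i) => [//|l].
by case: insub => [l'|]; rewrite ?mxE.
Qed.

Definition alpha_dir (c : 'I_(p.-1 + p.-1)) i : R :=
  with_reference 0 (lsubmx (delta_mx 0 c : 'rV[R]_(p.-1 + p.-1))) i.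

Definition beta_dir (c : 'I_(p.-1 + p.-1)) i : R :=
  with_reference 0 (rsubmx (delta_mx 0 c : 'rV[R]_(p.-1 + p.-1))) i.

Lemma alpha_dir_sum (v : 'rV[R]_(p.-1 + p.-1)) i :
  with_reference 0 (lsubmx v) i = \sum_c v 0 c * alpha_dir c i.
Proof.
rewrite [in LHS](row_sum_delta v) linear_sum with_reference_sum.
by apply: eq_bigr => c _; rewrite linearZ with_referenceZ.
Qed.

Lemma beta_dir_sum (v : 'rV[R]_(p.-1 + p.-1)) i :
  with_reference 0 (rsubmx v) i = \sum_c v 0 c * beta_dir c i.
Proof.
rewrite [in LHS](row_sum_delta v) linear_sum with_reference_sum.
by apply: eq_bigr => c _; rewrite linearZ with_referenceZ.
Qed.

Lemma alpha_shift th th' i :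
  alpha th' i = alpha th i + \sum_c (bias th' - bias th) 0 c * alpha_dir c i.
Proof.
by rewrite -alpha_dir_sum /alpha -with_referenceD -linearD addrC subrK.
Qed.

Lemma beta_shift th th' i :
  beta th' i = beta th i + \sum_c (bias th' - bias th) 0 c * beta_dir c i.
Proof.
by rewrite -beta_dir_sum /beta -with_referenceD -linearD addrC subrK.
Qed.

Lemma bias_ray th (t : R) c :
  bias (th + t *: delta_mx 0 (rshift m c)) = bias th + t *: delta_mx 0 c.
Proof.
apply/rowP => e; rewrite /bias !mxE; congr (_ + _ * _%:R).
by rewrite (inj_eq (@rshift_inj _ _)).
Qed.

Lemma alpha_ray th (t : R) c i :
  alpha (th + t *: delta_mx 0 (rshift m c)) i = alpha th i + t * alpha_dir c i.
Proof.
by rewrite /alpha bias_ray linearD with_referenceD linearZ with_referenceZ.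
Qed.

Lemma beta_ray th (t : R) c i :
  beta (th + t *: delta_mx 0 (rshift m c)) i = beta th i + t * beta_dir c i.
Proof.
by rewrite /beta bias_ray linearD with_referenceD linearZ with_referenceZ.
Qed.

Lemma level_mean_ray th (t : R) c :
  level_mean (th + t *: delta_mx 0 (rshift m c)) = level_mean th.
Proof.
apply/funext => j; rewrite /level_mean !mxE.
by rewrite eq_lrshift andbF mulr0 addr0.
Qed.

Lemma dir_reference i0 c : i0 = 0%N :> nat ->
  alpha_dir c i0 = 0 /\ beta_dir c i0 = 0.
Proof. by move=> i00; rewrite /alpha_dir /beta_dir /with_reference i00. Qed.

(** Each bias coordinate is the intercept or the slope of one non-reference laboratory, where it can
    be read. *)
Lemma dir_identifiable c :
  (exists i, forall h : 'I_(p.-1 + p.-1) -> R, \sum_e h e * alpha_dir e i = h c) \/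
  (exists i, forall h : 'I_(p.-1 + p.-1) -> R, \sum_e h e * beta_dir e i = h c).
Proof.
have lt l : (l < p.-1)%N -> (l.+1 < p)%N by case: p.
have sel (l : 'I_p.-1) v : with_reference 0 v (Ordinal (lt _ (ltn_ord l))) = v 0 l.
  rewrite /with_reference /=; case: insubP => [l' _ e|]; last by rewrite ltn_ord.
  by congr (v 0 _); exact: val_inj.
have [l cl|l cl] := split_ordP c; [left|right]; exists (Ordinal (lt _ (ltn_ord l))) => h.
- rewrite (bigD1 c)//= big1 => [|e ec]; rewrite /alpha_dir sel !mxE.
    by rewrite eqxx -cl eqxx mulr1 addr0.
  by rewrite -cl eq_sym (negbTE ec) andbF mulr0.
- rewrite (bigD1 c)//= big1 => [|e ec]; rewrite /beta_dir sel !mxE.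
    by rewrite eqxx -cl eqxx mulr1 addr0.
  by rewrite -cl eq_sym (negbTE ec) andbF mulr0.
Qed.
End BiasDirections.

(** * Score, information and maximizers of the log-likelihood *)

Lemma derive_ray (R : realType) (V : normedModType R) (f : V -> R) (a v : V) :
  'D_v f a = 'D_1 (fun h : R => f (a + h *: v)) 0.
Proof.
rewrite /derive; set F := (X in X @ _); set G := (X in _ = lim (X @ _)).
suff -> : F = G by [].
apply/funext => h; rewrite /F /G /=.
by rewrite [h%:A]mulr1 addr0 scale0r addr0 [h *: v + a]addrC.
Qed.

Section Likelihood.
Variables (R : realType) (p m : nat) (n : 'I_p -> nat).
Variables (s2x : 'I_m -> R) (s2 : 'I_p -> 'I_m -> R).
Hypothesis hs2x : forall j, 0 < s2x j.
Hypothesis hs2 : forall i j, 0 < s2 i j.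
Variable y : sample R m n.
Arguments y : clear implicits.

Let a := @weight R p m n s2.
Let ybar := sample_mean y.
Let da := @alpha_dir R p.
Let db := @beta_dir R p.
Let a0 i j : 0 <= a i j. Proof. exact: weight_ge0. Qed.

Let crit th := profile_criterion s2x a (beta th) ybar (alpha th) (level_mean th).
Let ray (th : param R p m) c (t : R) := th + t *: delta_mx 0 (rshift m c).

Let rayE th c t :
  [/\ alpha (ray th c t) = (fun i => alpha th i + t * da c i),
      beta (ray th c t) = (fun i => beta th i + t * db c i) &
      level_mean (ray th c t) = level_mean th].
Proof.
split; last exact: level_mean_ray.
  by apply/funext => i; exact: alpha_ray.
by apply/funext => i; exact: beta_ray.
Qed.

Let loglik_score (th : param R p m) c :=
  bias_score da db s2x a (beta th) ybar (alpha th) (level_mean th) c.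

Let slope_loglik th c h :
  slope (fun t => loglik s2x s2 y (ray th c t)) h (loglik_score (ray th c h) c).
Proof.
have [K LE] := loglikE hs2x hs2 y.
apply: (@slope_eq _ (fun t => K - crit (ray th c t) / 2) _ _ (0 - (- 2 * loglik_score (ray th c h) c) / 2)).
- by move=> t; rewrite LE.
- by field.
have sc : slope (fun t => crit (ray th c t)) h (- 2 * loglik_score (ray th c h) c).
  rewrite /loglik_score; have [-> -> ->] := rayE th c h.
  have := slope_profile_criterion da db ybar (level_mean th) hs2x a0 (alpha th) (beta th) c h.
  apply: slope_eq => // t; rewrite /crit.
  by have [-> -> ->] := rayE th c t.
apply: slope_to; first by slp.
by field.
Qed.

Let ray0 th c : ray th c 0 = th.
Proof. by rewrite /ray scale0r addr0. Qed.

Lemma loglik_deriveE th c :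
  'D_(delta_mx 0 (rshift m c)) (loglik s2x s2 y) th
  = bias_score da db s2x a (beta th) ybar (alpha th) (level_mean th) c.
Proof.
rewrite derive_ray.
by have := slope_loglik th c 0; rewrite ray0 => /@derive_val.
Qed.

Lemma bias_informationE th : bias_information s2x s2 y th
  = bias_obs_info da db s2x a (beta th) ybar (alpha th) (level_mean th).
Proof.
apply/matrixP => c e; rewrite /bias_information /obs_information 3!mxE [hessian _ _ _ _]mxE.
rewrite (_ : (fun t => 'D_(delta_mx 0 (rshift m e)) (loglik s2x s2 y) t) = loglik_score^~ e); last first.
  by apply/funext => t; exact: loglik_deriveE.
rewrite derive_ray.
have := slope_bias_score da db ybar (level_mean th) hs2x a0 (alpha th) (beta th) c 0 e.
rewrite (_ : (fun t => _) = (fun t => loglik_score (ray th c t) e)); last first.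
  by apply/funext => t; rewrite /loglik_score; have [-> -> ->] := rayE th c t.
move=> /@derive_val ->; rewrite opprK.
have [h1 h2 h3] := rayE th c 0; rewrite ray0 in h1 h2 h3.
by rewrite -h1 -h2.
Qed.

Lemma mle_score th c : maximizes_loglik s2x s2 y th ->
  bias_score da db s2x a (beta th) ybar (alpha th) (level_mean th) c = 0.
Proof.
move=> mle; rewrite -/(loglik_score th c) -[th in loglik_score th](ray0 th c).
apply: (@slope_max _ (fun t => loglik s2x s2 y (ray th c t)) 0).
- by move=> t; exists (loglik_score (ray th c t) c); exact: slope_loglik.
- exact: slope_loglik.
- by move=> t; rewrite ray0; exact: mle.
Qed.

(** The competitor has the bias of [th'] and level means equal to the levels [x]. Its profile is at
    most its criterion at v = x, where the penalty (v - mu)^2 vanishes. *)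
Lemma mle_profile_le (th th' : param R p m) (x : 'I_m -> R) : maximizes_loglik s2x s2 y th ->
  profile_criterion s2x a (beta th) ybar (alpha th) (level_mean th)
  <= \sum_j (ln (precision s2x a (beta th') j)
     + \sum_i a i j * (ybar i j - alpha th' i - beta th' i * x j) ^+ 2).
Proof.
move=> mle; pose th1 : param R p m := row_mx (\row_j x j) (bias th').
have [K LE] := loglikE hs2x hs2 y.
have le1 : crit th <= crit th1.
  by have := mle th1; rewrite !LE -/(crit th) -/(crit th1); lra.
apply: le_trans le1 _.
have b1 : bias th1 = bias th' by rewrite /bias row_mxKr.
have l1 j : level_mean th1 j = x j by rewrite /level_mean row_mxKl mxE.
rewrite /crit /alpha /beta b1.
apply: le_trans (profile_criterion_le _ _ hs2x a0 _ _ x) _.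
apply: ler_sum => j _; rewrite l1 subrr expr0n/= mul0r addr0.
exact: lexx.
Qed.
End Likelihood.

Lemma quadratic_formE (R : realType) (q : nat) (A : 'M[R]_q) (v : 'rV[R]_q) :
  quadratic_form A v = \sum_c \sum_e v 0 c * A c e * v 0 e.
Proof.
rewrite /quadratic_form mxE exchange_big; apply: eq_bigr => e _.
by rewrite !mxE mulr_suml.
Qed.

(** * The sources of the model *)

Lemma indep_normal_trivial (R : realType) d (T : measurableType d)
    (P : probability T R) (I : finType) (X : I -> T -> R) :
  (forall i, measurable_fun [set: T] (X i)) ->
  (forall A : I -> set R, (forall i, measurable (A i)) ->
    P [set t | forall i, A i (X i t)] = (\prod_i normal_prob 0 1 (A i))%E) ->
  indep_normal P (fun=> tt) X.
Proof.
move=> mX iX; split => // B A mB mA; have [Bt|Bt] := pselect (B tt).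
  rewrite (_ : _ @^-1` _ = setT); last by apply/seteqP; split.
  by rewrite setTI probability_setT mul1e iX.
rewrite (_ : _ @^-1` _ = set0); last by apply/seteqP; split.
by rewrite set0I measure0 mul0e.
Qed.

(** The case q = 1 of [chi2_representation]: it gives the normal law of a combination without
    convolutions, at the price of relating [Z] to it only through squares. *)
Lemma linear_combination_law (R : realType) d (T : measurableType d)
    (P : probability T R) d0 (T0 : measurableType d0) (W : T -> T0)
    (I : finType) (X : I -> T -> R) (a : I -> R) :
  indep_normal P W X -> 0 < \sum_i a i ^+ 2 ->
  exists Z : T -> R, [/\ measurable_fun [set: T] Z,
    forall A, measurable A -> P (Z @^-1` A) = normal_prob 0 1 A &
    forall t, (\sum_i a i * X i t) ^+ 2 = (\sum_i a i ^+ 2) * Z t ^+ 2].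
Proof.
move=> iX J0; have I0 : (1 <= #|I|)%N.
  rewrite lt0n; apply/eqP => /card0_eq I0; move: J0.
  by rewrite big1 ?ltxx// => i; have := I0 i; rewrite !inE.
have [|Z iZ ZE] := @chi2_representation _ _ _ _ _ _ _ _ 1 X (fun _ _ i => a i) I0 _ iX.
  by move=> *; exact: measurable_cst.
have [_ mZ _] := iZ.
exists (Z ord0); split => //.
  by move=> A mA; exact: indep_normal_marginal mA iZ.
move=> t; set U := \sum_i a i * _; set J := \sum_i _.
have := ZE t J%:M U%:M; rewrite big_ord1 => -> //; last 3 first.
- by move=> b b'; rewrite !ord1 mxE eqxx mulr1n.
- by move=> b; rewrite !ord1 mxE eqxx mulr1n.
- by rewrite unitmxE det_scalar expr1 unitfE gt_eqF.
rewrite invmx_scalar tr_scalar_mx -!scalar_mxM mxE eqxx mulr1n.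
by field; rewrite gt_eqF.
Qed.

Definition error_index (p m : nat) (n : 'I_p -> nat) : finType :=
  {i : 'I_p & ('I_m * 'I_(n i))%type}.

Section Sources.
Variables (R : realType) (p m : nat) (n : 'I_p -> nat).
Variables (s2x : 'I_m -> R) (s2 : 'I_p -> 'I_m -> R) (theta : param R p m).
Hypothesis hs2x : forall j, 0 < s2x j.
Hypothesis hs2 : forall i j, 0 < s2 i j.
Variables (d : measure_display) (T : measurableType d) (P : probability T R).
Variables (x : 'I_m -> {RV P >-> R}).
Variables (e : forall i : 'I_p, 'I_m -> 'I_(n i) -> {RV P >-> R}).
Arguments e : clear implicits.
Hypothesis hmodel : model_sources s2x s2 theta x e.

Definition std_error (s : error_index m n) (t : T) : R :=
  e (tag s) (tagged s).1 (tagged s).2 t / Num.sqrt (s2 (tag s) (tagged s).1).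

Definition std_level (j : 'I_m) (t : T) : R :=
  (x j t - level_mean theta j) / Num.sqrt (s2x j).

Let measurable_std (c s : R) (A : set R) :
  measurable A -> measurable [set u | A ((u - c) / s)].
Proof.
move=> mA; rewrite -[mkset _]setTI.
have : measurable_fun [set: R] (fun u : R => (u - c) / s).
  by apply: measurable_funM => //; exact: measurable_funB.
exact.
Qed.

Let sources_box (A : 'I_m -> set R) (B : error_index m n -> set R) :
  (forall j, measurable (A j)) -> (forall s, measurable (B s)) ->
  P [set t | (forall j, A j (x j t)) /\ (forall s, B s (std_error s t))]
  = ((\prod_j P (x j @^-1` A j)) * \prod_s normal_prob 0 1 (B s))%E.
Proof.
move=> mA mB; have [_ he indep] := hmodel.
pose C (s : source m n) : set R := match s with
  | inl j => A j
  | inr s => [set u | B s ((u - 0) / Num.sqrt (s2 (tag s) (tagged s).1))]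
  end.
have mC s : measurable (C s) by case: s => [j|s] //=; exact: measurable_std.
have := indep [set: source m n]%SET C mC.
rewrite (_ : mkset _ = [set t | (forall j, A j (x j t)) /\
    (forall s, B s (std_error s t))]); last first.
  apply/seteqP; split => t /= H.
    split=> [j|[i [j k]]]; first by have := H (inl j); apply; rewrite inE.
    by have := H (inr (existT _ i (j, k))); rewrite /= subr0; apply; rewrite inE.
  by case=> [j|[i [j k]]] _ /=; [exact: H.1|rewrite subr0; exact: (H.2 (existT _ i (j, k)))].
move=> ->; rewrite (eq_bigl xpredT); last by move=> s; rewrite inE.
rewrite big_sumType/=; congr (_ * _)%E; apply: eq_bigr => -[i [j k]] _ /=.
transitivity (distribution P (e i j k) (C (inr (existT _ i (j, k))))); first by [].
rewrite he; last exact: mC.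
rewrite /= normal_prob_standardize// sqrtr_gt0.
exact: hs2.
Qed.

(** For fixed error sets, the trace of the law of the levels is a multiple of that law, by
    comparison on boxes. *)
Lemma std_errors_indep : indep_normal P (fun t => [tuple x j t | j < m]) std_error.
Proof.
have mW : measurable_fun [set: T] (fun t => [tuple x j t | j < m]).
  apply/measurable_fun_tnthP => j.
  by rewrite (_ : _ \o _ = x j)//; apply/funext => t; rewrite /= tnth_mktuple.
have mE s : measurable_fun [set: T] (std_error s).
  by apply: measurable_funM.
split => // B A mB mA.
set D := [set t | _].
have mD : measurable D.
  rewrite (_ : D = \big[setI/setT]_s (std_error s @^-1` A s)).
    apply: bigsetI_measurable => s _; rewrite -[X in measurable X]setTI.
    exact: mE.
  rewrite -bigcap_seq; apply/seteqP; split => t /=.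
    by move=> Dt s _; exact: Dt.
  by move=> Dt s; apply: (Dt s); rewrite /= mem_index_enum.
set K := (\prod_s _)%E.
have K0 : 0 <= fine K.
  by apply: fine_ge0; apply: prode_ge0 => s _; exact: measure_ge0.
have Kfin : K \is a fin_num.
  by apply: prode_fin_num => s _; apply: fin_num_measure; exact: mA.
have [Q1 Q1E] := exists_trace_law P mD mW.
have [Q2 Q2E] := exists_scaled_law P K0 mW.
have : Q1 B = Q2 B; last by rewrite Q1E Q2E fineK// muleC.
apply: measure_eq_boxes mB.
  rewrite Q1E; apply: le_lt_trans (ltry 1); apply: probability_le1.
  by rewrite preimage_setT setTI.
move=> C mC; rewrite Q1E Q2E fineK//.
have lev : P ((fun t => [tuple x j t | j < m]) @^-1` [set u | forall j, C j (tnth u j)])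
    = (\prod_j P (x j @^-1` C j))%E.
  have := sources_box mC (fun=> measurableT).
  rewrite [X in (_ * X)%E]big1 ?mule1; last by move=> s _; exact: probability_setT.
  move=> <-; congr (P _); apply/seteqP; split => t /=.
    by move=> Ct; split => // j; have := Ct j; rewrite tnth_mktuple.
  by move=> [Ct _] j; rewrite tnth_mktuple.
rewrite lev muleC -sources_box//; congr (P _); apply/seteqP; split => t /=.
  by move=> [Ct Dt]; split => // j; have := Ct j; rewrite tnth_mktuple.
by move=> [Ct Dt]; split => // j; rewrite tnth_mktuple.
Qed.

Lemma std_levels_indep : indep_normal P (fun=> tt) std_level.
Proof.
have [hx _ _] := hmodel.
apply: indep_normal_trivial => [j|A mA].
  by apply: measurable_funM => //; exact: measurable_funB.
pose C j := [set u | A j ((u - level_mean theta j) / Num.sqrt (s2x j))].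
have mC j : measurable (C j) by exact: measurable_std.
have := sources_box mC (fun=> measurableT).
rewrite [X in (_ * X)%E]big1 ?mule1; last by move=> s _; exact: probability_setT.
rewrite (_ : mkset _ = [set t | forall j, A j (std_level j t)]); last first.
  by apply/seteqP; split => t /=; [case|].
move=> ->; apply: eq_bigr => j _.
transitivity (distribution P (x j) (C j)); first by [].
by rewrite hx; [apply: normal_prob_standardize; [rewrite sqrtr_gt0; exact: hs2x|exact: mA]|exact: mC].
Qed.
End Sources.

(** The integer tails decrease to the empty set, so continuity from above applies. *)
Lemma probability_tail (R : realType) (Q : probability (measurableTypeR R) R) (eps : R) :
  0 < eps -> exists2 M : R, 0 < M & (Q [set u | (M < `|u|)%R] <= eps%:E)%E.
Proof.
move=> eps0; pose F (k : nat) := [set u : R | (k.+1%:R < `|u|)%R].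
have mF k : measurable (F k).
  have mn : measurable_fun [set: R] (fun u : R => `|u|) by exact: measurableT_comp.
  have := mn measurableT _ (measurable_itv `]k.+1%:R, +oo[).
  by congr measurable; apply/seteqP; split => u; rewrite /F /= in_itv/= andbT; [case|].
have capF : \bigcap_k F k = set0.
  apply/seteqP; split => u //= Fu.
  have := Fu (Num.truncn `|u|) I; rewrite /F /= ltNge => /negP; apply.
  by rewrite ltW// truncnS_gt.
have := @nonincreasing_cvg_mu _ _ _ Q F.
rewrite capF measure0 => /(_ _ mF measurable0).
have noninc : nonincreasing_seq F.
  move=> k l kl; apply/subsetPset => u /=; apply: le_lt_trans.
  by rewrite ler_nat.
have F0fin : (Q (F 0%N) < +oo)%E.
  by apply: le_lt_trans (ltry 1); apply: probability_le1; exact: mF.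
move=> /(_ F0fin noninc) /fine_cvgP[_ /cvgr0_norm_le /(_ _ eps0)[k _ /(_ k (leqnn k))]] /= Fk.
exists k.+1%:R => //.
rewrite -[leLHS]fineK ?fin_num_measure//; last exact: mF.
by rewrite lee_fin; apply: le_trans Fk; exact: ler_norm.
Qed.

(** The density is at most (2 pi)^(-1/2) <= 1, so the mass is at most the length of the interval.
    The bound does not depend on [c], hence is uniform in the level means. *)
Lemma normal_prob_window (R : realType) (c k dt : R) : 0 < k -> 0 < dt ->
  (normal_prob 0 1 [set u : R | (`|c + k * u| < dt)%R] <= (2 * dt / k)%:E)%E.
Proof.
move=> k0 dt0.
have distE u : `|- c / k - u| * k = `|c + k * u|.
  rewrite -[X in _ * X](gtr0_norm k0) -normrM -normrN; congr `|_|.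
  by field; rewrite gt_eqF.
rewrite (_ : mkset _ = ball (- c / k) (dt / k)); last first.
  by apply/seteqP; split => u; rewrite /ball /= ltr_pdivlMr// distE.
have -> : (2 * dt / k)%:E = lebesgue_measure (ball (- c / k) (dt / k) : set R).
  rewrite lebesgue_measure_ball ?divr_ge0 ?ltW//; congr EFin.
  by ring.
rewrite -[leRHS]mul1e -integral_cst; last exact: measurable_ball.
rewrite /normal_prob; apply: ge0_le_integral => //.
- exact: measurable_ball.
- by move=> u _; rewrite lee_fin normal_pdf_ge0.
- apply/measurable_EFinP; apply: measurable_funTS; exact: measurable_normal_pdf.
- move=> u _; rewrite lee_fin; apply: le_trans (normal_pdf_ub _ _ _) _; first exact: oner_neq0.
  rewrite /normal_peak invf_le1; last by rewrite sqrtr_gt0 expr1n mul1r mulrn_wgt0 ?pi_gt0.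
  rewrite -[leLHS]sqrtr1 ler_wsqrtr// expr1n mul1r.
  by have := pi_ge2 R; rewrite -mulr_natl; lra.
Qed.

Lemma tends_ge (R : realType) (O : Type) (F : set_system O) (PF : ProperFilter F)
    (f : O -> R) (a b : R) : (forall o, b <= f o) -> tends F f a -> b <= a.
Proof.
move=> bf fa; rewrite -(cvg_lim _ fa)//; apply: limr_ge; first exact: cvgP fa.
exact: nearW.
Qed.

Definition score_form (R : realType) (I J : finType) (q : nat)
    (da db : 'I_q -> I -> R) (k : I -> J -> R) (b : I -> R) (x : J -> R)
    (z : I -> J -> R) : R :=
  ((score da db k b x z)^T *m invmx (info da db k b x)
     *m score da db k b x z) 0 0.

Lemma sample_mean_observations (R : realType) (p m : nat) (n : 'I_p -> nat)
    (theta : param R p m) (x : 'I_m -> R) (e : sample R m n) i j :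
  (0 < n i)%N ->
  sample_mean (observations theta x e) i j
  = alpha theta i + beta theta i * x j + sample_mean e i j.
Proof.
move=> n0; rewrite /sample_mean /observations big_split/= sumr_const card_ord.
by rewrite mulrDl -[_ *+ _]mulr_natr mulfK// pnatr_eq0 -lt0n.
Qed.

(** * Uniform comparison of the two forms on the good event *)

Section Sequence.
Variables (R : realType) (p m : nat).
Hypotheses (hp : (2 <= p)%N) (hm : (2 <= m)%N).
Variables (s2x : 'I_m -> R) (s2 : 'I_p -> 'I_m -> R).
Hypothesis hs2x : forall j, 0 < s2x j.
Hypothesis hs2 : forall i j, 0 < s2 i j.
Variables (w : 'I_p -> R) (n : nat -> 'I_p -> nat).
Hypothesis hw : forall i, 0 < w i.
Hypothesis hn : forall i, n v i @[v --> \oo] --> \oo.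
Hypothesis hnw : forall i,
  (n v i)%:R / (\sum_(i' < p) n v i')%N%:R @[v --> \oo] --> w i.
Variables (theta : param R p m) (theta_ : nat -> param R p m).
Hypothesis htheta : theta_ v @[v --> \oo] --> theta.

Definition sample_size v : R := (\sum_(i' < p) n v i')%N%:R.
(** Precision of a sample mean per unit of total sample size: [weight] is [sample_size] times
    [kappa], and [kappa] has a finite positive limit. *)
Definition kappa v (i : 'I_p) (j : 'I_m) : R :=
  (n v i)%:R / sample_size v / s2 i j.
Definition scaled_mean v (e : sample R m (n v)) i j : R :=
  Num.sqrt (sample_size v) * sample_mean e i j.

Let i0 : 'I_p := Ordinal (ltnW hp).
Let j0 : 'I_m := Ordinal (ltnW hm).
Let j1 : 'I_m := Ordinal hm.
Let q := (p.-1 + p.-1)%N.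
Let da := @alpha_dir R p.
Let db := @beta_dir R p.

Lemma near_sizes_gt0 : \forall v \near \oo, forall i, (0 < n v i)%N.
Proof.
apply: filter_forall => i.
by have /cvgnyPgt/(_ 0%N) := hn i.
Qed.

Lemma sample_size_gt0 v : (forall i, (0 < n v i)%N) -> 0 < sample_size v.
Proof.
move=> n0; rewrite ltr0n (bigD1 i0)//=.
by rewrite addn_gt0 n0.
Qed.

Lemma kappa_cvg i j : kappa v i j @[v --> \oo] --> w i / s2 i j.
Proof. by apply: cvgM; [exact: hnw|exact: cvg_cst]. Qed.

Lemma sqrt_sample_size_cvg : (Num.sqrt (sample_size v))^-1 @[v --> \oo] --> (0 : R).
Proof.
apply/cvgr0Pnorm_lt => eps eps0; near=> v.
have n0 : forall i, (0 < n v i)%N by near: v; exact: near_sizes_gt0.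
have N0 := sample_size_gt0 n0.
rewrite ger0_norm ?invr_ge0 ?sqrtr_ge0// invf_plt ?posrE ?sqrtr_gt0//.
rewrite -[ltLHS]ger0_norm ?invr_ge0 ?ltW// -sqrtr_sqr ltr_sqrt//.
apply: (@lt_le_trans _ _ (Num.truncn (eps^-1 ^+ 2)).+1%:R).
  by apply: truncnS_gt.
apply: (@le_trans _ _ (n v i0)%:R); last first.
  by rewrite ler_nat (bigD1 i0)//= leq_addr.
rewrite ler_nat; near: v.
by have /cvgnyPge := hn i0; apply.
Unshelve. all: by end_near. Qed.

Lemma coord_cvg (c : 'I_(m + (p.-1 + p.-1))) :
  theta_ v 0 c @[v --> \oo] --> theta 0 c.
Proof.
exact: (@cvg_comp _ _ _ theta_ (fun A : param R p m => A 0 c) _ _ _ htheta (@coord_continuous R 1 _ 0 c theta)).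
Qed.

Lemma beta_cvg i : beta (theta_ v) i @[v --> \oo] --> beta theta i.
Proof.
rewrite (_ : (fun v => _) = (fun v => beta theta i
  + \sum_c (theta_ v 0 (rshift m c) - theta 0 (rshift m c)) * db c i)); last first.
  apply/funext => v; rewrite (beta_shift theta); congr (_ + _).
  by apply: eq_bigr => c _; rewrite /bias !mxE.
have bE : beta theta i = beta theta i
    + \sum_c (theta 0 (rshift m c) - theta 0 (rshift m c)) * db c i.
  by rewrite big1 ?addr0// => c _; rewrite subrr mul0r.
rewrite [X in _ --> X]bE; apply: cvgD; first exact: cvg_cst.
apply: (tends_sum (f := fun v c => (theta_ v 0 (rshift m c) - theta 0 (rshift m c)) * db c i)).
move=> c _; apply: cvgM; last exact: cvg_cst.
by apply: cvgB; [exact: coord_cvg|exact: cvg_cst].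
Qed.

Definition good_event (v : nat) (M dt : R) (x : 'I_m -> R) (e : sample R m (n v)) : Prop :=
  [/\ forall j, `|x j| <= M, dt <= `|x j0 - x j1| &
      forall i j, `|scaled_mean e i j| <= M].

(* Otherwise violations occur at arbitrarily large ranks; along an ultrafilter on
   them both forms have the same limit. *)
Lemma quadratic_forms_close (f : R -> R) (M dt eps : R) :
  continuous f -> 0 < dt -> 0 < eps ->
  \forall v \near \oo, forall (x : 'I_m -> R) (e : sample R m (n v)) th,
    good_event M dt x e ->
    maximizes_loglik s2x s2 (observations (theta_ v) x e) th ->
    `|f (quadratic_form (bias_information s2x s2 (observations (theta_ v) x e) th)
           (bias th - bias (theta_ v)))
      - f (score_form da db (kappa v) (beta (theta_ v)) x (scaled_mean e))| <= eps.
Proof.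
move=> fc dt0 eps0; apply: contrapT => nQ.
set Q := (X in ~ (\forall v \near _, X v)) in nQ.
(* A violation is chosen together with its rank, because the type of the errors depends on the
   rank. *)
have bad k : exists b : {v : nat & (('I_m -> R) * sample R m (n v) * param R p m)%type},
    [/\ (k <= tag b)%N, forall i, (0 < n (tag b) i)%N,
     good_event M dt (tagged b).1.1 (tagged b).1.2,
     maximizes_loglik s2x s2 (observations (theta_ (tag b)) (tagged b).1.1 (tagged b).1.2) (tagged b).2 &
     eps < `|f (quadratic_form (bias_information s2x s2
             (observations (theta_ (tag b)) (tagged b).1.1 (tagged b).1.2) (tagged b).2)
           (bias (tagged b).2 - bias (theta_ (tag b))))
      - f (score_form da db (kappa (tag b)) (beta (theta_ (tag b))) (tagged b).1.1
             (scaled_mean (tagged b).1.2))|].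
  apply: contrapT => /forallNP nb; apply: nQ.
  near=> v => x e th good mle; rewrite leNgt; apply/negP => lt.
  apply: (nb (existT _ v (x, e, th))); split => //=.
    by near: v; exact: nbhs_infty_ge.
  by near: v; exact: near_sizes_gt0.
have {bad nQ Q} /choice[b /all_and5[bk bn bgood bmle bfar]] := bad.
have [U [UU subU]] := ultraFilterLemma eventually_filter.
have FU : Filter U by exact: ultra_proper.
(* The ranks of the violations tend to infinity, so limits in [v] are inherited along the
   ultrafilter. *)
have along (g : nat -> R) l : g v @[v --> \oo] --> l -> tends U (fun k => g (tag (b k))) l.
  move=> gl; apply: (@cvg_comp _ _ _ (fun k => tag (b k)) g U \oo) => //.
  apply: (@cvg_trans _ (tag (b k) @[k --> \oo])).
    by move=> A; exact: subU.
  apply/cvgnyPge => K; near=> k.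
  by apply: leq_trans (bk k); near: k; exact: nbhs_infty_ge.
pose x k := (tagged (b k)).1.1.
pose e k := (tagged (b k)).1.2.
pose th k := (tagged (b k)).2.
pose N k := sample_size (tag (b k)).
have N0 k : 0 < N k by exact: sample_size_gt0.
have xl j : exists l, tends U (fun k => x k j) l.
  by apply: (@ultra_bounded_tends _ _ U UU _ M) => k; have [/(_ j)] := bgood k.
have zl i j : exists l, tends U (fun k => scaled_mean (e k) i j) l.
  by apply: (@ultra_bounded_tends _ _ U UU _ M) => k; have [_ _ /(_ i j)] := bgood k.
have /choice[x' x'P] := xl.
have /choice[z' z'P] := fun ij : 'I_p * 'I_m => zl ij.1 ij.2.
have x01 k : x k j0 != x k j1.
  have [_ + _] := bgood k; rewrite -/(x k) => /(lt_le_trans dt0).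
  by rewrite normr_gt0 subr_eq0.
have x'01 : x' j0 != x' j1.
  rewrite -subr_eq0 -normr_gt0; apply: (lt_le_trans dt0).
  have ll : tends U (fun k => `|x k j0 - x k j1|) `|x' j0 - x' j1|.
    by apply: cvg_norm; apply: cvgB; exact: x'P.
  by refine (tends_ge ultra_proper _ ll) => k; have [] := bgood k.
pose dl k c := (bias (th k) - bias (theta_ (tag (b k)))) 0 c.
have alE k : (fun i => alpha (theta_ (tag (b k))) i + \sum_c dl k c * da c i) = alpha (th k).
  by apply/funext => i; apply/esym; exact: alpha_shift.
have beE k : (fun i => beta (theta_ (tag (b k))) i + \sum_c dl k c * db c i) = beta (th k).
  by apply/funext => i; apply/esym; exact: beta_shift.
have aE k : (fun i j => Num.sqrt (N k) ^+ 2 * kappa (tag (b k)) i j)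
    = @weight R p m (n (tag (b k))) s2.
  apply/funext => i; apply/funext => j.
  rewrite sqr_sqrtr ?ltW// /kappa /weight -/(N k); field.
  by apply/andP; split; rewrite gt_eqF//; exact: (N0 k).
have yE k : (fun i j => alpha (theta_ (tag (b k))) i + beta (theta_ (tag (b k))) i * x k j
      + scaled_mean (e k) i j / Num.sqrt (N k))
    = sample_mean (observations (theta_ (tag (b k))) (x k) (e k)).
  apply/funext => i; apply/funext => j; rewrite sample_mean_observations//.
  by rewrite /scaled_mean -/(N k) mulrAC mulfV ?mul1r// gt_eqF// sqrtr_gt0.
have better k := mle_profile_le hs2x hs2 (theta_ (tag (b k))) (x k) (bmle k).
have foc k c := mle_score hs2x hs2 c (bmle k).
have TE k := bias_informationE hs2x hs2
  (observations (theta_ (tag (b k))) (x k) (e k)) (th k).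
have rootgt0 k : 0 < Num.sqrt (N k) by rewrite sqrtr_gt0.
have kappa0 k i j : 0 < kappa (tag (b k)) i j.
  by apply: divr_gt0 => //; apply: divr_gt0; [rewrite ltr0n|exact: (N0 k)].
have wgt0 i j : 0 < w i / s2 i j by rewrite divr_gt0.
have be1 k : beta (theta_ (tag (b k))) i0 = 1 by [].
have better' k : profile_criterion s2x
    (fun i j => Num.sqrt (N k) ^+ 2 * kappa (tag (b k)) i j)
    (fun i => beta (theta_ (tag (b k))) i + \sum_c dl k c * db c i)
    (fun i j => alpha (theta_ (tag (b k))) i + beta (theta_ (tag (b k))) i * x k j
      + scaled_mean (e k) i j / Num.sqrt (N k))
    (fun i => alpha (theta_ (tag (b k))) i + \sum_c dl k c * da c i)
    (level_mean (th k))
  <= \sum_j (ln (precision s2x (fun i j => Num.sqrt (N k) ^+ 2 * kappa (tag (b k)) i j)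
                  (beta (theta_ (tag (b k)))) j)
       + \sum_i Num.sqrt (N k) ^+ 2 * kappa (tag (b k)) i j
           * (scaled_mean (e k) i j / Num.sqrt (N k)) ^+ 2).
  rewrite aE beE alE yE; apply: le_trans (better k) _; rewrite le_eqVlt; apply/orP; left.
  apply/eqP; apply: eq_bigr => j _; congr (_ + _); apply: eq_bigr => i _.
  rewrite -yE -[weight _ _ _ _]/((fun i j => @weight R p m (n (tag (b k))) s2 i j) i j) -aE.
  by congr (_ * _ ^+ 2); ring.
have foc' k c : bias_score da db s2x
    (fun i j => Num.sqrt (N k) ^+ 2 * kappa (tag (b k)) i j)
    (fun i => beta (theta_ (tag (b k))) i + \sum_c dl k c * db c i)
    (fun i j => alpha (theta_ (tag (b k))) i + beta (theta_ (tag (b k))) i * x k j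
      + scaled_mean (e k) i j / Num.sqrt (N k))
    (fun i => alpha (theta_ (tag (b k))) i + \sum_c dl k c * da c i)
    (level_mean (th k)) c = 0.
  by rewrite aE beE alE yE; exact: foc.
have ref c : da c i0 = 0 /\ db c i0 = 0 by exact: dir_reference.
have [l [Tl Sl]] := @quadratic_forms_merge R 'I_p 'I_m q da db i0 j0 j1 ref (@dir_identifiable R p)
  nat U UU _ _ _ _ _ x _ s2x dl _ (fun i j => z' (i, j)) (beta theta) x' hs2x rootgt0
  (along _ _ (@sqrt_sample_size_cvg)) kappa0 wgt0 (fun i j => along _ _ (@kappa_cvg i j))
  (fun i j => z'P (i, j)) (fun i => along _ _ (@beta_cvg i)) x'P be1 x01 x'01 better' foc'.
(* Both forms tend to the same real [l], so continuity of [f] at [l] closes the gap. *)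
have diff0 : tends U (fun k => `|f (quadratic_form (bias_information s2x s2
        (observations (theta_ (tag (b k))) (x k) (e k)) (th k))
        (bias (th k) - bias (theta_ (tag (b k)))))
   - f (score_form da db (kappa (tag (b k))) (beta (theta_ (tag (b k)))) (x k)
        (scaled_mean (e k)))|) 0.
  rewrite -[X in tends _ _ X](@normr0 R R) -(subrr (f l)); apply: cvg_norm; apply: cvgB.
    apply: (@cvg_comp _ _ _ _ f U _ _ _ (fc l)).
    apply: tends_eq Tl => // k; rewrite quadratic_formE TE; apply: eq_bigr => c _.
    by apply: eq_bigr => c' _; rewrite aE beE alE yE.
  exact: (@cvg_comp _ _ _ _ f U _ _ Sl (fc l)).
suff : eps <= 0 by rewrite leNgt eps0.
by refine (tends_ge ultra_proper _ diff0) => k; rewrite ltW// bfar.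
Unshelve. all: by end_near. Qed.
End Sequence.

(** * Measurability and comparison of expectations *)

Ltac msr :=
  lazymatch goal with
  | |- measurable_fun _ (fun t => @?f t + @?g t) => refine (@measurable_funD _ _ _ _ f g _ _); msr
  | |- measurable_fun _ (fun t => - @?f t) => refine (@measurable_funN _ _ _ _ f _); msr
  | |- measurable_fun _ (fun t => @?f t * @?g t) => refine (@measurable_funM _ _ _ _ f g _ _); msr
  | |- measurable_fun _ (fun t => @?f t ^+ ?k) => refine (@measurable_funX _ _ _ _ f k _); msr
  | |- measurable_fun _ (fun t => (@?f t)^-1) => refine (@measurable_funV _ _ _ f _); msr
  | |- measurable_fun _ (fun t => \sum_(i <- ?s) @?f t i) =>
       refine (@measurable_sum _ _ _ _ _ s (fun i t => f t i) _); let i := fresh "i" in intros i; msr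
  | |- _ => first [solve [eauto] | exact: measurable_cst]
  end.

Section Measurability.
Variables (R : realType) (d : measure_display) (T : measurableType d).
Variables (I J : finType) (q : nat) (da db : 'I_q -> I -> R).

Lemma measurable_bias_obs_info (s : J -> R) (a : I -> J -> R)
    (y : T -> I -> J -> R) (al b : T -> I -> R) (mu : T -> J -> R) c e :
  (forall i j, measurable_fun [set: T] (fun t => y t i j)) ->
  (forall i, measurable_fun [set: T] (fun t => al t i)) ->
  (forall i, measurable_fun [set: T] (fun t => b t i)) ->
  (forall j, measurable_fun [set: T] (fun t => mu t j)) ->
  measurable_fun [set: T]
    (fun t => bias_obs_info da db s a (b t) (y t) (al t) (mu t) c e).
Proof.
move=> my mal mb mmu.
have mp j : measurable_fun [set: T] (fun t => precision s a (b t) j).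
  by rewrite /precision; msr.
have mu' j : measurable_fun [set: T] (fun t => latent_mean s a (b t) (y t) (al t) (mu t) j).
  by rewrite /latent_mean; msr.
have mtg e' i j : measurable_fun [set: T]
    (fun t => tangent da db (latent_mean s a (b t) (y t) (al t) (mu t)) e' i j).
  by rewrite /tangent; msr.
have ms e' j : measurable_fun [set: T]
    (fun t => latent_slope da db s a (b t) (y t) (al t) (mu t) e' j).
  by rewrite /latent_slope /misfit; msr.
rewrite (_ : (fun t => _) = fun t => \sum_j
  ((\sum_i a i j * db c i * db e i) / precision s a (b t) j
    - 2 * (\sum_i a i j * b t i * db c i) * (\sum_i a i j * b t i * db e i)
        / precision s a (b t) j ^+ 2
    + \sum_i a i j * tangent da db (latent_mean s a (b t) (y t) (al t) (mu t)) c i j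
         * tangent da db (latent_mean s a (b t) (y t) (al t) (mu t)) e i j
    - latent_slope da db s a (b t) (y t) (al t) (mu t) c j
        * latent_slope da db s a (b t) (y t) (al t) (mu t) e j
        / precision s a (b t) j)); last by apply/funext => t; rewrite mxE.
by msr.
Qed.

Lemma measurable_residual (k : I -> J -> R) (b : I -> R) (x : T -> J -> R) c i j :
  (forall j, measurable_fun [set: T] (fun t => x t j)) ->
  measurable_fun [set: T] (fun t => residual da db k b (x t) c i j).
Proof. by move=> mx; rewrite /residual /leverage /tangent; msr. Qed.
End Measurability.

Section TestStatistic.
Variables (R : realType) (p m : nat) (n : 'I_p -> nat).
Variables (s2x : 'I_m -> R) (s2 : 'I_p -> 'I_m -> R) (theta : param R p m).
Hypothesis hs2x : forall j, 0 < s2x j.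
Hypothesis hs2 : forall i j, 0 < s2 i j.
Variables (d : measure_display) (T : measurableType d).
Variables (y : T -> sample R m n) (th : T -> param R p m).
Arguments y : clear implicits.

(** The closed form of the information replaces second derivatives by a rational function of the
    sample means and of the coordinates of the estimator. *)
Lemma measurable_test_statistic :
  (forall i j k, measurable_fun [set: T] (fun t => y t i j k)) ->
  random_vector th ->
  measurable_fun [set: T] (fun t =>
    quadratic_form (bias_information s2x s2 (y t) (th t)) (bias (th t) - bias theta)).
Proof.
move=> my mth.
have mdiff c : measurable_fun [set: T] (fun t => (bias (th t) - bias theta) 0 c).
  rewrite (_ : (fun t => _) = fun t => th t 0 (rshift m c) - theta 0 (rshift m c)).
    by have mc := mth (rshift m c); msr.
  by apply/funext => t; rewrite /bias !mxE.
have mal i : measurable_fun [set: T] (fun t => alpha (th t) i).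
  rewrite (_ : (fun t => _) = fun t => alpha theta i
      + \sum_c (bias (th t) - bias theta) 0 c * @alpha_dir R p c i); first by msr.
  by apply/funext => t; exact: alpha_shift.
have mbe i : measurable_fun [set: T] (fun t => beta (th t) i).
  rewrite (_ : (fun t => _) = fun t => beta theta i
      + \sum_c (bias (th t) - bias theta) 0 c * @beta_dir R p c i); first by msr.
  by apply/funext => t; exact: beta_shift.
have mmu j : measurable_fun [set: T] (fun t => level_mean (th t) j).
  rewrite (_ : (fun t => _) = fun t => th t 0 (lshift _ j)); first exact: mth.
  by apply/funext => t; rewrite /level_mean mxE.
have mybar i j : measurable_fun [set: T] (fun t => sample_mean (y t) i j).
  by rewrite /sample_mean; msr.
rewrite (_ : (fun t => _) = fun t => \sum_c \sum_e (bias (th t) - bias theta) 0 c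
  * bias_obs_info (@alpha_dir R p) (@beta_dir R p) s2x (@weight R p m n s2) (beta (th t))
      (sample_mean (y t)) (alpha (th t)) (level_mean (th t)) c e
  * (bias (th t) - bias theta) 0 e); last first.
  by apply/funext => t; rewrite quadratic_formE bias_informationE.
have mb c e := @measurable_bias_obs_info R d T 'I_p 'I_m _ (@alpha_dir R p) (@beta_dir R p)
  s2x (@weight R p m n s2) _ _ _ _ c e mybar mal mbe mmu.
by msr.
Qed.
End TestStatistic.

Lemma bounded_integrable (R : realType) (d : measure_display) (T : measurableType d)
    (P : probability T R) (f : T -> R) (C : R) :
  measurable_fun [set: T] f -> (forall t, `|f t| <= C) ->
  P.-integrable setT (EFin \o f).
Proof.
move=> mf fC; apply: measurable_bounded_integrable => //.
  by apply: le_lt_trans (ltry 1); exact: probability_le1.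
exists C; split; first exact: num_real.
by move=> C' /ltW CC' t _; exact: le_trans (fC t) CC'.
Qed.

(** The integrands differ by at most [eps] on [G] and by at most 2 K off it. *)
Lemma expectation_close (R : realType) (d : measure_display) (T : measurableType d)
    (P : probability T R) (g h : T -> R) (G : set T) (K eps eta : R) :
  measurable_fun [set: T] g -> measurable_fun [set: T] h ->
  (forall t, `|g t| <= K) -> (forall t, `|h t| <= K) ->
  measurable G -> 0 <= eps -> (forall t, G t -> `|g t - h t| <= eps) ->
  (P (~` G) <= eta%:E)%E ->
  `|\int[P]_t g t - \int[P]_t h t| <= eps + 2 * K * eta.
Proof.
move=> mg mh gK hK mG eps0 ghG PG.
have K0 : 0 <= K by apply: le_trans (gK point); exact: normr_ge0.
have ig := bounded_integrable P mg gK; have ih := bounded_integrable P mh hK.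
have mGc : measurable (~` G) by exact: measurableC.
have m1 : measurable_fun [set: T] (\1_(~` G) : T -> R) by exact: measurable_indic.
have i1 : P.-integrable setT (EFin \o (\1_(~` G) : T -> R)).
  apply: (bounded_integrable P (C := 1)) => // t; rewrite indicE.
  by case: (_ \in _); rewrite ?normr1 ?normr0.
have igh : P.-integrable setT (EFin \o (fun t => g t - h t)).
  apply: (bounded_integrable P (C := (K + K))); first by msr.
  by move=> t; apply: le_trans (ler_normB _ _) _; exact: lerD.
have inrm : P.-integrable setT (EFin \o (fun t => `|g t - h t|)).
  apply: (bounded_integrable P (C := (K + K))).
    by apply: measurableT_comp => //; msr.
  by move=> t; rewrite normr_id; apply: le_trans (ler_normB _ _) _; exact: lerD.
have ibd : P.-integrable setT (EFin \o (fun t => eps + 2 * K * \1_(~` G) t)).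
  apply: (bounded_integrable P (C := (eps + 2 * K))); first by msr.
  move=> t; rewrite ger0_norm ?addr_ge0 ?mulr_ge0// lerD2l indicE.
  by case: (_ \in _); rewrite ?mulr1 ?mulr0 ?mulr_ge0.
rewrite -RintegralB//; apply: le_trans; first exact: (le_normr_Rintegral measurableT igh).
apply: (@le_trans _ _ (\int[P]_t (eps + 2 * K * \1_(~` G) t))).
  apply: le_Rintegral => // t _; rewrite indicE; case: (boolP (t \in _)) => Gt.
    rewrite mulr1; apply: le_trans (ler_normB _ _) _.
    by have := gK t; have := hK t; lra.
  rewrite mulr0 addr0; apply: ghG; apply: contrapT => nGt.
  by move/negP: Gt; apply; rewrite inE.
rewrite RintegralD//; last 2 first.
- by apply: (bounded_integrable P (C := eps)) => // t; rewrite ger0_norm.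
- apply: (bounded_integrable P (C := (2 * K))); first by msr.
  move=> t; rewrite ger0_norm ?mulr_ge0// indicE.
  by case: (_ \in _); rewrite ?mulr1 ?mulr0 ?mulr_ge0.
have PT : fine (P [set: T]) = 1 by rewrite probability_setT.
rewrite Rintegral_cst// [X in eps * X](_ : _ = 1) ?mulr1 ?lerD2l ?RintegralZl//.
rewrite ler_wpM2l ?mulr_ge0// /Rintegral integral_indic// setIT.
by rewrite -lee_fin fineK// fin_num_measure.
Qed.

Lemma union_bound (R : realType) (d : measure_display) (T : measurableType d)
    (P : probability T R) (I : finType) (F : I -> set T) (eps : R) :
  (forall i, measurable (F i)) -> (forall i, P (F i) <= eps%:E)%E ->
  measurable [set t | exists i, F i t] /\
  (P [set t | exists i, F i t] <= (#|I|%:R * eps)%:E)%E.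
Proof.
move=> mF PF.
have seqP (s : seq I) : measurable [set t | exists2 i, i \in s & F i t] /\
    (P [set t | exists2 i, i \in s & F i t] <= ((size s)%:R * eps)%:E)%E.
  elim: s => [|i s [ms Ps]].
    rewrite (_ : mkset _ = set0); last by apply/seteqP; split => // t [].
    by rewrite measure0 mul0r.
  rewrite (_ : mkset _ = F i `|` [set t | exists2 i, i \in s & F i t]).
    split; first exact: measurableU.
    apply: le_trans (measureU2 _ _ _) _ => //.
    rewrite (_ : (_ * eps)%:E = (eps%:E + ((size s)%:R * eps)%:E)%E).
      by apply: leeD; [exact: PF|exact: Ps].
    by rewrite -EFinD /= -natr1; congr EFin; ring.
  apply/seteqP; split => t /=.
    by move=> [k]; rewrite inE => /orP[/eqP ->|ks Fk]; [left|right; exists k].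
  by move=> [Fi|[k ks Fk]]; [exists i; rewrite ?inE ?eqxx|exists k; rewrite ?inE ?ks ?orbT].
have [] := seqP (enum I); rewrite -cardE => mE PE.
rewrite (_ : mkset _ = [set t | exists2 i, i \in enum I & F i t]) //.
apply/seteqP; split => t /=; first by move=> [i Fi]; exists i => //; rewrite mem_enum.
by move=> [i _ Fi]; exists i.
Qed.

Lemma measurable_norm_gt (R : realType) (d : measure_display) (T : measurableType d)
    (f : T -> R) (M : R) : measurable_fun [set: T] f ->
  measurable [set t | M < `|f t|].
Proof.
move=> mf; have mn : measurable_fun [set: T] (fun t => `|f t|) by exact: measurableT_comp.
rewrite (_ : mkset _ = [set: T] `&` (fun t => `|f t|) @^-1` `]M, +oo[%classic).
  exact: mn.
by apply/seteqP; split => t; rewrite /= in_itv/= andbT; [|case].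
Qed.

Lemma measurable_norm_lt (R : realType) (d : measure_display) (T : measurableType d)
    (f : T -> R) (M : R) : measurable_fun [set: T] f ->
  measurable [set t | `|f t| < M].
Proof.
move=> mf; have mn : measurable_fun [set: T] (fun t => `|f t|) by exact: measurableT_comp.
rewrite (_ : mkset _ = [set: T] `&` (fun t => `|f t|) @^-1` `]-oo, M[%classic).
  exact: mn.
by apply/seteqP; split => t; rewrite /= in_itv/=; [|case].
Qed.

(** * Probability of the good event *)

Section Tightness.
Variables (R : realType) (d : nat -> measure_display).
Variables (T : forall v, measurableType (d v)) (P : forall v, probability (T v) R).

Definition tight (f : forall v, T v -> R) : Prop := forall eps : R, 0 < eps ->
  exists M : R, \forall v \near \oo, (P v [set t | (M < `|f v t|)%R] <= eps%:E)%E.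

Lemma tight_normal_bound (f : forall v, T v -> R) (c k : R) : 0 < k ->
  (forall v, measurable_fun [set: T v] (f v)) ->
  (\forall v \near \oo, exists Z : T v -> R, [/\ measurable_fun [set: T v] Z,
     forall A, measurable A -> P v (Z @^-1` A) = normal_prob 0 1 A &
     forall t, `|f v t| <= c + k * `|Z t| ]) -> tight f.
Proof.
move=> k0 mf fZ eps eps0.
have [M M0 tail] := probability_tail (@normal_prob R 0 1) eps0.
exists (c + k * M); near=> v.
have [Z [mZ lawZ fZv]] : exists Z : T v -> R, [/\ measurable_fun [set: T v] Z,
     forall A, measurable A -> P v (Z @^-1` A) = normal_prob 0 1 A &
     forall t, `|f v t| <= c + k * `|Z t| ] by near: v.
have mtail : measurable [set u : R | M < `|u|] by exact: (measurable_norm_gt (f := id)).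
apply: (@le_trans _ _ (P v (Z @^-1` [set u | M < `|u|]))); last by rewrite lawZ.
apply: le_measure; rewrite ?inE; [exact: measurable_norm_gt|exact: (measurable_norm_gt (f := Z))|].
move=> t /= lt; have := lt_le_trans lt (fZv t).
by rewrite ltrD2l ltr_pM2l.
Unshelve. all: by end_near. Qed.

Lemma tight_family (I : finType) (f : I -> forall v, T v -> R) (eps : R) :
  (forall i v, measurable_fun [set: T v] (f i v)) -> (forall i, tight (f i)) ->
  0 < eps -> exists M : R, \forall v \near \oo, forall i,
    (P v [set t | (M < `|f i v t|)%R] <= eps%:E)%E.
Proof.
move=> mf ft eps0.
have /choice[M MP] := fun i => ft i _ eps0.
exists (\sum_i `|M i|); apply: filter_forall => i; near=> v.
apply: le_trans (_ : (P v [set t | (M i < `|f i v t|)%R] <= _)%E); last by near: v; exact: MP.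
apply: le_measure; rewrite ?inE; try exact: measurable_norm_gt.
move=> t /=; apply: le_lt_trans; apply: le_trans (ler_norm _) _.
by rewrite (bigD1 i)//= lerDl sumr_ge0.
Unshelve. all: by end_near. Qed.
End Tightness.

Section GoodEvent.
Variables (R : realType) (p m : nat).
Hypotheses (hp : (2 <= p)%N) (hm : (2 <= m)%N).
Variables (s2x : 'I_m -> R) (s2 : 'I_p -> 'I_m -> R).
Hypothesis hs2x : forall j, 0 < s2x j.
Hypothesis hs2 : forall i j, 0 < s2 i j.
Variables (w : 'I_p -> R) (n : nat -> 'I_p -> nat).
Hypothesis hw : forall i, 0 < w i.
Hypothesis hn : forall i, n v i @[v --> \oo] --> \oo.
Hypothesis hnw : forall i,
  (n v i)%:R / (\sum_(i' < p) n v i')%N%:R @[v --> \oo] --> w i.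
Variables (theta : param R p m) (theta_ : nat -> param R p m).
Hypothesis htheta : theta_ v @[v --> \oo] --> theta.
Variables (d : nat -> measure_display) (T : forall v, measurableType (d v)).
Variables (P : forall v, probability (T v) R).
Variables (x : forall v, 'I_m -> {RV (P v) >-> R}).
Variables (e : forall v (i : 'I_p), 'I_m -> 'I_(n v i) -> {RV (P v) >-> R}).
Arguments e : clear implicits.
Hypothesis hmodel : forall v, model_sources s2x s2 (theta_ v) (x v) (e v).

Let zeta v i j (t : T v) : R := scaled_mean (fun i j k => e v i j k t) i j.

Lemma measurable_scaled_mean i j v : measurable_fun [set: T v] (zeta i j).
Proof.
rewrite /zeta /scaled_mean /sample_mean.
have me k : measurable_fun [set: T v] (e v i j k) by [].
by msr.
Qed.

Lemma tight_levels j : tight P (fun v => x v j).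
Proof.
(* The level means converge, so they are eventually within 1 of their limits. *)
apply: (@tight_normal_bound _ _ _ _ _ (`|theta 0 (lshift _ j)| + 1) (Num.sqrt (s2x j))).
- by rewrite sqrtr_gt0.
- by move=> v.
near=> v; have iX := std_levels_indep hs2x hs2 (hmodel v).
have [_ mX _] := iX.
exists (std_level s2x (theta_ v) (x v) j); split => //.
  by move=> A mA; exact: (@indep_normal_marginal _ _ _ _ _ _ _ _ _ j _ mA iX).
move=> t; rewrite /std_level normrM normfV [X in _ / X]ger0_norm ?sqrtr_ge0//.
rewrite mulrCA mulfV ?mulr1 ?gt_eqF ?sqrtr_gt0//.
rewrite -[X in `|X| <= _](subrK (level_mean (theta_ v) j)).
apply: le_trans (ler_normD _ _) _; rewrite addrC lerD2r.
rewrite /level_mean mxE.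
have : `|theta_ v 0 (lshift _ j) - theta 0 (lshift _ j)| < 1.
  rewrite distrC; near: v.
  by have /cvgrPdist_lt/(_ _ ltr01) := @coord_cvg _ _ _ _ _ htheta (lshift _ j).
have := ler_normD (theta_ v 0 (lshift _ j) - theta 0 (lshift _ j)) (theta 0 (lshift _ j)).
by rewrite subrK; lra.
Unshelve. all: by end_near. Qed.

Lemma tight_scaled_means i j : tight P (fun v => zeta i j).
Proof.
(* In absolute value the scaled mean is sqrt (s2 N / n_i) |Z|, and N / n_i tends to 1 / w_i, hence
   is eventually below 1 / w_i + 1. *)
apply: (@tight_normal_bound _ _ _ _ _ 0 (Num.sqrt (s2 i j * ((w i)^-1 + 1)))).
- by rewrite sqrtr_gt0 mulr_gt0// addr_gt0// invr_gt0.
- by move=> v; exact: measurable_scaled_mean.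
near=> v.
have n0 : forall i, (0 < n v i)%N by near: v; exact: (near_sizes_gt0 hn).
have N0 := sample_size_gt0 R hp n0.
have ni0 : (0 : R) < (n v i)%:R by rewrite ltr0n.
pose f (k : 'I_(n v i)) : error_index m (n v) := existT _ i (j, k).
have fI : injective f by move=> k k' /eqP; rewrite eq_Tagged/= => /eqP [].
have iE := indep_normal_reindex fI (std_errors_indep hs2 (hmodel v)).
have J0 : 0 < \sum_(k < n v i) (1 : R) ^+ 2.
  by rewrite expr1n sumr_const card_ord.
have [Z [mZ lawZ ZE]] := linear_combination_law iE J0.
exists Z; split => // t; rewrite add0r.
rewrite -[leLHS]ger0_norm// -sqrtr_sqr -[X in _ * X]sqrtr_sqr -sqrtrM; last first.
  by rewrite mulr_ge0// ?addr_ge0// ?invr_ge0 ltW.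
rewrite ler_wsqrtr// real_normK ?num_real//.
have -> : zeta i j t ^+ 2 = s2 i j * (sample_size R n v / (n v i)%:R) * Z t ^+ 2.
  have := ZE t; rewrite expr1n sumr_const card_ord => ZE'.
  rewrite /zeta /scaled_mean exprMn sqr_sqrtr ?ltW//.
  have -> : sample_mean (fun i j k => e v i j k t) i j
     = Num.sqrt (s2 i j) * (\sum_k 1 * std_error s2 (e v) (f k) t) / (n v i)%:R.
    rewrite /sample_mean mulr_sumr; congr (_ / _); apply: eq_bigr => k _.
    by rewrite /std_error/= mul1r mulrCA mulfV ?mulr1// gt_eqF// sqrtr_gt0.
  rewrite !exprMn ZE' sqr_sqrtr ?ltW//; field.
  by rewrite gt_eqF.
apply: ler_wpM2r; first exact: sqr_ge0.
apply: ler_wpM2l; first by rewrite ltW.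
rewrite -[leLHS]invf_div.
near: v.
have : ((n v i)%:R / sample_size R n v)^-1 @[v --> \oo] --> (w i)^-1.
  by apply: cvgV; [rewrite gt_eqF|exact: hnw].
move=> /cvgrPdist_lt/(_ _ ltr01); apply: filterS => v; rewrite distrC => h.
by have := ler_norm (((n v i)%:R / sample_size R n v)^-1 - (w i)^-1); lra.
Unshelve. all: by end_near. Qed.

Let j0 : 'I_m := Ordinal (ltnW hm).
Let j1 : 'I_m := Ordinal hm.

(* A linear combination of the levels is known only up to sign from its square,
   hence the two windows. *)
Lemma levels_separated (eps : R) : 0 < eps -> exists2 dt : R, 0 < dt &
  forall v, (P v [set t | (`|x v j0 t - x v j1 t| < dt)%R] <= eps%:E)%E.
Proof.
move=> eps0; pose J := s2x j0 + s2x j1.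
have J0 : 0 < J by rewrite addr_gt0.
have rJ0 : 0 < Num.sqrt J by rewrite sqrtr_gt0.
(* [J] is the variance of the difference of the two levels; each window then has mass at most 2 dt /
   sqrt J = eps / 2. *)
exists (eps * Num.sqrt J / 4); first by rewrite divr_gt0// mulr_gt0.
set dt := _ / 4; have dt0 : 0 < dt by rewrite divr_gt0// mulr_gt0.
move=> v; pose a (j : 'I_m) : R :=
  if j == j0 then Num.sqrt (s2x j0) else if j == j1 then - Num.sqrt (s2x j1) else 0.
have j10 : j1 != j0 by [].
have sum2 (F : 'I_m -> R) : (forall j, j != j0 -> j != j1 -> F j = 0) ->
    \sum_j F j = F j0 + F j1.
  move=> F0; rewrite (bigD1 j0)//= (bigD1 j1)//= big1 ?addr0// => j /andP[h h'].
  exact: F0.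
have aJ : \sum_j a j ^+ 2 = J.
  rewrite sum2 => [|j /negbTE h /negbTE h']; last by rewrite /a h h' expr0n.
  by rewrite /a !eqxx (negbTE j10) sqrrN !sqr_sqrtr// ltW.
have [|Z [mZ lawZ ZE]] := linear_combination_law (a := a) (std_levels_indep hs2x hs2 (hmodel v)).
  by rewrite aJ.
pose c := level_mean (theta_ v) j0 - level_mean (theta_ v) j1.
pose win (c : R) := Z @^-1` [set u | `|c + Num.sqrt J * u| < dt].
have mwin c' : measurable (win c').
  rewrite /win; apply: (measurable_norm_lt (f := fun t => c' + Num.sqrt J * Z t)).
  by msr.
have Pwin c' : (P v (win c') <= (eps / 2)%:E)%E.
  rewrite lawZ; last first.
    by apply: (measurable_norm_lt (f := fun u : R => c' + Num.sqrt J * u)); msr.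
  apply: le_trans (normal_prob_window c' rJ0 dt0) _; rewrite lee_fin /dt.
  rewrite le_eqVlt; apply/orP; left; apply/eqP; field.
  by rewrite gt_eqF.
have mdiff : measurable [set t | `|x v j0 t - x v j1 t| < dt].
  by apply: measurable_norm_lt; apply: measurable_funB.
apply: (@le_trans _ _ (P v (win c `|` win (- c)))).
  apply: le_measure; rewrite ?inE//; first exact: measurableU.
  move=> t /= lt.
  have UE : (x v j0 t - x v j1 t - c) ^+ 2 = (Num.sqrt J * Z t) ^+ 2.
    rewrite exprMn sqr_sqrtr ?ltW// -aJ -ZE; congr (_ ^+ 2).
    rewrite sum2 => [|j /negbTE h /negbTE h']; last by rewrite /a h h' mul0r.
    rewrite /a !eqxx (negbTE j10) /std_level /c.
    by field; rewrite !gt_eqF ?sqrtr_gt0.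
  move/eqP: UE; rewrite eqf_sqr => /orP[/eqP UE|/eqP UE]; [left|right].
    by rewrite /win /= -UE addrC subrK.
  rewrite /win /= -normrN opprD opprK -UE.
  by rewrite addrC subrK.
apply: le_trans (measureU2 _ _ _) _ => //.
have -> : eps%:E = ((eps / 2)%:E + (eps / 2)%:E)%E by rewrite -EFinD; congr EFin; field.
by apply: leeD; exact: Pwin.
Qed.

Lemma good_event_probability (eps : R) : 0 < eps -> exists M dt : R, 0 < dt /\
  \forall v \near \oo,
    measurable [set t | good_event hm M dt (x v ^~ t) (fun i j k => e v i j k t)] /\
    (P v (~` [set t | good_event hm M dt (x v ^~ t) (fun i j k => e v i j k t)])
       <= eps%:E)%E.
Proof.
(* [K] counts the events of the union bound: one per level, one per scaled mean, one for the
   separation. *)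
move=> eps0; pose K : R := (m + p * m + 1)%N%:R.
have K0 : 0 < K by rewrite ltr0n addn1.
have epsK : 0 < eps / K by rewrite divr_gt0.
have mx j v : measurable_fun [set: T v] (x v j) by [].
have [M1 M1P] := tight_family mx tight_levels epsK.
have mz (ij : 'I_p * 'I_m) v := @measurable_scaled_mean ij.1 ij.2 v.
have [M2 M2P] := tight_family mz (fun ij => @tight_scaled_means ij.1 ij.2) epsK.
have [dt dt0 dtP] := levels_separated epsK.
exists (Num.max M1 M2), dt; split => //; near=> v.
set G := [set t | _].
pose F1 j := [set t | Num.max M1 M2 < `|x v j t|].
pose F2 (ij : 'I_p * 'I_m) := [set t : T v | Num.max M1 M2 < `|zeta ij.1 ij.2 t|].
pose F3 := [set t | `|x v j0 t - x v j1 t| < dt].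
have mF1 j : measurable (F1 j) by exact: measurable_norm_gt.
have mF2 ij : measurable (F2 ij) by apply: measurable_norm_gt; exact: mz.
have mF3 : measurable F3 by apply: measurable_norm_lt; exact: measurable_funB.
have PF1 j : (P v (F1 j) <= (eps / K)%:E)%E.
  apply: (@le_trans _ _ (P v [set t | M1 < `|x v j t|])); last first.
    by move: j; near: v; exact: M1P.
  apply: le_measure; rewrite ?inE//; first exact: measurable_norm_gt.
  by move=> t /=; apply: le_lt_trans; rewrite le_max lexx.
have PF2 ij : (P v (F2 ij) <= (eps / K)%:E)%E.
  apply: (@le_trans _ _ (P v [set t | M2 < `|zeta ij.1 ij.2 t|])); last first.
    by move: ij; near: v; exact: M2P.
  apply: le_measure; rewrite ?inE//; first by apply: measurable_norm_gt; exact: mz.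
  by move=> t /=; apply: le_lt_trans; rewrite le_max lexx orbT.
have [mU1 PU1] := union_bound mF1 PF1.
have [mU2 PU2] := union_bound mF2 PF2.
set U1 := (X in measurable X) in mU1 PU1.
set U2 := (X in measurable X) in mU2 PU2.
have GE : G = ~` (U1 `|` U2 `|` F3).
  apply/seteqP; split => t /=.
    move=> [h1 h2 h3] [[[j]|[ij]]|].
    - by rewrite /F1 /= ltNge h1.
    - by rewrite /F2 /= ltNge; apply/negP/negPn; exact: h3.
    - by rewrite /F3 /= ltNge h2.
  move=> h; split.
  - move=> j; rewrite leNgt; apply/negP => lt; apply: h; left; left.
    by exists j.
  - rewrite leNgt; apply/negP => lt; apply: h; right.
    exact: lt.
  - move=> i j; rewrite leNgt; apply/negP => lt; apply: h; left; right.
    by exists (i, j).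
have mU : measurable (U1 `|` U2 `|` F3) by apply: measurableU => //; exact: measurableU.
split; first by rewrite GE; exact: measurableC.
rewrite GE setCK; apply: le_trans (measureU2 _ _ _) _ => //; first exact: measurableU.
have -> : eps%:E = ((m%:R * (eps / K))%:E + ((p * m)%N%:R * (eps / K))%:E + (eps / K)%:E)%E.
  rewrite -!EFinD; congr EFin.
  have epsE : eps = K * (eps / K) by rewrite mulrCA mulfV ?mulr1// gt_eqF.
  by rewrite {1}epsE {1}/K !natrD; ring.
apply: leeD; last exact: dtP.
apply: le_trans (measureU2 _ _ _) _ => //.
apply: leeD; first by move: PU1; rewrite card_ord.
by move: PU2; rewrite card_prod !card_ord.
Unshelve. all: by end_near. Qed.
End GoodEvent.

(** * Exact law of the score form *)

Section ChiSquare.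
Variables (R : realType) (p m : nat).
Hypotheses (hp : (2 <= p)%N) (hm : (2 <= m)%N).
Variables (s2x : 'I_m -> R) (s2 : 'I_p -> 'I_m -> R).
Hypothesis hs2 : forall i j, 0 < s2 i j.
Variables (n : nat -> 'I_p -> nat) (v : nat) (theta : param R p m).
Hypothesis n0 : forall i, (0 < n v i)%N.
Variables (d : measure_display) (T : measurableType d) (P : probability T R).
Variables (x : 'I_m -> {RV P >-> R}).
Variables (e : forall (i : 'I_p), 'I_m -> 'I_(n v i) -> {RV P >-> R}).
Arguments e : clear implicits.
Hypothesis hmodel : model_sources s2x s2 theta x e.

Let da := @alpha_dir R p.
Let db := @beta_dir R p.
Let kap := kappa s2 n v.
Let N := sample_size R n v.

Lemma sum_error_index (F : 'I_p -> 'I_m -> R) (G : error_index m (n v) -> R) :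
  \sum_(s : error_index m (n v)) F (tag s) (tagged s).1 * G s
  = \sum_j \sum_i F i j * \sum_k G (existT _ i (j, k)).
Proof.
rewrite exchange_big/=.
transitivity (\sum_i \sum_(jk : 'I_m * 'I_(n v i)) F i jk.1 * G (existT _ i jk)).
  rewrite (@sig_big_dep _ _ _ _ _ xpredT (fun _ => xpredT)
    (fun i jk => F i jk.1 * G (existT _ i jk))).
  by apply: eq_bigr => -[i jk].
apply: eq_bigr => i _.
transitivity (\sum_j \sum_k F i j * G (existT _ i (j, k))).
  by rewrite pair_bigA; apply: eq_bigr => -[j k].
by apply: eq_bigr => j _; rewrite mulr_sumr.
Qed.

(** A scaled mean is sqrt N sqrt s2 / n_i times the sum of its standardized errors, so [coef]
    expresses the score in these errors. As n_i (sqrt N sqrt s2 / n_i)^2 = 1 / kappa, the Gram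
    matrix of [coef] is the information. *)
Let coef (u : m.-tuple R) (c : 'I_(p.-1 + p.-1)) (s : error_index m (n v)) : R :=
  kap (tag s) (tagged s).1
  * residual da db kap (beta theta) (fun j => tnth u j) c (tag s) (tagged s).1
  * (Num.sqrt N * Num.sqrt (s2 (tag s) (tagged s).1) / (n v (tag s))%:R).

(** Distinct levels make the information invertible, whence the condition on the identity; [Z] is
    defined and normal on the whole space. *)
Lemma chi2_score_form : exists2 Z : 'I_(p.-1 + p.-1) -> T -> R,
  indep_normal P (fun t => [tuple x j t | j < m]) Z &
  forall t, x (Ordinal (ltnW hm)) t != x (Ordinal hm) t ->
    \sum_a Z a t ^+ 2 = score_form da db kap (beta theta) (x ^~ t)
      (scaled_mean (fun i j k => e i j k t)).
Proof.
have N0 : 0 < N by exact: sample_size_gt0.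
have nr0 i : (0 : R) < (n v i)%:R by rewrite ltr0n.
(* Every laboratory has at least two errors, since m >= 2 and n_i >= 1, which exceeds the 2 (p - 1)
   bias components. *)
have card : (p.-1 + p.-1 <= #|error_index m (n v)|)%N.
  rewrite card_tagged sumnE big_map big_enum/=.
  apply: (@leq_trans (\sum_(i < p) 2)).
    by rewrite sum_nat_const card_ord muln2 -addnn leq_add ?leq_pred.
  apply: leq_sum => i _; rewrite card_prod !card_ord.
  by rewrite (leq_trans hm)// leq_pmulr.
have mcoef c s : measurable_fun [set: m.-tuple R] (fun u => coef u c s).
  rewrite /coef.
  have mx j : measurable_fun [set: m.-tuple R] (fun u => tnth u j) by exact: measurable_tnth.
  have mr := measurable_residual da db kap (beta theta) c (tag s) (tagged s).1 mx.
  by msr.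
have [Z iZ ZE] := chi2_representation card mcoef (std_errors_indep hs2 hmodel).
exists Z => // t x01; pose xt := fun j => x j t.
have tE : (fun j => tnth [tuple x j t | j < m] j) = xt.
  by apply/funext => j; rewrite tnth_mktuple.
rewrite /score_form; apply: ZE.
- move=> a b; rewrite mxE.
  rewrite (eq_bigr (fun s : error_index m (n v) =>
     (kap (tag s) (tagged s).1 * residual da db kap (beta theta) xt a (tag s) (tagged s).1
      * (kap (tag s) (tagged s).1 * residual da db kap (beta theta) xt b (tag s) (tagged s).1)
      * (Num.sqrt N * Num.sqrt (s2 (tag s) (tagged s).1) / (n v (tag s))%:R) ^+ 2) * 1)); last first.
    by move=> s _; rewrite /coef tE; ring.
  rewrite (sum_error_index (fun i j => kap i j * residual da db kap (beta theta) xt a i j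
      * (kap i j * residual da db kap (beta theta) xt b i j)
      * (Num.sqrt N * Num.sqrt (s2 i j) / (n v i)%:R) ^+ 2) (fun=> 1)).
  apply: eq_bigr => j _; apply: eq_bigr => i _.
  rewrite sumr_const card_ord -mulr_natl mulr1 !exprMn !sqr_sqrtr ?ltW// /kap /kappa -/N.
  by field; rewrite !gt_eqF.
- move=> a; rewrite mxE.
  rewrite (eq_bigr (fun s : error_index m (n v) =>
     (kap (tag s) (tagged s).1 * residual da db kap (beta theta) xt a (tag s) (tagged s).1
      * (Num.sqrt N * Num.sqrt (s2 (tag s) (tagged s).1) / (n v (tag s))%:R))
     * std_error s2 e s t)); last first.
    by move=> s _; rewrite /coef tE.
  rewrite (sum_error_index (fun i j => kap i j * residual da db kap (beta theta) xt a i j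
      * (Num.sqrt N * Num.sqrt (s2 i j) / (n v i)%:R)) (fun s => std_error s2 e s t)).
  apply: eq_bigr => j _; apply: eq_bigr => i _.
  have -> : scaled_mean (fun i j k => e i j k t) i j
      = Num.sqrt N * Num.sqrt (s2 i j) / (n v i)%:R
        * \sum_k std_error s2 e (existT _ i (j, k)) t.
    rewrite /scaled_mean /sample_mean -/N.
    have -> : \sum_k e i j k t = Num.sqrt (s2 i j) * \sum_k std_error s2 e (existT _ i (j, k)) t.
      rewrite mulr_sumr; apply: eq_bigr => k _.
      by rewrite /std_error/= mulrCA mulfV ?mulr1// gt_eqF// sqrtr_gt0.
    by ring.
  by rewrite mulrA.
- apply: (@info_unit _ _ _ _ _ _ (Ordinal (ltnW hp)) (Ordinal (ltnW hm)) (Ordinal hm)) => //.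
  + exact: dir_identifiable.
  + by move=> i j; rewrite /kap /kappa !divr_gt0.
Qed.
End ChiSquare.

(** * Convergence in distribution of the Wald form *)

Theorem corollary3p3 (R : realType) (p m : nat) (hp : (2 <= p)%N)
  (hm : (2 <= m)%N)
  (s2x : 'I_m -> R) (s2 : 'I_p -> 'I_m -> R)
  (hs2x : forall j, 0 < s2x j) (hs2 : forall i j, 0 < s2 i j)
  (w : 'I_p -> R) (hw : forall i, 0 < w i)
  (n : nat -> 'I_p -> nat)
  (hn : forall i, n v i @[v --> \oo] --> \oo)
  (hnw : forall i,
     (n v i)%:R / (\sum_(i' < p) n v i')%N%:R @[v --> \oo] --> w i)
  (theta : param R p m) (theta_ : nat -> param R p m)
  (htheta : theta_ v @[v --> \oo] --> theta)
  (d : nat -> measure_display) (T : forall v, measurableType (d v))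
  (P : forall v, probability (T v) R)
  (x : forall v, 'I_m -> {RV (P v) >-> R})
  (e : forall v (i : 'I_p), 'I_m -> 'I_(n v i) -> {RV (P v) >-> R})
  (hmodel : forall v, model_sources s2x s2 (theta_ v) (x v) (e v))
  (Y : forall v, T v -> sample R m (n v))
  (hY : forall v t, Y v t
     = observations (theta_ v) (fun j => x v j t) (fun i j k => e v i j k t))
  (thetahat : forall v, sample R m (n v) -> param R p m)
  (hmle : \forall v \near \oo, is_mle s2x s2 (thetahat v))
  (hmeas : \forall v \near \oo,
     random_vector (fun t => thetahat v (Y v t)))
  (d' : measure_display) (T' : measurableType d') (P' : probability T' R)
  (z : 'I_(p.-1 + p.-1) -> {RV P' >-> R})
  (hz : standard_normal_vector z) :
  cvg_in_distribution P
    (fun v t =>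
       quadratic_form (bias_information s2x s2 (Y v t) (thetahat v (Y v t)))
         (bias (thetahat v (Y v t)) - bias (theta_ v)))
    P'
    (fun t => \sum_a z a t ^+ 2).
Proof.
pose q := (p.-1 + p.-1)%N.
pose stat v t := quadratic_form (bias_information s2x s2 (Y v t) (thetahat v (Y v t)))
         (bias (thetahat v (Y v t)) - bias (theta_ v)).
have mstat : \forall v \near \oo, measurable_fun [set: T v] (stat v).
  near=> v; apply: measurable_test_statistic => //.
    move=> i j k; rewrite (_ : (fun t => _) = fun t => alpha (theta_ v) i
        + beta (theta_ v) i * x v j t + e v i j k t).
      have mx : measurable_fun [set: T v] (x v j) by [].
      have me : measurable_fun [set: T v] (e v i j k) by [].
      by msr.
    by apply/funext => t; rewrite hY.
  by near: v.
split => //.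
  have mz a : measurable_fun [set: T'] (z a) by [].
  by msr.
move=> f fc [K fK].
have mf : measurable_fun [set: R] f by exact: continuous_measurable_fun.
pose F (u : q.-tuple R) := f (\sum_a tnth u a ^+ 2).
have mF : measurable_fun [set: q.-tuple R] F.
  apply: measurableT_comp => //.
  have mu a : measurable_fun [set: q.-tuple R] (fun u => tnth u a) by exact: measurable_tnth.
  by msr.
have [zlaw zind] := hz.
have zbox (A : 'I_q -> set R) : (forall a, measurable (A a)) ->
    P' [set t | forall a, A a (z a t)] = (\prod_a normal_prob 0 1 (A a))%E.
  move=> mA; have := zind [set: 'I_q]%SET A mA.
  rewrite (_ : mkset _ = [set t | forall a, A a (z a t)]); last first.
    by apply/seteqP; split => t /= h a; [apply: h; rewrite inE|move=> _; exact: h].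
  move=> ->; rewrite (eq_bigl xpredT); last by move=> a; rewrite inE.
  apply: eq_bigr => a _; transitivity (distribution P' (z a) (A a)); first by [].
  by rewrite zlaw// sqrtr1.
have K0 : 0 <= K by apply: le_trans (fK 0); exact: normr_ge0.
have fin (d0 : measure_display) (T0 : measurableType d0) (P0 : probability T0 R) (g : T0 -> R) :
    measurable_fun [set: T0] g -> (\int[P0]_t (f (g t))%:E)%E \is a fin_num.
  move=> mg; apply: (integrable_fin_num measurableT).
  by apply: (bounded_integrable P0 (C := K)) => //; exact: measurableT_comp.
have mzz : measurable_fun [set: T'] (fun t => \sum_a z a t ^+ 2).
  have mz a : measurable_fun [set: T'] (z a) by [].
  by msr.
rewrite -(fineK (fin _ _ _ _ mzz)); apply/fine_cvgP; split.
  by apply: filterS mstat => v; exact: fin.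
apply/cvgrPdist_le => eps eps0.
(* The exceptional event then costs 2 K eta <= eps / 2; the summand 1 covers K = 0. *)
pose eta := eps / (4 * (K + 1)).
have K1 : 0 < 4 * (K + 1) by rewrite mulr_gt0// ltr_wpDl.
have eta0 : 0 < eta by rewrite divr_gt0.
have eps2 : 0 < eps / 2 by rewrite divr_gt0.
have [M [dt [dt0 goodP]]] :=
  good_event_probability hp hm hs2x hs2 hw hn hnw htheta hmodel eta0.
have close := quadratic_forms_close hp hm hs2x hs2 hw hn hnw htheta M fc dt0 eps2.
near=> v.
have n0 : forall i, (0 < n v i)%N by near: v; exact: (near_sizes_gt0 hn).
have [mG PG] : measurable [set t | good_event hm M dt (x v ^~ t) (fun i j k => e v i j k t)] /\
    (P v (~` [set t | good_event hm M dt (x v ^~ t) (fun i j k => e v i j k t)])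
       <= eta%:E)%E by near: v.
have [Z iZ ZE] := chi2_score_form hp hm hs2 n0 (hmodel v).
have [_ mZ boxZ] := iZ.
have mZZ : measurable_fun [set: T v] (fun t => \sum_a Z a t ^+ 2) by msr.
have tupleE (d0 : measure_display) (T0 : measurableType d0) (P0 : probability T0 R)
    (X : 'I_q -> T0 -> R) :
    (\int[P0]_t (f (\sum_a X a t ^+ 2))%:E = \int[P0]_t (F [tuple X a t | a < q])%:E)%E.
  apply: eq_integral => t _; congr (f _)%:E; apply: eq_bigr => a _.
  by rewrite tnth_mktuple.
(* [Z] has at each rank the law of [z], so the limiting expectation can be computed on the space of
   rank [v], next to the statistic. *)
have intE : (\int[P']_t (f (\sum_a z a t ^+ 2))%:E = \int[P v]_t (f (\sum_a Z a t ^+ 2))%:E)%E.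
  apply: etrans (tupleE _ _ P' (fun a => z a)) _.
  apply: etrans _ (esym (tupleE _ _ (P v) Z)).
  apply: expectation_eq_boxes => //; last by exists K => u; exact: fK.
  move=> A mA; rewrite zbox//.
  have := boxZ setT A measurableT mA.
  by rewrite preimage_setT setTI probability_setT mul1e => ->.
have bound : `|\int[P v]_t f (stat v t) - \int[P v]_t f (\sum_a Z a t ^+ 2)|
    <= eps / 2 + 2 * K * eta.
  apply: (expectation_close (G := [set t | good_event hm M dt (x v ^~ t) (fun i j k => e v i j k t)])) => //.
  - by apply: measurableT_comp => //; near: v.
  - exact: measurableT_comp.
  - exact: ltW.
  move=> t good; rewrite /stat /= ZE; last first.
    have [_ sep _] := good.
    by rewrite -subr_eq0 -normr_gt0; exact: lt_le_trans sep.
  (* The comparison holds for any maximizer at any good realization, so it applies pointwise to the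
     estimator. *)
  rewrite [Y v t]hY; apply: (near close v) => //.
  by rewrite -[observations _ _ _]hY; move: (Y v t); near: v.
rewrite intE distrC; apply: le_trans bound _.
rewrite /eta (_ : 2 * K * _ = eps / 2 * (K / (K + 1))); last first.
  by field; rewrite gt_eqF// ltr_wpDl.
have : K / (K + 1) <= 1 by rewrite ler_pdivrMr ?mul1r ?lerDl// ltr_wpDl.
by nra.
Unshelve. all: by end_near. Qed.
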